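(* Let $(M,g)$ be a compact connected pseudo-Kähler manifold with complex-structure tensor $J$, such that the complex manifold $M$ has the $\partial\overline{\partial}$ property. Let $v$ be an affine vector field on $(M,g)$, let $A=\nabla v$ (the bundle endomorphism $w\mapsto\nabla_w v$ of $TM$, with $\nabla$ the Levi-Civita connection of $g$), and let $A^*$ be the pointwise $g$-adjoint of $A$. Then: (a) $A^*=JAJ$; (b) $A-A^*$ commutes with $J$; (c) $A+A^*$ anticommutes with $J$; (d) $A+A^*$ is parallel, and nilpotent at every point; (e) $\operatorname{div} v=0$; (f) $v$ is a Killing field if and only if it is real-holomorphic.
   Context: All manifolds and tensor fields are smooth; manifolds are connected. A pseudo-Kähler manifold is a pseudo-Riemannian manifold $(M,g)$ (the metric $g$ need not be definite) endowed with an almost-complex structure $J$ which is parallel for the Levi-Civita connection $\nabla$ of $g$ and makes $g$ Hermitian, i.e. $g(J\cdot,J\cdot)=g$. Then $J$ is integrable, so $M$ is a complex manifold. A compact complex manifold $M$ has the $\partial\overline{\partial}$ property if, for all integers $p,q\ge 0$, every closed complex-valued $(p,q)$-form on $M$ that is $\partial$-exact or $\overline{\partial}$-exact equals $\partial\overline{\partial}\lambda$ for some $(p-1,q-1)$-form $\lambda$ (in particular it is zero if $p=0$ or $q=0$). A vector field $v$ on $(M,g)$ is affine if its local flow preserves the Levi-Civita connection $\nabla$ (equivalently $\mathcal{L}_v\nabla=0$); it is a Killing field if $\mathcal{L}_v g=0$; it is real-holomorphic if $\mathcal{L}_v J=0$. Here $\mathcal{L}_v$ is the Lie derivative. The divergence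 is $\operatorname{div} v=\operatorname{tr}\nabla v$. *)

(* Defs.v *)
From HB Require Import structures.
From mathcomp Require Import all_boot all_order all_algebra.
From mathcomp Require Import boolp classical_sets functions reals.
From mathcomp Require Import topology normedtype derive.
From mathcomp Require Import complex.

Set Implicit Arguments.
Unset Strict Implicit.
Unset Printing Implicit Defensive.

Import Order.TTheory GRing.Theory Num.Theory.
Import numFieldNormedType.Exports.

Local Open Scope classical_set_scope.
Local Open Scope ring_scope.
Local Open Scope complex_scope.

(** Conventions.

    Every point [x] of a manifold comes with a preferred chart [chart_at x],
    and the tangent space at [x] is ['rV[R]_n] through the coordinate basis of
    that chart.  A section of a tensor bundle is thus a plain function on the
    manifold, and smoothness is tested on its components in the charts of the
    atlas (no continuity of [chart_at] in [x] is needed).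

    Tangent vectors are rows, so an endomorphism [B] sends [w] to [w *m B] and
    the composite "first [B], then [C]" is [B *m C]; a bilinear form [g] is
    [(u, w) |-> u *m g *m w^T]. *)

Section SmoothFunctions.
Context {R : realType} {n : nat} {W : normedModType R}.
Implicit Types (f : 'rV[R]_n -> W) (s : seq 'I_n) (U : set 'rV[R]_n).

Definition basis_vec (i : 'I_n) : 'rV[R]_n := delta_mx 0 i.

Definition iter_partial s f : 'rV[R]_n -> W :=
  foldr (fun i h => 'D_(basis_vec i) h) f s.

(* U is always open below *)
Definition smooth_on U f :=
  forall s x, U x ->
    (forall i, derivable (iter_partial s f) x (basis_vec i)) /\
    {for x, continuous (iter_partial s f)}.

End SmoothFunctions.

(* [chart_map] and [chart_inv] are mutually inverse between [dom] and its image;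
   their values elsewhere are irrelevant *)
Record chart (R : realType) (n : nat) (M : topologicalType) := Chart {
  dom : set M;
  chart_map : M -> 'rV[R]_n;
  chart_inv : 'rV[R]_n -> M }.

Definition chart_image (R : realType) n (M : topologicalType)
  (c : chart R n M) : set 'rV[R]_n := chart_map c @` dom c.

Record is_chart (R : realType) n (M : topologicalType)
    (c : chart R n M) : Prop := IsChart {
  dom_open : open (dom c);
  chart_image_open : open (chart_image c);
  chart_mapK : {in dom c, cancel (chart_map c) (chart_inv c)};
  chart_map_continuous : {in dom c, continuous (chart_map c)};
  chart_inv_continuous : {in chart_image c, continuous (chart_inv c)} }.

Record smooth_structure (R : realType) (n : nat) (M : topologicalType) :=
  SmoothStructure {
  atlas : set (chart R n M);
  chart_at : M -> chart R n M;
  atlas_chart : forall c, atlas c -> is_chart c;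
  atlas_compat : forall c c', atlas c -> atlas c' ->
    smooth_on (chart_map c @` (dom c `&` dom c')) (chart_map c' \o chart_inv c);
  chart_at_atlas : forall x, atlas (chart_at x);
  chart_at_dom : forall x, dom (chart_at x) x }.

Section TensorFields.
Context {R : realType} {n : nat} {M : topologicalType}.
Variable mfd : smooth_structure R n M.
Implicit Types (c : chart R n M) (x : M) (f : M -> R).
Implicit Types (X Y v : M -> 'rV[R]_n) (B J g : M -> 'M[R]_n).

Definition smooth_function f :=
  forall c, atlas mfd c -> smooth_on (chart_image c) (f \o chart_inv c).

(* row i is the coordinate vector d/dx^i of the chart c at x, expressed in the
   basis of the tangent space at x given by [chart_at mfd x] *)
Definition frame c x : 'M[R]_n :=
  \matrix_i 'D_(basis_vec i) (chart_map (chart_at mfd x) \o chart_inv c)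
              (chart_map c x).

Definition vf_in_chart c X (y : 'rV[R]_n) : 'rV[R]_n :=
  X (chart_inv c y) *m invmx (frame c (chart_inv c y)).

Definition smooth_vf X :=
  forall c, atlas mfd c -> smooth_on (chart_image c) (vf_in_chart c X).

Definition smooth_endo B :=
  forall c, atlas mfd c -> forall i j,
    smooth_on (chart_image c)
      (fun y => (frame c (chart_inv c y) *m B (chart_inv c y)
                   *m invmx (frame c (chart_inv c y))) i j : R).

Definition smooth_bilinear g :=
  forall c, atlas mfd c -> forall i j,
    smooth_on (chart_image c)
      (fun y => (frame c (chart_inv c y) *m g (chart_inv c y)
                   *m (frame c (chart_inv c y))^T) i j : R).

(* derivative of f at x in the direction of the tangent vector w at x *)
Definition dir_derive x (w : 'rV[R]_n) f : R :=
  'D_w (f \o chart_inv (chart_at mfd x)) (chart_map (chart_at mfd x) x).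

(* [X, Y] = DY(X) - DX(Y) in the coordinates of the preferred chart at x,
   whose coordinate basis is the basis used for the tangent space at x *)
Definition lie_bracket X Y x : 'rV[R]_n :=
  let c := chart_at mfd x in
  'D_(X x) (vf_in_chart c Y) (chart_map c x)
  - 'D_(Y x) (vf_in_chart c X) (chart_map c x).

Definition pair_with g X Y x : R := (X x *m g x *m (Y x)^T) 0 0.

Record is_pseudo_riemannian g : Prop := IsPseudoRiemannian {
  metric_smooth : smooth_bilinear g;
  metric_sym : forall x, (g x)^T = g x;
  metric_nondegenerate : forall x, g x \in unitmx }.

(* A connection is Y |-> (nabla Y : w |-> nabla_w Y). *)
Definition connection := (M -> 'rV[R]_n) -> M -> 'M[R]_n.

Definition cov (nabla : connection) X Y x : 'rV[R]_n := X x *m nabla Y x.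

Record is_connection (nabla : connection) : Prop := IsConnection {
  nabla_smooth : forall Y, smooth_vf Y -> smooth_endo (nabla Y);
  nablaD : forall Y Z, smooth_vf Y -> smooth_vf Z ->
    forall x, nabla (fun y => Y y + Z y) x = nabla Y x + nabla Z x;
  nabla_leibniz : forall f Y, smooth_function f -> smooth_vf Y ->
    forall x w, w *m nabla (fun y => f y *: Y y) x
              = dir_derive x w f *: Y x + f x *: (w *m nabla Y x) }.

Record is_levi_civita g (nabla : connection) : Prop := IsLeviCivita {
  levi_civita_connection : is_connection nabla;
  torsion_free : forall X Y, smooth_vf X -> smooth_vf Y ->
    forall x, cov nabla X Y x - cov nabla Y X x = lie_bracket X Y x;
  metric_compatible : forall X Y Z,
    smooth_vf X -> smooth_vf Y -> smooth_vf Z ->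
    forall x, dir_derive x (X x) (pair_with g Y Z)
            = pair_with g (cov nabla X Y) Z x
              + pair_with g Y (cov nabla X Z) x }.

(* nabla_w (B Y) = B (nabla_w Y), that is (nabla_w B) Y = 0 *)
Definition parallel_endo (nabla : connection) B :=
  forall Y, smooth_vf Y ->
    forall x, nabla (fun y => Y y *m B y) x = nabla Y x *m B x.

Record is_pseudo_kahler g (nabla : connection) J : Prop := IsPseudoKahler {
  kahler_metric : is_pseudo_riemannian g;
  kahler_levi_civita : is_levi_civita g nabla;
  kahler_J_smooth : smooth_endo J;
  kahler_J_sqr : forall x, J x *m J x = - 1%:M;
  kahler_hermitian : forall x, J x *m g x *m (J x)^T = g x;
  kahler_J_parallel : parallel_endo nabla J }.

(* g(B u, w) = g(u, B^* w), see [adjointP] *)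
Definition adjoint g B x : 'M[R]_n := g x *m (B x)^T *m invmx (g x).

Definition divergence (nabla : connection) v x : R := \tr (nabla v x).

(* (L_v nabla)(X, Y) = [v, nabla_X Y] - nabla_[v, X] Y - nabla_X [v, Y] *)
Definition affine_vf (nabla : connection) v :=
  forall X Y, smooth_vf X -> smooth_vf Y -> forall x,
    lie_bracket v (cov nabla X Y) x
    - cov nabla (lie_bracket v X) Y x
    - cov nabla X (lie_bracket v Y) x = 0.

(* (L_v g)(X, Y) = v (g(X, Y)) - g([v, X], Y) - g(X, [v, Y]) *)
Definition killing_vf g v :=
  forall X Y, smooth_vf X -> smooth_vf Y -> forall x,
    dir_derive x (v x) (pair_with g X Y)
    - pair_with g (lie_bracket v X) Y x
    - pair_with g X (lie_bracket v Y) x = 0.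

(* (L_v J) X = [v, J X] - J [v, X] *)
Definition real_holomorphic_vf J v :=
  forall X, smooth_vf X -> forall x,
    lie_bracket v (fun y => X y *m J y) x - lie_bracket v X x *m J x = 0.

End TensorFields.

Lemma frame_chart_at (R : realType) n (M : topologicalType)
    (mfd : smooth_structure R n M) x : frame mfd (chart_at mfd x) x = 1%:M.
Proof.
have cc := atlas_chart (chart_at_atlas mfd x).
apply/row_matrixP => i; rewrite rowK row1.
rewrite -[RHS](derive_id (chart_map (chart_at mfd x) x)).
apply: near_eq_derive.
have : nbhs (chart_map (chart_at mfd x) x) (chart_image (chart_at mfd x)).
  apply: open_nbhs_nbhs; split; first exact: chart_image_open.
  by exists x => //; exact: chart_at_dom.
by apply: filterS => y [z dz <-] /=; rewrite (chart_mapK cc) // inE.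
Qed.

Lemma adjointP (R : realType) n (M : topologicalType)
    (mfd : smooth_structure R n M) (g B : M -> 'M[R]_n) x (u w : 'rV[R]_n) :
  is_pseudo_riemannian mfd g ->
  u *m B x *m g x *m w^T = u *m g x *m (w *m adjoint g B x)^T.
Proof.
move=> [_ gsym gu]; rewrite /adjoint !trmx_mul trmx_inv gsym trmxK -!mulmxA.
by congr (_ *m _); rewrite (mulmxA (g x)) mulmxV // mul1mx.
Qed.

(** Complex-valued differential forms.

    At [x], a form of degree [k] is evaluated on sequences of [k] vectors of the
    complexified tangent space ['rV[R[i]]_n], and is 0 on sequences of any other
    length, so that forms of one degree are equal iff they are equal as
    functions. *)
Section ComplexForms.
Context {R : realType} {n : nat} {M : topologicalType}.
Variables (mfd : smooth_structure R n M) (J : M -> 'M[R]_n).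
Local Notation CV := 'rV[R[i]]_n.
Local Notation form := (M -> seq CV -> R[i]).
Implicit Types (c : chart R n M) (x : M) (s : seq CV) (omega eta lam : form).

Definition complexify {m p : nat} (A : 'M[R]_(m, p)) : 'M[R[i]]_(m, p) :=
  map_mx (real_complex R) A.

(* omega in the chart c: vectors in s are given by their components in c *)
Definition form_in_chart c omega (y : 'rV[R]_n) s : R[i] :=
  omega (chart_inv c y)
    [seq z *m complexify (frame mfd c (chart_inv c y)) | z <- s].

Record is_form (k : nat) omega : Prop := IsForm {
  form_degree : forall x s, size s != k -> omega x s = 0;
  form_linear : forall x s1 s2 (a : R[i]) (z z' : CV),
    (size s1 + size s2).+1 = k ->
    omega x (s1 ++ (a *: z + z') :: s2)
    = a * omega x (s1 ++ z :: s2) + omega x (s1 ++ z' :: s2);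
  form_alternating : forall x s1 s2 s3 (z : CV),
    omega x (s1 ++ z :: s2 ++ z :: s3) = 0;
  form_smooth : forall c, atlas mfd c -> forall t : seq 'I_n,
    let coeff y :=
      form_in_chart c omega y [seq complexify (basis_vec i) | i <- t] in
    smooth_on (chart_image c) (fun y => complex.Re (coeff y) : R) /\
    smooth_on (chart_image c) (fun y => complex.Im (coeff y) : R) }.

Definition complex_partial (j : 'I_n) (F : 'rV[R]_n -> R[i]) y : R[i] :=
  'D_(basis_vec j) (fun t => complex.Re (F t) : R) y
  +i* 'D_(basis_vec j) (fun t => complex.Im (F t) : R) y.

(* d omega (z_0, ..., z_k) =
   sum_i (-1)^i z_i . (omega (z_0, ..., z_(i-1), z_(i+1), ..., z_k))
   for z_i constant in the coordinates of the preferred chart at x *)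
Definition ext_d omega : form := fun x s =>
  let c := chart_at mfd x in
  \sum_(i < size s) (-1) ^+ i *
    \sum_(j < n) (nth 0 s i) 0 j *
      complex_partial j
        (fun y => form_in_chart c omega y (take i s ++ drop i.+1 s))
        (chart_map c x).

(* the components of z in T^{1,0} = {J z = i z} and T^{0,1} = {J z = -i z} *)
Definition proj_type (b : bool) x (z : CV) : CV :=
  let iJz := 'i *: (z *m complexify (J x)) in
  2^-1 *: (if b then z - iJz else z + iJz).

Definition proj_types (b : seq bool) x s : seq CV :=
  [seq proj_type bz.1 x bz.2 | bz <- zip b s].

Record is_pq_form (p q : nat) omega : Prop := IsPQForm {
  pq_form : is_form (p + q) omega;
  pq_type : forall x (b : seq bool) s,
    size b = (p + q)%N -> size s = (p + q)%N -> count id b != p ->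
    omega x (proj_types b x s) = 0 }.

(* the component of bidegree (p, k - p) of a form of degree k *)
Definition bidegree_part (p : nat) omega : form := fun x s =>
  \sum_(b : (size s).-tuple bool | count id b == p) omega x (proj_types b x s).

(* on a form of bidegree (p, q), the parts of d of bidegrees (p + 1, q) and
   (p, q + 1) *)
Definition del (p : nat) omega : form := bidegree_part p.+1 (ext_d omega).
Definition delbar (p : nat) omega : form := bidegree_part p (ext_d omega).

Definition zero_form : form := fun _ _ => 0.

(* forms of negative bidegree are zero *)
Definition del_exact (p q : nat) omega :=
  if p is p'.+1 then exists2 eta, is_pq_form p' q eta & omega = del p' eta
  else omega = zero_form.

Definition delbar_exact (p q : nat) omega :=
  if q is q'.+1 then exists2 eta, is_pq_form p q' eta & omega = delbar p eta
  else omega = zero_form.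

Definition deldelbar_exact (p q : nat) omega :=
  if (p, q) is (p'.+1, q'.+1) then
    exists2 lam, is_pq_form p' q' lam & omega = del p' (delbar p' lam)
  else omega = zero_form.

Definition deldelbar_property :=
  forall p q omega, is_pq_form p q omega -> ext_d omega = zero_form ->
    del_exact p q omega \/ delbar_exact p q omega ->
    deldelbar_exact p q omega.

End ComplexForms.

(* Main.v *)
Require Import Defs.
From HB Require Import structures.
From mathcomp Require Import all_boot all_order all_algebra.
From mathcomp Require Import boolp classical_sets functions reals.
From mathcomp Require Import interval_inference topology normedtype landau derive realfun sequences exp.
From mathcomp Require Import complex.
From mathcomp Require Import ring lra.

Set Implicit Arguments.
Unset Strict Implicit.
Unset Printing Implicit Defensive.

Import Order.TTheory GRing.Theory Num.Theory.
Import numFieldNormedType.Exports.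

Local Open Scope classical_set_scope.
Local Open Scope ring_scope.

(** Since g may be indefinite, it offers no positivity for an integral argument; the only sign
    available comes from the second-order condition at an extremum of a potential, and being
    parallel is what spreads that sign over M.

    Affinity reads nabla_w A = - R(v, w). The curvature is g-skew and commutes with J, so A + A^*
    and the commutator of A with J are parallel, whereas A itself need not be. The field v is
    replaced by J v because d of g(v, .) only sees the g-skew part of A; after the rotation by J, d
    of g(J v, .) is built from the two parallel tensors alone. For J S v, where S is parallel, only
    the J-invariant part of d is under control: it is a multiple of g(J S^2 ., .), which is why the
    conclusion is S^2 = 0.

    The ddbar property needs closed complex forms. They are obtained from eta, the (1,0)-form with
    real part g(X, .), and the delicate point is that the imaginary part of the (1,1)-component of d
    eta is closed although it is not assumed parallel. *)

(* Write S = A + A^* and let F be d of the 1-form g(X, .).  If the J-anti-invariant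
   part of F is parallel, its (2,0)-component is closed and del-exact, hence zero by the
   ddbar property.  If the J-invariant part of F is parallel, the ddbar property gives it
   a potential lambda.  With H the Hessian of Im lambda at a critical point, the symmetric
   form F(., J.) equals there H + J H J^T: it is negative semidefinite at a maximum of
   Im lambda, positive semidefinite at a minimum.  Being parallel, it is both everywhere,
   so that it vanishes.  For an affine field v, both S and J A - A J are parallel, and
   these vanishing results apply to X = J v, giving A^* = J A J, and then to X = J S v,
   giving S^2 = 0. *)

(** * Directional derivatives *)

Section DirectionalDerivatives.
Context {R : realType} {V : normedModType R}.
Implicit Types (f : V -> R) (x y z v w : V).

Lemma is_derive_line f z v t d :
  is_derive (z + t *: v) v f d ->
  is_derive (t : R^o) 1 (fun s : R^o => f (z + s *: v)) d.
Proof.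
have E : (fun h : R => h^-1 *: (((fun s : R^o => f (z + s *: v)) \o shift (t : R^o))
                                  (h *: 1) - f (z + t *: v)))
       = (fun h : R => h^-1 *: ((f \o shift (z + t *: v)) (h *: v)
                                  - f (z + t *: v))).
  apply/funext => h /=; congr (_ *: (f _ - _)).
  by rewrite /shift /= [h *: 1]mulr1 scalerDl addrCA addrC -addrA.
by move=> [dv <-]; split; [rewrite /derivable E | rewrite /derive E].
Qed.

(** The intermediate point is located only by [|c| <= |a|], so that increments of either sign are
    covered by one statement. *)
Lemma mvt_line f z v (a : R) :
  (forall t : R, `|t| <= `|a| -> derivable f (z + t *: v) v) ->
  exists2 c : R, `|c| <= `|a| & f (z + a *: v) - f z = a * 'D_v f (z + c *: v).
Proof.
move=> df; pose h (s : R) := f (z + s *: v).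
have dh t : `|t| <= `|a| -> is_derive (t : R^o) 1 h ('D_v f (z + t *: v)).
  by move=> ta; apply: is_derive_line; apply: DeriveDef (df _ ta) erefl.
have H b c : b <= c -> (forall t, b <= t <= c -> `|t| <= `|a|) ->
    exists2 d, b <= d <= c & h c - h b = 'D_v f (z + d *: v) * (c - b).
  move=> bc bca; have [||d] := @MVT_segment R h (fun t => 'D_v f (z + t *: v)) b c bc.
  - by move=> t; rewrite in_itv /= => /andP[t0 t1]; apply/dh/bca; rewrite !ltW.
  - apply: derivable_within_continuous => t; rewrite in_itv /= => tbc.
    by have [] := dh t (bca _ tbc).
  - by rewrite in_itv /= => dbc E; exists d.
have hz : h 0 = f z by rewrite /h scale0r addr0.
have [a0|/ltW a0] := leP 0 a.
  have [t /andP[t0 ta]|d dac E] := H 0 a a0; first by rewrite !ger0_norm.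
  exists d; first by case/andP: dac => *; rewrite !ger0_norm.
  by rewrite -hz -/(h a) E subr0 mulrC.
have [t /andP[ta t0]|d dac E] := H a 0 a0; first by rewrite !ler0_norm // lerN2.
exists d; first by case/andP: dac => *; rewrite !ler0_norm // lerN2.
by rewrite -hz -/(h a) -opprB E sub0r mulrN opprK mulrC.
Qed.

End DirectionalDerivatives.

Section Differentiability.
Context {R : realType} {n : nat}.
Implicit Types (f : 'rV[R]_n -> R) (x y z v w : 'rV[R]_n) (U : set 'rV[R]_n).
Local Notation e := (@basis_vec R n).

Lemma coord_le_norm (h : 'rV[R]_n) i : `|h 0 i| <= `|h|.
Proof.
rewrite [leRHS]/Num.Def.normr /= mx_normrE; apply/bigmax_geP; right.
by exists (0, i).
Qed.

Lemma norm_le_coord (h : 'rV[R]_n) (r : R) :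
  0 <= r -> (forall i, `|h 0 i| <= r) -> `|h| <= r.
Proof.
move=> r0 hr; rewrite [leLHS]/Num.Def.normr /= mx_normrE.
by apply/bigmax_leP; split => // -[i j] _ /=; rewrite ord1.
Qed.

Lemma row_sum_basis (h : 'rV[R]_n) : h = \sum_i h 0 i *: e i.
Proof. exact: row_sum_delta. Qed.

Definition head_coords (h : 'rV[R]_n) (k : nat) : 'rV[R]_n :=
  \row_(j < n) (if (j < k)%N then h 0 j else 0).

Lemma head_coordsS (h : 'rV[R]_n) (i : 'I_n) :
  head_coords h i.+1 = head_coords h i + h 0 i *: e i.
Proof.
apply/rowP => j; rewrite !mxE eqxx /= ltnS leq_eqVlt -val_eqE /=.
have [/ord_inj ->|_] := eqVneq (j : nat) i.
  by rewrite ltnn mulr1 add0r.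
by rewrite mulr0 addr0.
Qed.

Lemma norm_head_coords (h : 'rV[R]_n) (i : 'I_n) (t : R) : `|t| <= `|h 0 i| ->
  `|head_coords h i + t *: e i| <= `|h|.
Proof.
move=> th; apply: norm_le_coord => // j; rewrite !mxE eqxx /= -val_eqE /=.
have [/ord_inj ->|_] := eqVneq (j : nat) i.
  by rewrite ltnn mulr1 add0r (le_trans th) ?coord_le_norm.
by rewrite mulr0 addr0; case: ifP => _; rewrite ?normr0 ?coord_le_norm.
Qed.

(** The path from [x] to [x + h] changes one coordinate at a time, and the mean value theorem is
    applied on each edge. In the sup norm every point of the path stays within [|h|] of [x]. *)
Lemma partials_increment f x h :
  (forall y i, `|y - x| <= `|h| -> derivable f y (e i)) ->
  exists2 p : 'I_n -> 'rV[R]_n, forall i, `|p i - x| <= `|h| &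
    f (x + h) - f x = \sum_i h 0 i * 'D_(e i) f (p i).
Proof.
move=> df.
have H (i : 'I_n) : exists2 p, `|p - x| <= `|h| & f (x + head_coords h i.+1)
    - f (x + head_coords h i) = h 0 i * 'D_(e i) f p.
  have E (t : R) : x + head_coords h i + t *: e i - x
      = head_coords h i + t *: e i.
    by rewrite -!addrA addrC -!addrA addNr addr0.
  have [|c c01] := @mvt_line R _ f (x + head_coords h i) (e i) (h 0 i).
    by move=> t t01; apply: df; rewrite E norm_head_coords.
  rewrite head_coordsS addrA => ->.
  by exists (x + head_coords h i + c *: e i); rewrite ?E ?norm_head_coords.
exists (fun i => s2val (cid2 (H i))) => [i|]; first by case: cid2.
transitivity (\sum_(i < n) (f (x + head_coords h i.+1) - f (x + head_coords h i))).
  rewrite -(big_mkord xpredT (fun i => f (x + head_coords h i.+1) - f (x + head_coords h i))).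
  rewrite telescope_sumr //; congr (f (x + _) - f _).
    by apply/rowP => j; rewrite mxE ltn_ord.
  by apply/rowP => j; rewrite !mxE addr0.
by apply: eq_bigr => i _; case: cid2.
Qed.

Definition grad_form f x (h : 'rV[R]_n) : R := \sum_i h 0 i * 'D_(e i) f x.

Lemma grad_form_linear f x : linear (grad_form f x : 'rV[R]_n -> R).
Proof.
move=> a u v; rewrite /grad_form scaler_sumr -big_split /=.
by apply: eq_bigr => i _; rewrite !mxE mulrDl -mulrA.
Qed.

Lemma grad_form_continuous f x : continuous (grad_form f x).
Proof.
apply: continuous_big => [|i _ y]; first exact: add_continuous.
by apply: (@continuousM _ _ (fun h : 'rV[R]_n => h 0 i) (cst _));
  [exact: coord_continuous | exact: cst_continuous].
Qed.

Lemma partials_differentiable f x :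
  (forall i, \forall y \near x, derivable f y (e i)) ->
  (forall i, {for x, continuous ('D_(e i) f)}) ->
  differentiable f x.
Proof.
move=> df cf.
pose L := HB.pack_for {linear 'rV[R]_n -> R} (grad_form f x)
  (GRing.isLinear.Build _ _ _ _ _ (grad_form_linear f x)).
have Lc : continuous L := @grad_form_continuous f x.
have fdL := @diff_unique _ _ _ f L x Lc.
(* The goal becomes the hypothesis of [diff_unique], the little-o expansion of [f] at [x] with
   linear part [L], read off from the type of [fdL]. *)
suff fL : ltac:(match type of fdL with ?P -> _ => exact P end).
  by apply/diff_locallyP; rewrite (fdL fL); split; [exact: Lc | exact: fL].
apply/eqaddoP => _/posnumP[eps].
(* Each of the [n] coordinates contributes at most [|h| * d]; the successor keeps the division
   meaningful for [n = 0]. *)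
pose d := eps%:num / n.+1%:R.
have d0 : 0 < d by rewrite divr_gt0.
have near_df i : \forall y \near x, derivable f y (e i) /\
    `|'D_(e i) f x - 'D_(e i) f y| <= d.
  apply: filterI; first exact: df.
  by move/cvgrPdist_le: (cf i); exact.
have /nbhs_ballP[r r0 rH] : nbhs x [set y | forall i, derivable f y (e i) /\
    `|'D_(e i) f x - 'D_(e i) f y| <= d].
  exact: (@filter_forall _ _ _ (nbhs x) _ near_df).
near=> h.
have hr : `|h| < r.
  near: h; apply/nbhs_ballP; exists r => // h.
  by rewrite -ball_normE /= sub0r normrN.
have {}rH y : `|y - x| <= `|h| -> forall i, derivable f y (e i) /\
    `|'D_(e i) f x - 'D_(e i) f y| <= d.
  move=> yh; apply: rH; rewrite -ball_normE /= distrC; exact: le_lt_trans hr.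
have [|p ph E] := @partials_increment f x h.
  by move=> y i /rH /(_ i)[].
apply: (@le_trans _ _ `|(f (x + h) - f x) - grad_form f x h|).
  rewrite [x + h]addrC -addrA -opprD; exact: lexx.
rewrite E -sumrB.
apply: le_trans (ler_norm_sum _ _ _) _.
apply: (@le_trans _ _ (\sum_(i < n) `|h| * d)).
  apply: ler_sum => i _; rewrite -mulrBr normrM; apply: ler_pM => //.
    exact: coord_le_norm.
  by rewrite distrC; have [] := rH _ (ph i) i.
rewrite sumr_const card_ord -mulr_natl /d mulrCA mulrC ler_wpM2r //.
rewrite mulrCA ler_piMr // ler_pdivrMr // mul1r ler_nat.
by rewrite leqW.
Unshelve. all: by end_near.
Qed.

Lemma derive_sum_partials f x w : differentiable f x ->
  'D_w f x = \sum_i w 0 i * 'D_(e i) f x.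
Proof.
move=> df; rewrite deriveE // {1}(row_sum_basis w) linear_sum.
by apply: eq_bigr => i _; rewrite linearZ /= deriveE.
Qed.

End Differentiability.

(** * Smooth functions on open sets *)

Section FlatFunction.
Context {R : realType}.

(** The factor t^-m makes the family stable under differentiation up to linear combinations, as
    [is_derive_flat] shows; a single function exp (- 1/t) would not be. *)
Definition flat_exp (m : nat) (t : R) : R :=
  if 0 < t then t^-1 ^+ m * expR (- t^-1) else 0.

Lemma flat_ge0 m t : 0 <= flat_exp m t.
Proof.
by rewrite /flat_exp; case: ifP => // t0; rewrite mulr_ge0 ?exprn_ge0 ?expR_ge0 ?invr_ge0 ?ltW.
Qed.

Lemma flat_gt0 m t : 0 < t -> 0 < flat_exp m t.
Proof. by move=> t0; rewrite /flat_exp t0 mulr_gt0 ?exprn_gt0 ?expR_gt0 ?invr_gt0. Qed.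

Lemma flat_eq0 m t : t <= 0 -> flat_exp m t = 0.
Proof. by move=> t0; rewrite /flat_exp ltNge t0. Qed.

(** The exponential series at 1/t dominates its term of order m + 1, one more than the power in
    [flat_exp m]; the extra factor is the [t] of the bound. *)
Lemma flat_le m (t : R) : flat_exp m t <= (m.+1)`!%:R * `|t|.
Proof.
rewrite /flat_exp; case: ltP => [t0|_]; last by rewrite mulr_ge0.
rewrite gtr0_norm // expRN ler_pdivrMr ?expR_gt0 //.
have := @expR_ge1Dxn R t^-1 m; rewrite invr_ge0 ltW // => /(_ isT) H.
have F0 : 0 < (m.+1)`!%:R :> R by rewrite ltr0n fact_gt0.
have H' : t^-1 ^+ m.+1 <= (m.+1)`!%:R * expR t^-1.
  rewrite mulrC -ler_pdivrMr //; apply: le_trans H; rewrite lerDr; exact: ler01.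
rewrite mulrAC -ler_pdivrMr // -exprSr; exact: H'.
Qed.

Lemma flat_cvg0 m : flat_exp m t @[t --> (0 : R)] --> 0.
Proof.
apply: (@squeeze_cvgr _ _ _ _ (fun=> 0) (fun t => (m.+1)`!%:R * `|t|)).
- by near=> t; rewrite flat_ge0 flat_le.
- exact: cvg_cst.
- rewrite -[X in _ --> X](mulr0 (m.+1)`!%:R) -[X in _ * X](@normr0 _ R).
  by apply: cvgMl_tmp; exact: norm_continuous.
Unshelve. all: by end_near. Qed.

Lemma is_derive_flat m (t : R) :
  is_derive (t : R^o) 1 (flat_exp m) (- m%:R * flat_exp m.+1 t + flat_exp m.+2 t).
Proof.
have [t0|t0|->] := ltgtP t 0.
- have E : \forall s \near (t : R^o), cst 0 s = flat_exp m s.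
    by near=> s; rewrite flat_eq0 //; apply: ltW; near: s; exact: lt_nbhsl.
  apply: near_eq_is_derive E _.
  by rewrite !flat_eq0 ?ltW // mulr0 addr0; exact: is_derive_cst.
- have E : \forall s \near (t : R^o), s^-1 ^+ m * expR (- s^-1) = flat_exp m s.
    by near=> s; rewrite /flat_exp ifT //; near: s; exact: lt_nbhsr.
  apply: near_eq_is_derive E _.
  have tn0 : t != 0 by rewrite gt_eqF.
  have dV : is_derive (t : R^o) 1 (fun s : R => s^-1) (- t ^- 2 *: 1).
    exact: is_deriveV.
  have dE : is_derive (t : R^o) 1 (fun s : R => expR (- s^-1))
      (expR (- t^-1) * - (- t ^- 2 *: 1)).
    exact: is_derive1_comp.
  have dM := is_deriveM (is_deriveX m dV) dE.
  rewrite (_ : (fun s => s^-1 ^+ m * expR (- s^-1))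
    = ((fun s : R => s^-1) ^+ m) * (fun s : R => expR (- s^-1))); last first.
    by apply/funext => s; rewrite exprfctE.
  apply: (is_derive_eq dM).
  rewrite /flat_exp t0 exprfctE; set E1 := expR _.
  have sc (a b : R) : a *: b = a * b by [].
  rewrite !sc mulr1 !exprS; case: (m) => [|k] /=.
    by rewrite !mul0r mulr0 oppr0 mul0r add0r addr0 expr0 !mulr1; field.
  by rewrite !exprS -mulNrn; field.
- rewrite !flat_eq0 // mulr0 addr0.
  (* At 0 the difference quotient is the next function of the family, whose limit is already
     known. *)
  have H : (fun h : R => h^-1 *: ((flat_exp m \o shift (0 : R^o)) (h *: 1) - flat_exp m 0))
     = flat_exp m.+1.
    apply/funext => h; rewrite /= addr0 [h *: 1]mulr1 (flat_eq0 _ (lexx 0)) subr0.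
    rewrite /flat_exp; case: ifP => _; last by rewrite scaler0.
    by rewrite exprS -mulrA.
  have c0 : flat_exp m.+1 @ (0 : R)^' --> (0 : R).
    by apply: cvg_trans (flat_cvg0 m.+1); apply: cvg_app; exact: cvg_within.
  split; first by rewrite /derivable H; apply/cvg_ex; exists 0.
  by rewrite /derive H; apply/cvg_lim.
Unshelve. all: by end_near. Qed.

End FlatFunction.

Section SmoothOn.
Context {R : realType} {n : nat}.
Implicit Types (U : set 'rV[R]_n) (x : 'rV[R]_n).
Local Notation e := (@basis_vec R n).

Lemma open_near (W : normedModType R) U (f g : 'rV[R]_n -> W) x :
  open U -> U x -> (forall y, U y -> f y = g y) -> \forall y \near x, f y = g y.
Proof. by move=> oU Ux fg; apply: filterS (open_nbhs_nbhs (conj oU Ux)). Qed.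

Lemma derive_open_eq (W : normedModType R) U (f g : 'rV[R]_n -> W) x v :
  open U -> U x -> (forall y, U y -> f y = g y) -> 'D_v f x = 'D_v g x.
Proof. by move=> oU Ux fg; exact/near_eq_derive/(open_near oU Ux fg). Qed.

Lemma continuous_near_eq (T W : topologicalType) (f g : T -> W) (x : T) :
  (\forall y \near x, f y = g y) -> {for x, continuous f} -> {for x, continuous g}.
Proof.
move=> fg cf; have cfg : g @ x --> f x by apply: cvg_trans cf; exact: near_eq_cvg.
by move: cfg; rewrite (nbhs_singleton fg).
Qed.

(** A class of continuous functions with partial derivatives that is stable under taking partials,
    up to equality on [U], is an invariant for the iteration in [smooth_on]. Smoothness is proved
    below by exhibiting such classes. *)
Lemma smooth_on_coind (W : normedModType R) U (P : ('rV[R]_n -> W) -> Prop) :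
  open U ->
  (forall f x, P f -> U x ->
     (forall i, derivable f x (e i)) /\ {for x, continuous f}) ->
  (forall f i, P f -> exists2 h, P h & forall x, U x -> 'D_(e i) f x = h x) ->
  forall f, P f -> smooth_on U f.
Proof.
move=> oU Preg Pder f Pf.
have H s : exists2 h, P h & forall x, U x -> h x = iter_partial s f x.
  elim: s => [|i s [h Ph hE]]; first by exists f.
  have [k Pk kE] := Pder h i Ph; exists k => // x Ux.
  by rewrite -kE //; exact: derive_open_eq hE.
move=> s x Ux; have [h Ph hE] := H s; have [dh ch] := Preg h x Ph Ux.
have E := open_near oU Ux hE.
by split; [move=> i; exact: near_eq_derivable (dh i) | exact: continuous_near_eq ch].
Qed.

Lemma smooth_on_partial (W : normedModType R) U (f : 'rV[R]_n -> W) i :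
  smooth_on U f -> smooth_on U ('D_(e i) f).
Proof. by move=> sf s; have := sf (rcons s i); rewrite /iter_partial foldr_rcons. Qed.

Lemma smooth_on_subset (W : normedModType R) U V (f : 'rV[R]_n -> W) :
  U `<=` V -> smooth_on V f -> smooth_on U f.
Proof. by move=> UV sf s x /UV; exact: sf. Qed.

Lemma smooth_on_eq (W : normedModType R) U (f g : 'rV[R]_n -> W) :
  open U -> (forall x, U x -> f x = g x) -> smooth_on U f -> smooth_on U g.
Proof.
move=> oU fg sf.
apply: (@smooth_on_coind _ U (fun g => exists2 f, smooth_on U f &
  forall x, U x -> f x = g x)) => //; last by exists f.
- move=> h x [k sk kh] Ux; have E := open_near oU Ux kh.
  have [dk ck] := sk [::] x Ux.
  by split; [move=> i; exact: near_eq_derivable (dk i) | exact: continuous_near_eq ck].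
- move=> h i [k sk kh]; exists ('D_(e i) h) => //.
  exists ('D_(e i) k); first exact: smooth_on_partial.
  by move=> x Ux; exact: derive_open_eq kh.
Qed.

Lemma smooth_on_local (W : normedModType R) U (f : 'rV[R]_n -> W) :
  (forall x, U x -> exists V, [/\ open V, V x & smooth_on V f]) -> smooth_on U f.
Proof. by move=> H s x /H[V [oV Vx]]; apply. Qed.

Lemma smooth_on_derivable (W : normedModType R) U (f : 'rV[R]_n -> W) x i :
  smooth_on U f -> U x -> derivable f x (e i).
Proof. by move=> sf Ux; have [] := sf [::] x Ux. Qed.

Lemma smooth_on_continuous (W : normedModType R) U (f : 'rV[R]_n -> W) x :
  smooth_on U f -> U x -> {for x, continuous f}.
Proof. by move=> sf Ux; have [] := sf [::] x Ux. Qed.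

Lemma smooth_on_differentiable U (f : 'rV[R]_n -> R) x :
  open U -> smooth_on U f -> U x -> differentiable f x.
Proof.
move=> oU sf Ux; apply: partials_differentiable => i.
  apply: filterS (open_nbhs_nbhs (conj oU Ux)) => y Uy.
  exact: smooth_on_derivable sf Uy.
exact: smooth_on_continuous (smooth_on_partial i sf) Ux.
Qed.

Lemma smooth_on_cst U (a : R) : open U -> smooth_on U (fun=> a).
Proof.
move=> oU; apply: (@smooth_on_coind _ U (fun f => exists a, f = cst a)) => //.
- move=> f x [b ->] _; split => [i|]; first exact: derivable_cst.
  exact: cst_continuous.
- move=> f i [b ->]; exists (cst 0); first by exists 0.
  by move=> x _; exact: derive_cst.
- by exists a.
Qed.

End SmoothOn.

(** * Smoothness of composite expressions *)

Section SmoothGen.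
Context {R : realType} {n : nat}.
Implicit Types (U : set 'rV[R]_n) (x : 'rV[R]_n).
Local Notation e := (@basis_vec R n).

Lemma row_decomp (m : nat) (g : 'rV[R]_n -> 'rV[R]_m) :
  g = \sum_(j < m) (fun x => g x 0 j *: basis_vec j).
Proof. by apply/funext => x; rewrite fct_sumE; exact: row_sum_basis. Qed.

Lemma differentiable_row (m : nat) (g : 'rV[R]_n -> 'rV[R]_m) x :
  (forall j, differentiable (fun x => g x 0 j) x) -> differentiable g x.
Proof.
by move=> dg; rewrite (row_decomp g); apply: differentiable_sum => j; exact: differentiableZl.
Qed.

Lemma derive_comp_row (m : nat) (F : 'rV[R]_m -> R) (g : 'rV[R]_n -> 'rV[R]_m) x v :
  differentiable F (g x) -> differentiable g x ->
  'D_v (F \o g) x = 'D_('D_v g x) F (g x).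
Proof.
move=> dF dg; rewrite deriveE; last exact: differentiable_comp.
by rewrite (diff_comp dg dF) [LHS]/= [in RHS]deriveE // (deriveE _ dg).
Qed.

(** The partials of a product or of a composite are sums of products, so the operations cannot be
    treated separately. Closing the smooth functions under all of them at once gives a class stable
    under partials, to which [smooth_on_coind] applies. *)
Inductive smooth_gen U : ('rV[R]_n -> R) -> Prop :=
| smooth_gen_base f : smooth_on U f -> smooth_gen U f
| smooth_gen_add f g :
    smooth_gen U f -> smooth_gen U g -> smooth_gen U (fun x => f x + g x)
| smooth_gen_mul f g :
    smooth_gen U f -> smooth_gen U g -> smooth_gen U (fun x => f x * g x)
| smooth_gen_inv f :
    (forall x, U x -> f x != 0) -> smooth_gen U f ->
    smooth_gen U (fun x => (f x)^-1)
| smooth_gen_flat m f : smooth_gen U f -> smooth_gen U (fun x => flat_exp m (f x))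
| smooth_gen_comp (m : nat) (V : set 'rV[R]_m) (F : 'rV[R]_m -> R)
    (g : 'rV[R]_n -> 'rV[R]_m) :
    open V -> smooth_on V F -> (forall x, U x -> V (g x)) ->
    (forall j, smooth_gen U (fun x => g x 0 j)) ->
    smooth_gen U (fun x => F (g x)).

Lemma smooth_gen_differentiable U f x :
  open U -> smooth_gen U f -> U x -> differentiable f x.
Proof.
move=> oU sf Ux; elim: sf => {f}.
- by move=> f sf; exact: smooth_on_differentiable sf Ux.
- by move=> f g _ df _ dg; exact: differentiableD.
- by move=> f g _ df _ dg; exact: differentiableM.
- by move=> f f0 _ df; apply: differentiableV => //; exact: f0.
- move=> m f _ df; apply: differentiable_comp => //.
  by apply/derivable1_diffP; have [] := is_derive_flat m (f x).
- move=> m V F g oV sF gV _ dg; apply: differentiable_comp.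
    exact: differentiable_row.
  exact: smooth_on_differentiable sF (gV _ Ux).
Qed.

Lemma smooth_gen_sum U (I : Type) (r : seq I) (F : I -> 'rV[R]_n -> R) :
  open U -> (forall i, smooth_gen U (F i)) ->
  smooth_gen U (fun x => \sum_(i <- r) F i x).
Proof.
move=> oU sF; elim: r => [|i r IH].
  under eq_fun do rewrite big_nil.
  by apply: smooth_gen_base; exact: smooth_on_cst.
under eq_fun do rewrite big_cons.
exact: smooth_gen_add.
Qed.

Lemma smooth_gen_partial U f i : open U -> smooth_gen U f ->
  exists2 h, smooth_gen U h & forall x, U x -> 'D_(e i) f x = h x.
Proof.
move=> oU; elim=> {f}.
- move=> f sf; exists ('D_(e i) f) => //.
  exact/smooth_gen_base/smooth_on_partial.
- move=> f g sf [f' sf' fE] sg [g' sg' gE].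
  exists (fun x => f' x + g' x); first exact: smooth_gen_add.
  move=> x Ux; rewrite -fE // -gE // -[LHS]/('D_(e i) (f + g) x) deriveD //.
    exact/diff_derivable/(smooth_gen_differentiable oU sf Ux).
  exact/diff_derivable/(smooth_gen_differentiable oU sg Ux).
- move=> f g sf [f' sf' fE] sg [g' sg' gE].
  exists (fun x => f x * g' x + g x * f' x).
    by apply: smooth_gen_add; exact: smooth_gen_mul.
  move=> x Ux; rewrite -fE // -gE // -[LHS]/('D_(e i) (f * g) x) deriveM //.
    exact/diff_derivable/(smooth_gen_differentiable oU sf Ux).
  exact/diff_derivable/(smooth_gen_differentiable oU sg Ux).
- move=> f f0 sf [f' sf' fE].
  exists (fun x => (-1 * ((f x)^-1 * (f x)^-1)) * f' x).
    apply: smooth_gen_mul => //; apply: smooth_gen_mul.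
      by apply: smooth_gen_base; exact: smooth_on_cst.
    by apply: smooth_gen_mul; exact: smooth_gen_inv.
  move=> x Ux; rewrite -fE // deriveV; last first.
  + exact/diff_derivable/(smooth_gen_differentiable oU sf Ux).
  + exact: f0.
  by rewrite mulN1r -invfM -expr2.
- move=> m f sf [f' sf' fE].
  exists (fun x => (- m%:R * flat_exp m.+1 (f x) + flat_exp m.+2 (f x)) * f' x).
    apply: smooth_gen_mul => //; apply: smooth_gen_add; last exact: smooth_gen_flat.
    apply: smooth_gen_mul; last exact: smooth_gen_flat.
    by apply: smooth_gen_base; exact: smooth_on_cst.
  move=> x Ux; rewrite -fE //.
  have df := smooth_gen_differentiable oU sf Ux.
  have [dm dE] := is_derive_flat m (f x).
  have dm' : differentiable (flat_exp m) (f x) by apply/derivable1_diffP.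
  rewrite -[LHS]/('D_(e i) (flat_exp m \o f) x) deriveE; last exact: differentiable_comp.
  rewrite (diff_comp df dm') [LHS]/= -(deriveE _ df) (deriv1E dm) derive1E dE.
  by rewrite [LHS]mulrC.
- move=> m V F g oV sF gV sg dg.
  (* The induction hypothesis gives a derivative for each component of [g]; choosing one per index
     allows the chain rule to be written as a sum. *)
  pose h j := s2val (cid2 (dg j)).
  have hs j : smooth_gen U (h j) := s2valP (cid2 (dg j)).
  have hE j : forall x, U x -> 'D_(e i) (fun x => g x 0 j) x = h j x :=
    s2valP' (cid2 (dg j)).
  exists (fun x => \sum_j h j x * 'D_(basis_vec j) F (g x)).
    apply: smooth_gen_sum => // j; apply: smooth_gen_mul => //.
    exact: smooth_gen_comp (smooth_on_partial j sF) gV sg.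
  move=> x Ux; have dF := smooth_on_differentiable oV sF (gV _ Ux).
  have dgx : differentiable g x.
    by apply: differentiable_row => j; exact: (smooth_gen_differentiable oU (sg j) Ux).
  rewrite -[LHS]/('D_(e i) (F \o g) x) derive_comp_row // derive_sum_partials //.
  apply: eq_bigr => j _; congr (_ * _); rewrite derive_mx; last exact: diff_derivable.
  by rewrite mxE hE.
Qed.

Lemma smooth_gen_smooth U f : open U -> smooth_gen U f -> smooth_on U f.
Proof.
move=> oU; apply: (smooth_on_coind oU) => [g x sg Ux|g i sg].
  have dg := smooth_gen_differentiable oU sg Ux.
  by split; [move=> i; exact: diff_derivable | exact: differentiable_continuous].
exact: smooth_gen_partial.
Qed.

End SmoothGen.

Section SmoothOps.
Context {R : realType} {n : nat}.
Implicit Types (U : set 'rV[R]_n) (f g : 'rV[R]_n -> R).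

Lemma smooth_onD U f g : open U -> smooth_on U f -> smooth_on U g ->
  smooth_on U (fun x => f x + g x).
Proof.
by move=> oU sf sg; apply: smooth_gen_smooth => //; apply: smooth_gen_add; exact: smooth_gen_base.
Qed.

Lemma smooth_onM U f g : open U -> smooth_on U f -> smooth_on U g ->
  smooth_on U (fun x => f x * g x).
Proof.
by move=> oU sf sg; apply: smooth_gen_smooth => //; apply: smooth_gen_mul; exact: smooth_gen_base.
Qed.

Lemma smooth_onN U f : open U -> smooth_on U f -> smooth_on U (fun x => - f x).
Proof.
move=> oU sf; have := smooth_onM oU (smooth_on_cst (-1) oU) sf.
by under eq_fun do rewrite mulN1r.
Qed.

Lemma smooth_on_sum U (I : Type) (r : seq I) (F : I -> 'rV[R]_n -> R) :
  open U -> (forall i, smooth_on U (F i)) ->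
  smooth_on U (fun x => \sum_(i <- r) F i x).
Proof.
move=> oU sF; apply: smooth_gen_smooth => //; apply: smooth_gen_sum => // i.
exact: smooth_gen_base.
Qed.

Lemma smooth_on_comp m (V : set 'rV[R]_m) U (F : 'rV[R]_m -> R)
    (g : 'rV[R]_n -> 'rV[R]_m) :
  open U -> open V -> smooth_on V F -> (forall x, U x -> V (g x)) ->
  (forall j, smooth_on U (fun x => g x 0 j)) -> smooth_on U (fun x => F (g x)).
Proof.
move=> oU oV sF gV sg; apply: smooth_gen_smooth => //.
by apply: smooth_gen_comp oV sF gV _ => j; exact: smooth_gen_base.
Qed.

Lemma derive_coord (x w : 'rV[R]_n) i : 'D_w (fun y : 'rV[R]_n => y 0 i) x = w 0 i.
Proof.
apply: lim_near_cst => //; near=> h; rewrite /= !mxE addrK [_ *: _]mulKf //.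
by near: h; exact: nbhs_dnbhs_neq.
Unshelve. all: by end_near. Qed.

Lemma smooth_on_coord U i : open U -> smooth_on U (fun x : 'rV[R]_n => x 0 i).
Proof.
move=> oU; apply: (@smooth_on_coind _ _ _ U (fun f => smooth_on U f \/ f = fun x => x 0 i)) => //; last by right.
- move=> f x [sf|->] Ux; first exact: (sf [::]).
  split => [j|]; last exact: coord_continuous.
  exact/diff_derivable/differentiable_coord.
- move=> f j [sf|->]; first by exists ('D_(basis_vec j) f) => //; left; exact: smooth_on_partial.
  exists (fun=> (basis_vec j) 0 i : R); first by left; exact: smooth_on_cst.
  by move=> x _; exact: derive_coord.
Qed.

Lemma smooth_onP m U (f : 'rV[R]_n -> 'rV[R]_m) : open U ->
  smooth_on U f <-> forall j, smooth_on U (fun x => f x 0 j).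
Proof.
move=> oU; split => [sf j|sf].
  apply: (@smooth_on_coind _ _ _ U (fun h => exists2 f : 'rV[R]_n -> 'rV[R]_m,
    smooth_on U f & h = fun x => f x 0 j)) => //; last by exists f.
  - move=> _ x [k sk ->] Ux; have [dk ck] := sk [::] x Ux; split => [i|].
      by have /derivable_mxP := dk i; exact.
    apply: (@continuous_comp _ _ _ k (fun y => y 0 j)); first exact: ck.
    exact: coord_continuous.
  - move=> _ i [k sk ->]; exists (fun x => 'D_(basis_vec i) k x 0 j).
      exists ('D_(basis_vec i) k); [exact: smooth_on_partial | reflexivity].
    move=> x Ux; rewrite [in RHS]derive_mx ?mxE //.
    exact: smooth_on_derivable sk Ux.
apply: (@smooth_on_coind _ _ _ U (fun f : 'rV[R]_n -> 'rV[R]_m =>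
  forall j, smooth_on U (fun x => f x 0 j))) => //.
- move=> k x sk Ux; have dk : differentiable k x.
    by apply: differentiable_row => j; exact: smooth_on_differentiable (sk j) Ux.
  by split; [move=> i; exact: diff_derivable | exact: differentiable_continuous].
- move=> k i sk; exists (fun x => \row_j 'D_(basis_vec i) (fun x => k x 0 j) x).
    move=> j; have := smooth_on_partial i (sk j).
    by apply: smooth_on_eq => // x _; rewrite mxE.
  move=> x Ux; have dk : differentiable k x.
    by apply: differentiable_row => j; exact: smooth_on_differentiable (sk j) Ux.
  rewrite derive_mx; last exact: diff_derivable.
  by apply/rowP => j; rewrite !mxE.
Qed.

End SmoothOps.

(** * Symmetry of second partial derivatives *)

Section Clairaut.
Context {R : realType} {n : nat}.
Implicit Types (U : set 'rV[R]_n) (f g : 'rV[R]_n -> R).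
Local Notation e := (@basis_vec R n).

(** The mean value theorem is used twice: along [e i] for the difference of [f] in direction [e j],
    then along [e j] for the partial derivative of [f]. The radius [2 * |h|] accounts for the two
    steps. *)
Lemma second_difference U f x i j (h : R) : open U -> smooth_on U f ->
  (forall y, `|y - x| <= 2 * `|h| -> U y) ->
  exists2 y, `|y - x| <= 2 * `|h| &
    f (x + h *: e i + h *: e j) - f (x + h *: e i) - (f (x + h *: e j) - f x)
    = h * (h * 'D_(e j) ('D_(e i) f) y).
Proof.
move=> oU sf hU.
have ne k : `|e k| <= 1 :> R.
  apply: norm_le_coord => // l; rewrite !mxE eqxx /=.
  by case: (l == k); rewrite ?normr1 ?normr0.
have nh (s t : R) : `|s| <= `|h| -> `|t| <= `|h| ->
    `|x + s *: e i + t *: e j - x| <= 2 * `|h|.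
  move=> sh th; rewrite -!addrA addrC -!addrA addNr addr0 mulr_natl mulr2n.
  apply: le_trans (ler_normD _ _) _; rewrite !normrZ.
  by apply: lerD; rewrite -[leRHS]mulr1; apply: ler_pM.
have n0 : `|0 : R| <= `|h| by rewrite normr0.
pose g z := f (z + h *: e j) - f z.
have Ug (t : R) : `|t| <= `|h| -> U (x + t *: e i) /\ U (x + t *: e i + h *: e j).
  move=> th; split; apply: hU; last exact: nh.
  by have := nh t 0 th n0; rewrite scale0r addr0.
have dfs z w k : U (z + w) -> is_derive z (e k) (fun y => f (y + w)) ('D_(e k) f (z + w)).
  move=> Uzw; have E : (fun h0 : R => h0^-1 *: (((fun y => f (y + w)) \o shift z) (h0 *: e k) - f (z + w)))
    = (fun h0 => h0^-1 *: ((f \o shift (z + w)) (h0 *: e k) - f (z + w))).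
    by apply/funext => t /=; rewrite /shift /= addrA.
  have dfz := smooth_on_derivable (i := k) sf Uzw.
  by split; [rewrite /derivable E | rewrite /derive E].
have dg (t : R) : `|t| <= `|h| -> is_derive (x + t *: e i) (e i) g
    ('D_(e i) f (x + t *: e i + h *: e j) - 'D_(e i) f (x + t *: e i)).
  move=> th; have [U1 U2] := Ug t th; apply: is_deriveB; first exact: dfs.
  exact/derivableP/(smooth_on_derivable (i := i) sf U1).
have [t th|c ch E] := @mvt_line R _ g x (e i) h; first by have [] := dg t th.
have [_ dgE] := dg c ch; rewrite dgE in E.
have [t th|c' ch' E'] := @mvt_line R _ ('D_(e i) f) (x + c *: e i) (e j) h.
  apply: (smooth_on_derivable (smooth_on_partial i sf)); apply: hU; exact: nh.
exists (x + c *: e i + c' *: e j); first exact: nh.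
by rewrite -E' -E.
Qed.

Lemma clairaut U f x i j : open U -> smooth_on U f -> U x ->
  'D_(e i) ('D_(e j) f) x = 'D_(e j) ('D_(e i) f) x.
Proof.
move=> oU sf Ux; apply/eqP; rewrite -subr_eq0 -normr_le0.
apply/ler_addgt0Pl => _/posnumP[eps]; rewrite addr0.
pose D k l := 'D_(e k) ('D_(e l) f).
have cD k l : \forall y \near x, `|D k l x - D k l y| <= eps%:num / 2.
  have sD := smooth_on_partial k (smooth_on_partial l sf).
  by have /cvgrPdist_le := smooth_on_continuous sD Ux; apply.
have /nbhs_ballP[r /= r0 rH] : nbhs x (U `&` ([set y | `|D i j x - D i j y| <= eps%:num / 2]
    `&` [set y | `|D j i x - D j i y| <= eps%:num / 2])).
  exact: filterI (open_nbhs_nbhs (conj oU Ux)) (filterI (cD i j) (cD j i)).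
pose h := r / 4.
have h0 : 0 < h by rewrite divr_gt0.
have hr y : `|y - x| <= 2 * `|h| -> ball x r y.
  move=> yh; rewrite -ball_normE /= distrC; apply: le_lt_trans yh _.
  rewrite gtr0_norm // /h; lra.
have hU y : `|y - x| <= 2 * `|h| -> U y by move=> /hr /rH [].
have [y1 y1h E1] := second_difference i j oU sf hU.
have [y2 y2h E2] := second_difference j i oU sf hU.
(* The second difference does not depend on the order of the two directions, so the mixed partials
   agree, though at two different points near [x]; continuity brings them back to [x]. *)
have E : D j i y1 = D i j y2.
  apply: (mulfI (lt0r_neq0 h0)); apply: (mulfI (lt0r_neq0 h0)).
  apply: etrans (esym E1) (etrans _ E2); rewrite (addrAC x (h *: e j)).
  have swap (a b c d : R) : a - b - (c - d) = a - c - (b - d) by ring.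
  exact: swap.
have [_ [H1 _]] := rH _ (hr _ y2h); have [_ [_ H2]] := rH _ (hr _ y1h).
rewrite -[X in `|X - _|](subrK (D i j y2)) -addrA.
apply: le_trans (ler_normD _ _) _; rewrite [eps%:num]splitr.
apply: lerD; first exact: H1.
rewrite -E distrC; exact: H2.
Qed.

End Clairaut.

(** * Charts and coordinate frames *)

Section Bump.
Context {R : realType} {n : nat}.
Implicit Types (U : set 'rV[R]_n).

(** The bump is a / (a + b), where [a] vanishes far from [y0] and [b] vanishes near [y0], never both
    at once. The smooth squared Euclidean distance [q] is used inside, and the result is stated in
    the sup norm. *)
Lemma exists_bump U (y0 : 'rV[R]_n) : open U -> U y0 ->
  exists chi : 'rV[R]_n -> R, exists r : R, [/\ smooth_on setT chi,
    \forall y \near y0, chi y = 1,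
    forall y, chi y != 0 -> `|y - y0| <= r &
    forall y, `|y - y0| <= r -> U y].
Proof.
move=> oU Uy0.
have /nbhs_ballP[rho /= rho0 rhoU] := open_nbhs_nbhs (conj oU Uy0).
pose q (y : 'rV[R]_n) := \sum_i (y 0 i - y0 0 i) * (y 0 i - y0 0 i).
(* Halving [rho] puts the closed ball of radius [r] inside [U]. As [2 * d = r ^+ 2], a single
   coordinate of [y - y0] beyond [r] already makes [a] vanish. *)
pose r := rho / 2; pose d := r ^+ 2 / 2.
have r0 : 0 < r by rewrite divr_gt0.
have d0 : 0 < d by rewrite divr_gt0 // exprn_gt0.
have oT : open [set: 'rV[R]_n] by exact: openT.
have sq : smooth_on setT q.
  have sc i : smooth_on setT (fun y : 'rV[R]_n => y 0 i - y0 0 i).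
    by apply: smooth_onD => //; [exact: smooth_on_coord | exact: smooth_on_cst].
  by apply: smooth_on_sum => // i; exact: smooth_onM.
pose a y := flat_exp 0 (2 * d - q y); pose b y := flat_exp 0 (q y - d).
have ga : smooth_gen setT a.
  apply: smooth_gen_flat; apply: smooth_gen_base; apply: smooth_onD => //.
    exact: smooth_on_cst.
  exact: smooth_onN.
have gb : smooth_gen setT b.
  apply: smooth_gen_flat; apply: smooth_gen_base; apply: smooth_onD => //.
  exact: smooth_on_cst.
have ab y : 0 < a y + b y.
  have [qd|dq] := ltP d (q y).
    by apply: ltr_wpDl; [exact: flat_ge0 | apply: flat_gt0; rewrite subr_gt0].
  apply: ltr_pwDl; last exact: flat_ge0.
  by apply: flat_gt0; rewrite subr_gt0 (le_lt_trans dq) // ltr_pMl // ltr1n.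
exists (fun y => a y * (a y + b y)^-1), r; split.
- apply: smooth_gen_smooth => //; apply: smooth_gen_mul => //.
  apply: smooth_gen_inv; first by move=> y _; rewrite gt_eqF.
  exact: smooth_gen_add.
- have cq := smooth_on_continuous sq (I : [set: 'rV[R]_n] y0).
  have q0 : q y0 = 0 by rewrite /q big1 // => i _; rewrite subrr mulr0.
  have qd : nbhs y0 [set y | q y < d].
    have cq0 : q @ y0 --> 0 by rewrite -[X in _ --> X]q0; exact: cq.
    exact: (cq0 _ (lt_nbhsl d0)).
  apply: filterS qd => y qd; have by0 : b y = 0 by apply: flat_eq0; rewrite subr_le0 ltW.
  by have := ab y; rewrite by0 addr0 => ay; rewrite mulfV // gt_eqF.
- move=> y; apply: contraR; rewrite -ltNge => ry.
  have [i ri] : exists i, r < `|(y - y0) 0 i|.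
    apply: contrapT => /forallNP H; move: ry; rewrite ltNge => /negP; apply.
    by apply: norm_le_coord (ltW r0) _ => i; rewrite leNgt; apply/negP/H.
  rewrite /a flat_eq0 ?mul0r // subr_le0 /d mulrC divfK //.
  apply: (@le_trans _ _ ((y 0 i - y0 0 i) * (y 0 i - y0 0 i))).
    rewrite -expr2 -[leRHS]real_normK ?num_real //.
    by rewrite !mxE in ri; apply: lerXn2r; rewrite ?nnegrE ?normr_ge0 ?(ltW r0) ?(ltW ri).
  rewrite /q (bigD1 i) //= lerDl; apply: sumr_ge0 => j _.
  by rewrite -expr2 sqr_ge0.
- move=> y yr; apply: rhoU; rewrite -ball_normE /= distrC; apply: le_lt_trans yr _.
  by rewrite ltr_pdivrMr // ltr_pMr // ltr1n.
Qed.

End Bump.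

Section Charts.
Context {R : realType} {n : nat} {M : topologicalType}.
Variable mfd : smooth_structure R n M.
Implicit Types (c : chart R n M) (x p : M) (f : M -> R) (y w : 'rV[R]_n).
Local Notation e := (@basis_vec R n).
Local Notation atlas := (atlas mfd).
Local Notation chart_at := (chart_at mfd).
Local Notation frame := (frame mfd).

Definition transition c c' : 'rV[R]_n -> 'rV[R]_n := chart_map c' \o chart_inv c.
Definition overlap c c' := chart_map c @` (dom c `&` dom c').
Definition jac c c' y : 'M[R]_n := \matrix_i 'D_(e i) (transition c c') y.

Lemma chart_inv_dom c y : atlas c -> chart_image c y -> dom c (chart_inv c y).
Proof.
by move=> ac [p dp <-]; rewrite (chart_mapK (atlas_chart ac)) // inE.
Qed.

Lemma chart_invK c y : atlas c -> chart_image c y -> chart_map c (chart_inv c y) = y.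
Proof.
by move=> ac [p dp <-]; rewrite (chart_mapK (atlas_chart ac)) // inE.
Qed.

Lemma chart_mapK' c p : atlas c -> dom c p -> chart_inv c (chart_map c p) = p.
Proof. by move=> ac dp; rewrite (chart_mapK (atlas_chart ac)) // inE. Qed.

Lemma image_chart_map c p : dom c p -> chart_image c (chart_map c p).
Proof. by move=> dp; exists p. Qed.

Lemma overlapE c c' y : atlas c ->
  overlap c c' y <-> chart_image c y /\ dom c' (chart_inv c y).
Proof.
move=> ac; split => [[p [dp d'p] <-]|[cy d'y]].
  by rewrite chart_mapK' //; split => //; exact: image_chart_map.
by exists (chart_inv c y); [split => //; exact: chart_inv_dom | exact: chart_invK].
Qed.

Lemma overlap_open c c' : atlas c -> atlas c' -> open (overlap c c').
Proof.
move=> ac ac'; rewrite openE => y /(overlapE c' y ac)[cy d'y].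
have oi := chart_image_open (atlas_chart ac).
have n1 := open_nbhs_nbhs (conj oi cy).
have ci : {for y, continuous (chart_inv c)}.
  by apply: (chart_inv_continuous (atlas_chart ac)); rewrite inE.
have n2 := ci _ (open_nbhs_nbhs (conj (dom_open (atlas_chart ac')) d'y)).
by apply: filterS (filterI n1 n2) => z [z1 z2]; apply/(overlapE c' z ac).
Qed.

Lemma transition_smooth c c' : atlas c -> atlas c' ->
  smooth_on (overlap c c') (transition c c').
Proof. exact: atlas_compat. Qed.

Lemma transition_overlap c c' y : atlas c -> overlap c c' y ->
  overlap c' c (transition c c' y).
Proof.
by move=> ac [p [dp d'p] <-]; rewrite /transition /= chart_mapK' //; exists p.
Qed.

Lemma transition_inv c c' y : atlas c -> atlas c' -> overlap c c' y ->
  chart_inv c' (transition c c' y) = chart_inv c y.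
Proof.
by move=> ac ac' [p [dp d'p] <-]; rewrite /transition /= chart_mapK' // chart_mapK'.
Qed.

Lemma transition_differentiable c c' y : atlas c -> atlas c' -> overlap c c' y ->
  differentiable (transition c c') y.
Proof.
move=> ac ac' cy; have oc := overlap_open ac ac'.
have /(smooth_onP _ oc) sj := transition_smooth ac ac'.
by apply: differentiable_row => j; exact: smooth_on_differentiable (sj j) cy.
Qed.

Lemma jacE c c' y i j : atlas c -> atlas c' -> overlap c c' y ->
  jac c c' y i j = 'D_(e i) (fun z => transition c c' z 0 j) y.
Proof.
move=> ac ac' cy; rewrite mxE derive_mx ?mxE //.
exact/diff_derivable/transition_differentiable.
Qed.

Lemma jac_smooth c c' i j : atlas c -> atlas c' ->
  smooth_on (overlap c c') (fun y => jac c c' y i j).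
Proof.
move=> ac ac'; have oc := overlap_open ac ac'.
have /(smooth_onP _ oc) sj := transition_smooth ac ac'.
apply: smooth_on_eq (smooth_on_partial i (sj j)) => // y cy.
by rewrite jacE.
Qed.

Lemma derive_transition c c' y w : atlas c -> atlas c' -> overlap c c' y ->
  'D_w (transition c c') y = w *m jac c c' y.
Proof.
move=> ac ac' cy; have dt := transition_differentiable ac ac' cy.
rewrite derive_mx; last exact: diff_derivable.
apply/rowP => j; rewrite !mxE; have oc := overlap_open ac ac'.
have /(smooth_onP _ oc) sj := transition_smooth ac ac'.
rewrite derive_sum_partials; last exact: smooth_on_differentiable (sj j) cy.
by apply: eq_bigr => i _; rewrite jacE.
Qed.

Lemma derive_transition_comp c c' (F : 'rV[R]_n -> R) y w :
  atlas c -> atlas c' -> overlap c c' y ->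
  differentiable F (transition c c' y) ->
  'D_w (F \o transition c c') y = 'D_(w *m jac c c' y) F (transition c c' y).
Proof.
move=> ac ac' cy dF; rewrite derive_comp_row ?derive_transition //.
exact: transition_differentiable.
Qed.

Lemma jac_id c y : atlas c -> chart_image c y -> jac c c y = 1%:M.
Proof.
move=> ac cy; apply/row_matrixP => i; rewrite rowK row1 -[RHS](derive_id y).
apply: derive_open_eq cy _; first exact: chart_image_open (atlas_chart ac).
by move=> z cz; exact: chart_invK.
Qed.

Lemma jac_comp c c' c'' p : atlas c -> atlas c' -> atlas c'' ->
  dom c p -> dom c' p -> dom c'' p ->
  jac c c'' (chart_map c p) = jac c c' (chart_map c p) *m jac c' c'' (chart_map c' p).
Proof.
move=> ac ac' ac'' dp d'p d''p; apply/matrixP => i j.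
have o1 : overlap c c' (chart_map c p) by exists p.
have o2 : overlap c c'' (chart_map c p) by exists p.
have o3 : overlap c' c'' (chart_map c' p) by exists p.
have tp : transition c c' (chart_map c p) = chart_map c' p.
  by rewrite /transition /= chart_mapK'.
rewrite jacE //.
have E : \forall z \near chart_map c p, transition c c'' z 0 j
    = ((fun z => transition c' c'' z 0 j) \o transition c c') z.
  apply: filterS (open_nbhs_nbhs (conj (overlap_open ac ac') o1)) => z oz.
  by rewrite /= [in RHS]/transition /= transition_inv.
have oc := overlap_open ac' ac''.
have /(smooth_onP _ oc) sj := transition_smooth ac' ac''.
have dF := smooth_on_differentiable oc (sj j) o3.
rewrite (near_eq_derive _ E) derive_transition_comp ?tp //.
rewrite derive_sum_partials // mxE; apply: eq_bigr => k _.
by rewrite -rowE [X in X * _]mxE (jacE k j ac' ac'' o3).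
Qed.

Lemma frameE c x : frame c x = jac c (chart_at x) (chart_map c x).
Proof. by []. Qed.

(** The frame is the Jacobian from [c] to the preferred chart at [x]; the Jacobian of the reverse
    transition inverts it. *)
Lemma frame_unit c x : atlas c -> dom c x -> frame c x \in unitmx.
Proof.
move=> ac dx; have ax := chart_at_atlas mfd x; have dx' := chart_at_dom mfd x.
have E := jac_comp ac ax ac dx dx' dx.
rewrite jac_id // in E; last exact: image_chart_map.
by have [] := mulmx1_unit (esym E).
Qed.

Lemma frame_jac c c' x : atlas c -> atlas c' -> dom c x -> dom c' x ->
  frame c x = jac c c' (chart_map c x) *m frame c' x.
Proof.
move=> ac ac' dx d'x; rewrite !frameE.
by rewrite (jac_comp ac ac') //; [exact: chart_at_atlas | exact: chart_at_dom].
Qed.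

(** The preferred chart, which may vary arbitrarily with [x], cancels: only a Jacobian between two
    fixed charts is left, and that one is smooth. *)
Lemma frame_frameV c c' x : atlas c -> atlas c' -> dom c x -> dom c' x ->
  frame c x *m invmx (frame c' x) = jac c c' (chart_map c x).
Proof. by move=> *; rewrite (@frame_jac c c') // mulmxK // frame_unit. Qed.

Lemma dir_derive_chart c x w f : atlas c -> dom c x ->
  differentiable (f \o chart_inv c) (chart_map c x) ->
  dir_derive mfd x w f
  = 'D_(w *m invmx (frame c x)) (f \o chart_inv c) (chart_map c x).
Proof.
move=> ac dx df; have ax := chart_at_atlas mfd x; have dx' := chart_at_dom mfd x.
have ox : overlap (chart_at x) c (chart_map (chart_at x) x) by exists x.
have tx : transition (chart_at x) c (chart_map (chart_at x) x) = chart_map c x.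
  by rewrite /transition /= chart_mapK'.
rewrite /dir_derive.
have E : \forall z \near chart_map (chart_at x) x, (f \o chart_inv (chart_at x)) z
    = ((f \o chart_inv c) \o transition (chart_at x) c) z.
  apply: filterS (open_nbhs_nbhs (conj (overlap_open ax ac) ox)) => z oz.
  by rewrite /= transition_inv.
rewrite (near_eq_derive _ E) derive_transition_comp ?tx //.
by rewrite -frame_frameV // frame_chart_at mul1mx.
Qed.

End Charts.

(** * Tensor fields in charts *)

Section SmoothMatrices.
Context {R : realType} {n : nat}.
Implicit Types (U : set 'rV[R]_n).

Definition smooth_mx m p U (F : 'rV[R]_n -> 'M[R]_(m, p)) :=
  forall i j, smooth_on U (fun y => F y i j).

Lemma smooth_mx_eq m p U (F G : 'rV[R]_n -> 'M[R]_(m, p)) : open U ->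
  (forall y, U y -> F y = G y) -> smooth_mx U F -> smooth_mx U G.
Proof. by move=> oU FG sF i j; apply: smooth_on_eq (sF i j) => // y /FG ->. Qed.

Lemma smooth_mxD m p U (F G : 'rV[R]_n -> 'M[R]_(m, p)) : open U ->
  smooth_mx U F -> smooth_mx U G -> smooth_mx U (fun y => F y + G y).
Proof.
move=> oU sF sG i j; under eq_fun do rewrite mxE.
exact: (smooth_onD oU (sF i j) (sG i j)).
Qed.

Lemma smooth_mxN m p U (F : 'rV[R]_n -> 'M[R]_(m, p)) : open U ->
  smooth_mx U F -> smooth_mx U (fun y => - F y).
Proof.
by move=> oU sF i j; under eq_fun do rewrite mxE; exact: (smooth_onN oU (sF i j)).
Qed.

Lemma smooth_mxZ m p U (a : R) (F : 'rV[R]_n -> 'M[R]_(m, p)) : open U ->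
  smooth_mx U F -> smooth_mx U (fun y => a *: F y).
Proof.
move=> oU sF i j; under eq_fun do rewrite mxE.
exact: (smooth_onM oU (smooth_on_cst a oU) (sF i j)).
Qed.

Lemma smooth_mxM m p q U (F : 'rV[R]_n -> 'M[R]_(m, p)) (G : 'rV[R]_n -> 'M[R]_(p, q)) :
  open U -> smooth_mx U F -> smooth_mx U G -> smooth_mx U (fun y => F y *m G y).
Proof.
move=> oU sF sG i j; under eq_fun do rewrite mxE.
by apply: smooth_on_sum => // k; exact: (smooth_onM oU (sF i k) (sG k j)).
Qed.

Lemma smooth_mxT m p U (F : 'rV[R]_n -> 'M[R]_(m, p)) :
  smooth_mx U F -> smooth_mx U (fun y => (F y)^T).
Proof. by move=> sF i j; under eq_fun do rewrite mxE; exact: sF. Qed.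

Lemma smooth_mx_row U (F : 'rV[R]_n -> 'rV[R]_n) : open U ->
  smooth_on U F <-> smooth_mx U F.
Proof.
move=> oU; split => [/(smooth_onP _ oU) sF i j|sF]; first by rewrite ord1.
by apply/(smooth_onP _ oU) => j; exact: sF.
Qed.

End SmoothMatrices.

Section TensorsInCharts.
Context {R : realType} {n : nat} {M : topologicalType}.
Variable mfd : smooth_structure R n M.
Implicit Types (c : chart R n M) (x p : M) (f : M -> R) (y w : 'rV[R]_n).
Implicit Types (X Y : M -> 'rV[R]_n) (B C K : M -> 'M[R]_n).
Local Notation e := (@basis_vec R n).
Local Notation atlas := (atlas mfd).
Local Notation chart_at := (chart_at mfd).
Local Notation frame := (frame mfd).
Local Notation vfc := (vf_in_chart mfd).

Definition endo_in_chart c B y : 'M[R]_n :=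
  frame c (chart_inv c y) *m B (chart_inv c y) *m invmx (frame c (chart_inv c y)).

Definition bil_in_chart c K y : 'M[R]_n :=
  frame c (chart_inv c y) *m K (chart_inv c y) *m (frame c (chart_inv c y))^T.

Lemma image_open c : atlas c -> open (chart_image c).
Proof. by move=> ac; exact: chart_image_open (atlas_chart ac). Qed.

Lemma frame_inv_unit c y : atlas c -> chart_image c y ->
  frame c (chart_inv c y) \in unitmx.
Proof. by move=> ac cy; exact: frame_unit ac (chart_inv_dom ac cy). Qed.

Lemma vf_mul_in_chart c X B y : atlas c -> chart_image c y ->
  vfc c (fun x => X x *m B x) y = vfc c X y *m endo_in_chart c B y.
Proof.
by move=> ac cy; rewrite /vf_in_chart /endo_in_chart !mulmxA mulmxKV // frame_inv_unit.
Qed.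

Lemma endo_mul_in_chart c B C y : atlas c -> chart_image c y ->
  endo_in_chart c (fun x => B x *m C x) y = endo_in_chart c B y *m endo_in_chart c C y.
Proof.
by move=> ac cy; rewrite /endo_in_chart !mulmxA mulmxKV // frame_inv_unit.
Qed.

Lemma bil_mull_in_chart c B K y : atlas c -> chart_image c y ->
  bil_in_chart c (fun x => B x *m K x) y = endo_in_chart c B y *m bil_in_chart c K y.
Proof.
by move=> ac cy; rewrite /endo_in_chart /bil_in_chart !mulmxA mulmxKV // frame_inv_unit.
Qed.

Lemma bil_tr_in_chart c K y :
  bil_in_chart c (fun x => (K x)^T) y = (bil_in_chart c K y)^T.
Proof. by rewrite /bil_in_chart !trmx_mul trmxK mulmxA. Qed.

Lemma bil_add_in_chart c B K y :
  bil_in_chart c (fun x => B x + K x) y = bil_in_chart c B y + bil_in_chart c K y.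
Proof. by rewrite /bil_in_chart mulmxDr mulmxDl. Qed.

Lemma bil_opp_in_chart c K y :
  bil_in_chart c (fun x => - K x) y = - bil_in_chart c K y.
Proof. by rewrite /bil_in_chart mulmxN mulNmx. Qed.

Lemma bil_scale_in_chart c (a : R) K y :
  bil_in_chart c (fun x => a *: K x) y = a *: bil_in_chart c K y.
Proof. by rewrite /bil_in_chart -scalemxAr -scalemxAl. Qed.

Lemma bil_mulr_in_chart c B K y : atlas c -> chart_image c y ->
  bil_in_chart c (fun x => K x *m (B x)^T) y = bil_in_chart c K y *m (endo_in_chart c B y)^T.
Proof.
move=> ac cy; rewrite /endo_in_chart /bil_in_chart !trmx_mul !mulmxA.
set F := frame c _; rewrite -(mulmxA _ F^T (invmx F)^T) -trmx_mul mulVmx ?frame_inv_unit //.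
by rewrite trmx1 mulmx1.
Qed.

Lemma pair_with_in_chart c K X Y y : atlas c -> chart_image c y ->
  pair_with K X Y (chart_inv c y)
  = (vfc c X y *m bil_in_chart c K y *m (vfc c Y y)^T) 0 0.
Proof.
move=> ac cy; rewrite /pair_with /vf_in_chart /bil_in_chart !mulmxA.
by rewrite mulmxKV ?frame_inv_unit // -!mulmxA -trmx_mul mulmxKV ?frame_inv_unit.
Qed.

Lemma smooth_vfP X : smooth_vf mfd X <->
  forall c, atlas c -> smooth_mx (chart_image c) (vfc c X).
Proof.
by split => sX c ac; apply/(smooth_mx_row _ (image_open ac)); exact: sX.
Qed.

Lemma smooth_vfM X B : smooth_vf mfd X -> smooth_endo mfd B ->
  smooth_vf mfd (fun x => X x *m B x).
Proof.
move=> /smooth_vfP sX sB; apply/smooth_vfP => c ac.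
have oc := image_open ac.
apply: (smooth_mx_eq oc _ (smooth_mxM oc (sX c ac) (sB c ac))) => y cy.
by rewrite vf_mul_in_chart.
Qed.

Lemma smooth_vfD X Y : smooth_vf mfd X -> smooth_vf mfd Y ->
  smooth_vf mfd (fun x => X x + Y x).
Proof.
move=> /smooth_vfP sX /smooth_vfP sY; apply/smooth_vfP => c ac.
have oc := image_open ac.
apply: (smooth_mx_eq oc _ (smooth_mxD oc (sX c ac) (sY c ac))) => y cy.
by rewrite /vf_in_chart mulmxDl.
Qed.

Lemma smooth_vfZ (a : R) X : smooth_vf mfd X -> smooth_vf mfd (fun x => a *: X x).
Proof.
move=> /smooth_vfP sX; apply/smooth_vfP => c ac; have oc := image_open ac.
apply: (smooth_mx_eq oc _ (smooth_mxZ a oc (sX c ac))) => y cy.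
by rewrite /vf_in_chart scalemxAl.
Qed.

Lemma smooth_endoM B C : smooth_endo mfd B -> smooth_endo mfd C ->
  smooth_endo mfd (fun x => B x *m C x).
Proof.
move=> sB sC c ac; have oc := image_open ac.
apply: (smooth_mx_eq oc _ (smooth_mxM oc (sB c ac) (sC c ac))) => y cy.
by rewrite -[LHS]/(endo_in_chart c B y *m endo_in_chart c C y) -endo_mul_in_chart.
Qed.

Lemma smooth_endoD B C : smooth_endo mfd B -> smooth_endo mfd C ->
  smooth_endo mfd (fun x => B x + C x).
Proof.
move=> sB sC c ac; have oc := image_open ac.
apply: (smooth_mx_eq oc _ (smooth_mxD oc (sB c ac) (sC c ac))) => y cy.
by rewrite mulmxDr mulmxDl.
Qed.

Lemma smooth_bilM B K : smooth_endo mfd B -> smooth_bilinear mfd K ->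
  smooth_bilinear mfd (fun x => B x *m K x).
Proof.
move=> sB sK c ac; have oc := image_open ac.
apply: (smooth_mx_eq oc _ (smooth_mxM oc (sB c ac) (sK c ac))) => y cy.
by rewrite -[LHS]/(endo_in_chart c B y *m bil_in_chart c K y) -bil_mull_in_chart.
Qed.

Lemma smooth_bilD B K : smooth_bilinear mfd B -> smooth_bilinear mfd K ->
  smooth_bilinear mfd (fun x => B x + K x).
Proof.
move=> sB sK c ac; have oc := image_open ac.
apply: (smooth_mx_eq oc _ (smooth_mxD oc (sB c ac) (sK c ac))) => y cy.
by rewrite mulmxDr mulmxDl.
Qed.

Lemma smooth_bilZ (a : R) K : smooth_bilinear mfd K ->
  smooth_bilinear mfd (fun x => a *: K x).
Proof.
move=> sK c ac; have oc := image_open ac.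
apply: (smooth_mx_eq oc _ (smooth_mxZ a oc (sK c ac))) => y cy.
by rewrite -scalemxAr -scalemxAl.
Qed.

Lemma smooth_bilN K : smooth_bilinear mfd K -> smooth_bilinear mfd (fun x => - K x).
Proof.
by move=> sK; under eq_fun do rewrite -scaleN1r; exact: smooth_bilZ.
Qed.

Lemma smooth_bilT K : smooth_bilinear mfd K -> smooth_bilinear mfd (fun x => (K x)^T).
Proof.
move=> sK c ac; have oc := image_open ac.
apply: (smooth_mx_eq oc _ (smooth_mxT (sK c ac))) => y cy.
by rewrite !trmx_mul trmxK mulmxA.
Qed.

Lemma smooth_bilMr B K : smooth_endo mfd B -> smooth_bilinear mfd K ->
  smooth_bilinear mfd (fun x => K x *m (B x)^T).
Proof.
move=> sB sK; have := smooth_bilT (smooth_bilM sB (smooth_bilT sK)).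
by under eq_fun do rewrite trmx_mul trmxK.
Qed.

Lemma smooth_pair K X Y : smooth_bilinear mfd K -> smooth_vf mfd X ->
  smooth_vf mfd Y -> smooth_function mfd (pair_with K X Y).
Proof.
move=> sK /smooth_vfP sX /smooth_vfP sY c ac; have oc := image_open ac.
have sKc : smooth_mx (chart_image c) (bil_in_chart c K) := sK c ac.
have s := smooth_mxM oc (smooth_mxM oc (sX c ac) sKc) (smooth_mxT (sY c ac)).
apply: (smooth_on_eq oc _ (s 0 0)) => y cy.
by rewrite -pair_with_in_chart.
Qed.

Lemma smooth_function_differentiable f c y : smooth_function mfd f -> atlas c ->
  chart_image c y -> differentiable (f \o chart_inv c) y.
Proof.
by move=> sf ac cy; exact: smooth_on_differentiable (image_open ac) (sf c ac) cy.
Qed.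

Lemma chart_preimage_open c (A : set M) : atlas c -> open A ->
  open (chart_image c `&` chart_inv c @^-1` A).
Proof.
move=> ac oA; rewrite openE => y [cy Ay].
have n1 := open_nbhs_nbhs (conj (image_open ac) cy).
have ci : {for y, continuous (chart_inv c)}.
  by apply: (chart_inv_continuous (atlas_chart ac)); rewrite inE.
have n2 := ci _ (open_nbhs_nbhs (conj oA Ay)).
by apply: filterS (filterI n1 n2) => z [].
Qed.

(* Cutting a coordinate field off by a bump function; its support is closed
   because [M] is Hausdorff. *)
Lemma exists_coord_fields c y0 : hausdorff_space M -> atlas c -> chart_image c y0 ->
  exists E : 'I_n -> M -> 'rV[R]_n, exists V : set 'rV[R]_n,
    [/\ open V, V y0, V `<=` chart_image c, forall j, smooth_vf mfd (E j) &
        forall j y, V y -> vfc c (E j) y = e j].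
Proof.
move=> hM ac cy0; have oc := image_open ac.
have [chi [r [schi chi1 chi0 rc]]] := exists_bump oc cy0.
pose E j p := if pselect (dom c p) then chi (chart_map c p) *: row j (frame c p) else 0.
(* A compact set carrying the support of every [E j]. *)
pose K := chart_inv c @` [set y | `|y - y0| <= r].
have cK : closed K.
  apply: compact_closed => //; apply: continuous_compact.
    apply: continuous_in_subspaceT => y; rewrite inE => /rc cy.
    by apply: (chart_inv_continuous (atlas_chart ac)); rewrite inE.
  apply: bounded_closed_compact.
    exists (`|y0| + r); split; first exact: num_real.
    move=> t /ltW rt y /= yr; apply: le_trans rt.
    rewrite -[y](subrK y0) addrC; apply: le_trans (ler_normD _ _) _.
    by rewrite lerD2l.
  rewrite (_ : [set y | _] = (fun y => `|y - y0|) @^-1` [set t | t <= r]) //.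
  apply: preimage_closed => [y _|]; last exact: closed_le.
  apply: (@continuous_comp _ _ _ (fun y => y - y0) Num.norm).
    by apply: continuousB; [exact: cvg_id | exact: cst_continuous].
  exact: norm_continuous.
have Ein c' y j : atlas c' -> overlap c' c y -> vfc c' (E j) y
    = chi (transition c' c y) *: row j (jac c c' (transition c' c y)).
  move=> ac' oy; have [c'y dp] := (overlapE c y ac').1 oy.
  rewrite /vf_in_chart /E; case: pselect => [{}dp|//].
  rewrite -scalemxAl -row_mul frame_frameV //.
  exact: chart_inv_dom ac' c'y.
have : nbhs y0 [set y | chi y = 1] := chi1.
rewrite nbhsE => -[V0 [oV0 V0y0] V0chi].
exists E, (V0 `&` chart_image c); split.
- exact: openI.
- by [].
- by move=> y [].
- move=> j; apply/smooth_vfP => c' ac'.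
  (* Two cases: inside the domain of [c] the field is given by the smooth formula [Ein]; outside it
     the point avoids the closed set [K], and the field vanishes on a neighbourhood. *)
  suff loc y : chart_image c' y -> exists W, [/\ open W, W y & smooth_mx W (vfc c' (E j))].
    by move=> i k; apply: smooth_on_local => y /loc[W [oW Wy sW]]; exists W.
  move=> c'y; have [dp|ndp] := pselect (dom c (chart_inv c' y)).
    have oo := overlap_open ac' ac.
    exists (overlap c' c); split; [exact: oo | exact: (overlapE c y ac').2 (conj c'y dp) |].
    have st := transition_smooth ac' ac.
    have tO z : overlap c' c z -> overlap c c' (transition c' c z).
      exact: transition_overlap ac'.
    apply: (smooth_mx_eq oo (F := fun z => chi (transition c' c z) *:
      row j (jac c c' (transition c' c z)))) => [z oz|i k]; first by rewrite Ein.
    have sT l : smooth_on (overlap c' c) (fun z => transition c' c z 0 l).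
      by have /(smooth_onP _ oo) := st; exact.
    have s1 := smooth_on_comp oo openT schi (fun _ _ => I) sT.
    have s2 := smooth_on_comp oo (overlap_open ac ac') (jac_smooth j k ac ac') tO sT.
    apply: (smooth_on_eq oo _ (smooth_onM oo s1 s2)) => z _.
    by rewrite [RHS]mxE [X in _ = _ * X]mxE.
  have oW := chart_preimage_open ac' (closed_openC cK).
  exists (chart_image c' `&` chart_inv c' @^-1` (~` K)); split => //.
    split => // -[z /rc cz zp]; apply: ndp; rewrite -zp; exact: chart_inv_dom ac cz.
  apply: (smooth_mx_eq oW (F := fun=> 0)) => [z [c'z Kz]|i k]; last first.
    under eq_fun do rewrite mxE.
    exact: smooth_on_cst.
  rewrite /vf_in_chart /E; case: pselect => [dz|?]; last by rewrite mul0mx.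
  have [->|chin0] := eqVneq (chi (chart_map c (chart_inv c' z))) 0.
    by rewrite scale0r mul0mx.
  by case: Kz; exists (chart_map c (chart_inv c' z)); [exact: chi0 | exact: chart_mapK' ac dz].
- move=> j y [V0y cy].
  have oy : overlap c c y := (overlapE c y ac).2 (conj cy (chart_inv_dom ac cy)).
  have ty : transition c c y = y by exact: chart_invK ac cy.
  by rewrite Ein // ty V0chi // scale1r (jac_id ac cy) row1.
Qed.

End TensorsInCharts.

(** * Lie brackets in charts *)

Section Brackets.
Context {R : realType} {n : nat} {M : topologicalType}.
Variable mfd : smooth_structure R n M.
Implicit Types (c : chart R n M) (x p : M) (f : M -> R) (y w : 'rV[R]_n).
Implicit Types (X Y : M -> 'rV[R]_n) (B C K : M -> 'M[R]_n).
Local Notation e := (@basis_vec R n).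
Local Notation atlas := (atlas mfd).
Local Notation chart_at := (chart_at mfd).
Local Notation frame := (frame mfd).
Local Notation vfc := (vf_in_chart mfd).

Lemma basis_bilinear (B : 'M[R]_n) j k : (e j *m B *m (e k)^T) 0 0 = B j k.
Proof. by rewrite -rowE trmx_delta -colE !mxE. Qed.

Lemma vf_in_chart_at X x : vfc (chart_at x) X (chart_map (chart_at x) x) = X x.
Proof.
rewrite /vf_in_chart (chart_mapK' (chart_at_atlas mfd x) (chart_at_dom mfd x)).
by rewrite frame_chart_at invmx1 mulmx1.
Qed.

Lemma vf_change_chart c c' X y : atlas c -> atlas c' -> overlap c' c y ->
  vfc c' X y = vfc c X (transition c' c y) *m jac c c' (transition c' c y).
Proof.
move=> ac ac' oy; have [c'y dp] := (overlapE c y ac').1 oy.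
have d'p := chart_inv_dom ac' c'y.
rewrite -(frame_frameV ac ac' dp d'p) /vf_in_chart (transition_inv ac' ac oy).
by rewrite !mulmxA mulmxKV // frame_unit.
Qed.

Lemma dir_derive_field c X y f : atlas c -> chart_image c y ->
  smooth_function mfd f ->
  dir_derive mfd (chart_inv c y) (X (chart_inv c y)) f
  = 'D_(vfc c X y) (f \o chart_inv c) y.
Proof.
move=> ac cy sf; have dp := chart_inv_dom ac cy; have yE := chart_invK ac cy.
rewrite (dir_derive_chart _ ac dp) yE //.
exact: smooth_function_differentiable sf ac cy.
Qed.

(** The bracket is defined through the preferred chart, where coordinate fields of [c] have the rows
    of a Jacobian as components. Its two terms are then mixed second partials of the transition map,
    equal by [clairaut]. *)
Lemma lie_bracket_coord c X Y V i j y : atlas c -> open V -> V `<=` chart_image c ->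
  smooth_vf mfd X -> smooth_vf mfd Y ->
  (forall z, V z -> vfc c X z = e i) -> (forall z, V z -> vfc c Y z = e j) ->
  V y -> lie_bracket mfd X Y (chart_inv c y) = 0.
Proof.
move=> ac oV Vc sX sY XE YE Vy; have cy := Vc _ Vy.
set p := chart_inv c y; pose c' := chart_at p.
have ac' : atlas c' := chart_at_atlas mfd p.
have dp : dom c p := chart_inv_dom ac cy.
have d'p : dom c' p := chart_at_dom mfd p.
have yE : chart_map c p = y := chart_invK ac cy.
have oc'c : overlap c' c (chart_map c' p) by exists p.
have occ' : overlap c c' y by rewrite -yE; exists p.
have oo := overlap_open ac ac'.
have tp : transition c' c (chart_map c' p) = y.
  by rewrite /transition /= (chart_mapK' ac' d'p).
have /(smooth_onP _ oo) sj := transition_smooth ac ac'.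
have key Z W k l m : smooth_vf mfd W -> (forall z, V z -> vfc c Z z = e k) ->
    (forall z, V z -> vfc c W z = e l) ->
    'D_(Z p) (vfc c' W) (chart_map c' p) 0 m
    = 'D_(e k) ('D_(e l) (fun z => transition c c' z 0 m)) y.
  move=> sW ZE WE.
  have c'p : chart_image c' (chart_map c' p) by exact: image_chart_map.
  have sWc' := sW c' ac'.
  have dW : differentiable (vfc c' W) (chart_map c' p).
    apply: differentiable_row => q.
    apply: (smooth_on_differentiable (image_open ac') _ c'p).
    by have /(smooth_onP _ (image_open ac')) := sWc'; exact.
  rewrite derive_mx; last exact: diff_derivable.
  rewrite mxE.
  have nV : nbhs (chart_map c' p) (transition c' c @^-1` V).
    have ct := differentiable_continuous (transition_differentiable ac' ac oc'c).
    by apply: ct; rewrite tp; exact: open_nbhs_nbhs.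
  have E : \forall z \near chart_map c' p, vfc c' W z 0 m
      = ((fun z => jac c c' z l m) \o transition c' c) z.
    have no := open_nbhs_nbhs (conj (overlap_open ac' ac) oc'c).
    apply: filterS (filterI no nV) => z [oz Vz].
    rewrite (vf_change_chart W ac ac' oz) WE //.
    by rewrite /basis_vec -rowE [LHS]mxE.
  have dJ : differentiable (fun z => jac c c' z l m) y.
    exact: smooth_on_differentiable oo (jac_smooth l m ac ac') occ'.
  rewrite (near_eq_derive _ E) (derive_transition_comp _ ac' ac) ?tp //.
  rewrite -(frame_frameV ac' ac d'p dp) frame_chart_at mul1mx.
  have -> : Z p *m invmx (frame c p) = e k by rewrite -(ZE _ Vy).
  by apply: derive_open_eq oo occ' _ => z oz; rewrite (jacE l m ac ac' oz).
apply/rowP => m; rewrite /lie_bracket -/c' !mxE (key X Y i j) // (key Y X j i) //.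
by rewrite (clairaut _ _ oo (sj m) occ') subrr.
Qed.

Lemma dir_derive_bracket X Y f x : smooth_vf mfd X -> smooth_vf mfd Y ->
  smooth_function mfd f ->
  dir_derive mfd x (X x) (fun p => dir_derive mfd p (Y p) f)
  - dir_derive mfd x (Y x) (fun p => dir_derive mfd p (X p) f)
  = dir_derive mfd x (lie_bracket mfd X Y x) f.
Proof.
move=> sX sY sf; pose c := chart_at x; pose y := chart_map c x.
have ac : atlas c := chart_at_atlas mfd x.
have cy : chart_image c y := image_chart_map (chart_at_dom mfd x).
have oc := image_open ac.
pose F := f \o chart_inv c.
have sF : smooth_on (chart_image c) F := sf c ac.
have dF k : differentiable ('D_(e k) F) y.
  exact: smooth_on_differentiable oc (smooth_on_partial k sF) cy.
have cmp Z k : smooth_vf mfd Z -> differentiable (fun z => vfc c Z z 0 k) y.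
  move=> sZ; apply: (smooth_on_differentiable oc _ cy).
  by have /(smooth_onP _ oc) := sZ c ac; exact.
have dZ Z : smooth_vf mfd Z -> differentiable (vfc c Z) y.
  by move=> sZ; apply: differentiable_row => k; exact: cmp.
(* The second-order part of Z (W f); it is symmetric in the two fields and cancels in the
   commutator. *)
pose H (Z W : M -> 'rV[R]_n) := \sum_k \sum_l W x 0 k * (Z x 0 l * 'D_(e l) ('D_(e k) F) y).
have Hsym : H X Y = H Y X.
  rewrite /H exchange_big /=; apply: eq_bigr => k _; apply: eq_bigr => l _.
  by rewrite (clairaut k l oc sF cy) mulrCA.
have key Z W : smooth_vf mfd W ->
    dir_derive mfd x (Z x) (fun p => dir_derive mfd p (W p) f)
    = \sum_k ('D_(Z x) (vfc c W) y 0 k * 'D_(e k) F y)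
      + H Z W.
  move=> sW; rewrite /dir_derive -/c -/y.
  have E : \forall z \near y, ((fun p => dir_derive mfd p (W p) f) \o chart_inv c) z
      = (\sum_(k < n) ((fun z => vfc c W z 0 k) * 'D_(e k) F)) z.
    apply: filterS (open_nbhs_nbhs (conj oc cy)) => z cz.
    rewrite /= dir_derive_field // derive_sum_partials ?fct_sumE //.
    exact: smooth_on_differentiable oc sF cz.
  rewrite (near_eq_derive _ E) derive_sum; last first.
    by move=> k; apply: derivableM; apply: diff_derivable => //; exact: cmp.
  rewrite -big_split /=; apply: eq_bigr => k _.
  rewrite deriveM; [|by apply: diff_derivable => //; exact: cmp..].
  have -> : 'D_(Z x) (vfc c W) y 0 k = 'D_(Z x) (fun z => vfc c W z 0 k) y.
    by rewrite derive_mx ?mxE //; apply: diff_derivable; exact: dZ.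
  rewrite [LHS]addrC; congr (_ + _); first exact: mulrC.
  rewrite [vfc c W y]vf_in_chart_at derive_sum_partials //.
  exact: mulr_sumr.
rewrite (key X Y) // (key Y X) //.
rewrite [dir_derive _ _ (lie_bracket _ _ _ _) _]/dir_derive -/c -/y -/F.
rewrite derive_sum_partials; last exact: smooth_on_differentiable oc sF cy.
rewrite Hsym opprD addrACA subrr addr0 -sumrB; apply: eq_bigr => k _.
by rewrite /lie_bracket !mxE mulrBl.
Qed.

End Brackets.

(** * Parallel bilinear forms *)

Section Connection.
Context {R : realType} {n : nat} {M : topologicalType}.
Variable mfd : smooth_structure R n M.
Hypothesis hM : hausdorff_space M.
Variable nabla : (M -> 'rV[R]_n) -> M -> 'M[R]_n.
Hypothesis hnabla : is_connection mfd nabla.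
Implicit Types (c : chart R n M) (x p : M) (f : M -> R) (y w : 'rV[R]_n).
Implicit Types (X Y Z v : M -> 'rV[R]_n) (B C K : M -> 'M[R]_n).
Local Notation e := (@basis_vec R n).
Local Notation atlas := (atlas mfd).
Local Notation chart_at := (chart_at mfd).
Local Notation frame := (frame mfd).
Local Notation vfc := (vf_in_chart mfd).
Local Notation bilc := (bil_in_chart mfd).
Local Notation endoc := (endo_in_chart mfd).

Lemma smooth_vf0 : smooth_vf mfd (fun=> 0).
Proof.
apply/smooth_vfP => c ac; apply: (smooth_mx_eq (image_open ac) (F := fun=> 0)) => [y _|i j].
  by rewrite /vf_in_chart mul0mx.
under eq_fun do rewrite mxE.
exact: smooth_on_cst (image_open ac).
Qed.

Lemma smooth_vf_sum (I : Type) (r : seq I) (F : I -> M -> 'rV[R]_n) :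
  (forall i, smooth_vf mfd (F i)) -> smooth_vf mfd (fun p => \sum_(i <- r) F i p).
Proof.
move=> sF; elim: r => [|i r IH].
  by under eq_fun do rewrite big_nil; exact: smooth_vf0.
by under eq_fun do rewrite big_cons; exact: (smooth_vfD (sF i) IH).
Qed.

(** Connections, brackets and parallelism are tested on global smooth fields, so pointwise matrix
    identities require a field through every tangent vector. *)
Lemma exists_vf x w : exists2 X, smooth_vf mfd X & X x = w.
Proof.
have ac := chart_at_atlas mfd x.
have cx := image_chart_map (chart_at_dom mfd x).
have [E [V [oV Vx _ sE EV]]] := exists_coord_fields hM ac cx.
exists (fun p => \sum_j w 0 j *: E j p).
  by apply: smooth_vf_sum => j; exact: smooth_vfZ.
rewrite [RHS](row_sum_basis w); apply: eq_bigr => j _; congr (_ *: _).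
by rewrite -(vf_in_chart_at mfd (E j) x) EV.
Qed.

Lemma vf_mx_eq x m (P Q : 'M[R]_(n, m)) :
  (forall X, smooth_vf mfd X -> X x *m P = X x *m Q) -> P = Q.
Proof.
move=> PQ; apply/row_matrixP => i; rewrite !rowE.
by have [X sX <-] := exists_vf x (delta_mx 0 i); exact: PQ.
Qed.

Lemma smooth_vfN X : smooth_vf mfd X -> smooth_vf mfd (fun p => - X p).
Proof. by move=> sX; under eq_fun do rewrite -scaleN1r; exact: smooth_vfZ. Qed.

Lemma smooth_vfB X Y : smooth_vf mfd X -> smooth_vf mfd Y ->
  smooth_vf mfd (fun p => X p - Y p).
Proof. by move=> sX sY; exact: (smooth_vfD sX (smooth_vfN sY)). Qed.

Lemma nablaB X Y x : smooth_vf mfd X -> smooth_vf mfd Y ->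
  nabla (fun p => X p - Y p) x = nabla X x - nabla Y x.
Proof.
move=> sX sY; apply/eqP; rewrite -subr_eq opprK; apply/eqP.
rewrite -(nablaD hnabla (smooth_vfB sX sY) sY).
by congr (nabla _ x); apply/funext => p; rewrite subrK.
Qed.

Lemma smooth_cov X Y : smooth_vf mfd X -> smooth_vf mfd Y -> smooth_vf mfd (cov nabla X Y).
Proof. by move=> sX sY; apply: smooth_vfM => //; exact: (nabla_smooth hnabla). Qed.

(** The Leibniz rule for K(Y, Z) in direction [w], with the term (nabla_w K)(Y, Z) absent. *)
Definition parallel_bil K :=
  smooth_bilinear mfd K /\
  forall Y Z, smooth_vf mfd Y -> smooth_vf mfd Z -> forall x w,
    dir_derive mfd x w (pair_with K Y Z)
    = (w *m nabla Y x *m K x *m (Z x)^T) 0 0 + (Y x *m K x *m (w *m nabla Z x)^T) 0 0.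

Lemma dir_deriveD x w f f' : smooth_function mfd f -> smooth_function mfd f' ->
  dir_derive mfd x w (fun p => f p + f' p) = dir_derive mfd x w f + dir_derive mfd x w f'.
Proof.
move=> sf sf'; have ac := chart_at_atlas mfd x.
have cx := image_chart_map (chart_at_dom mfd x).
rewrite /dir_derive -deriveD //; apply: diff_derivable;
  by apply: (smooth_function_differentiable _ ac cx).
Qed.

Lemma dir_deriveZ x w a f : smooth_function mfd f ->
  dir_derive mfd x w (fun p => a * f p) = a * dir_derive mfd x w f.
Proof.
move=> sf; have ac := chart_at_atlas mfd x.
have cx := image_chart_map (chart_at_dom mfd x).
have := @deriveZ _ _ _ (f \o chart_inv (chart_at x)) a (chart_map (chart_at x) x) w.
by apply; apply: diff_derivable; exact: (smooth_function_differentiable sf ac cx).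
Qed.

Lemma parallel_bilD K C : parallel_bil K -> parallel_bil C ->
  parallel_bil (fun x => K x + C x).
Proof.
move=> [sK pK] [sC pC]; split; first exact: smooth_bilD.
move=> Y Z sY sZ x w.
have -> : pair_with (fun x => K x + C x) Y Z = fun p => pair_with K Y Z p + pair_with C Y Z p.
  by apply/funext => p; rewrite /pair_with mulmxDr mulmxDl mxE.
rewrite dir_deriveD ?pK ?pC //; [|exact: smooth_pair..].
by rewrite !mulmxDr !mulmxDl !mxE addrACA.
Qed.

Lemma parallel_bilZ a K : parallel_bil K -> parallel_bil (fun x => a *: K x).
Proof.
move=> [sK pK]; split; first exact: smooth_bilZ.
move=> Y Z sY sZ x w.
have -> : pair_with (fun x => a *: K x) Y Z = fun p => a * pair_with K Y Z p.
  by apply/funext => p; rewrite /pair_with -scalemxAr -scalemxAl mxE.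
rewrite dir_deriveZ ?pK //; last exact: smooth_pair.
by rewrite -!scalemxAr -!scalemxAl !mxE mulrDr.
Qed.

Lemma parallel_bilN K : parallel_bil K -> parallel_bil (fun x => - K x).
Proof. by move=> pK; under eq_fun do rewrite -scaleN1r; exact: parallel_bilZ. Qed.

Lemma parallel_bilT K : parallel_bil K -> parallel_bil (fun x => (K x)^T).
Proof.
have tr00 (P : 'M[R]_1) : P 0 0 = P^T 0 0 by rewrite mxE.
move=> [sK pK]; split; first exact: smooth_bilT.
move=> Y Z sY sZ x w.
have -> : pair_with (fun x => (K x)^T) Y Z = pair_with K Z Y.
  by apply/funext => p; rewrite /pair_with tr00 !trmx_mul !trmxK mulmxA.
rewrite pK // addrC; congr (_ + _).
  by rewrite tr00 !trmx_mul !trmxK !mulmxA.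
by rewrite [LHS]tr00 !trmx_mul !trmxK !mulmxA.
Qed.

Lemma parallel_bilM B K : smooth_endo mfd B -> parallel_endo mfd nabla B ->
  parallel_bil K -> parallel_bil (fun x => B x *m K x).
Proof.
move=> sB pB [sK pK]; split; first exact: smooth_bilM.
move=> Y Z sY sZ x w.
have -> : pair_with (fun x => B x *m K x) Y Z = pair_with K (fun p => Y p *m B p) Z.
  by apply/funext => p; rewrite /pair_with !mulmxA.
by rewrite (pK _ _ (smooth_vfM sY sB) sZ) pB // !mulmxA.
Qed.

Section Torsion.
Hypothesis torsion_free : forall X Y, smooth_vf mfd X -> smooth_vf mfd Y ->
  forall x, cov nabla X Y x - cov nabla Y X x = lie_bracket mfd X Y x.

Lemma basis_entry (u : 'rV[R]_n) k : (u *m (e k)^T) 0 0 = u 0 k.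
Proof. by rewrite trmx_delta -colE mxE. Qed.

(* Christoffel symbols: row [j] of [Gam i] is nabla_i of the [j]-th coordinate field. *)
Lemma exists_christoffel c y0 : atlas c -> chart_image c y0 ->
  exists V : set 'rV[R]_n, exists Gam : 'I_n -> 'rV[R]_n -> 'M[R]_n,
  [/\ [/\ open V, V y0 & V `<=` chart_image c],
      forall i, smooth_mx V (Gam i),
      forall i j y, V y -> row j (Gam i y) = row i (Gam j y) &
      forall K, parallel_bil K -> forall i j k y, V y ->
        'D_(e i) (fun z => bilc c K z j k) y
        = (Gam i y *m bilc c K y + bilc c K y *m (Gam i y)^T) j k].
Proof.
move=> ac cy0; have [E [V [oV Vy0 Vc sE EV]]] := exists_coord_fields hM ac cy0.
exists V, (fun i y => \matrix_j row i (endoc c (nabla (E j)) y)); split => //.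
- move=> i j k; under eq_fun do rewrite mxE mxE.
  apply: smooth_on_subset Vc _.
  exact: ((nabla_smooth hnabla (sE j)) c ac i k).
- move=> i j y Vy; rewrite !rowK.
  have cy := Vc _ Vy; have dp := chart_inv_dom ac cy.
  have covE k l : row k (endoc c (nabla (E l)) y)
      = vfc c (cov nabla (E k) (E l)) y.
    by rewrite (vf_mul_in_chart _ _ ac cy) EV // -rowE.
  (* Symmetry of the symbols: the connection has no torsion and coordinate fields commute. *)
  rewrite !covE; apply/eqP; rewrite -subr_eq0; apply/eqP.
  rewrite /vf_in_chart -mulmxBl torsion_free //.
  by rewrite (lie_bracket_coord ac oV Vc (sE i) (sE j) (EV i) (EV j) Vy) mul0mx.
move=> K [sK pK] i j k y Vy; have cy := Vc _ Vy.
have E0 : 'D_(e i) (fun z => bilc c K z j k) y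
    = dir_derive mfd (chart_inv c y) (E i (chart_inv c y)) (pair_with K (E j) (E k)).
  rewrite (dir_derive_field _ ac cy) ?EV //; last exact: smooth_pair.
  apply: derive_open_eq oV Vy _ => z Vz.
  rewrite /= (pair_with_in_chart _ _ _ ac (Vc _ Vz)) !EV //.
  by rewrite basis_bilinear.
rewrite E0 pK //.
rewrite -[X in X + _]/(pair_with K (cov nabla (E i) (E j)) (E k) (chart_inv c y)).
rewrite -[X in _ + X]/(pair_with K (E j) (cov nabla (E i) (E k)) (chart_inv c y)).
rewrite !(pair_with_in_chart _ _ _ ac cy) !(vf_mul_in_chart _ _ ac cy) !EV //.
rewrite [RHS]mxE; congr (_ + _).
  rewrite basis_entry -rowE [LHS]mxE [RHS]mxE; apply: eq_bigr => l _.
  by congr (_ * _); rewrite [RHS]mxE.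
rewrite -!rowE [LHS]mxE [RHS]mxE; apply: eq_bigr => l _.
by rewrite [X in X * _]mxE; congr (_ * _); rewrite [LHS]mxE [RHS]mxE [RHS]mxE.
Qed.

End Torsion.
End Connection.

(** * Affine vector fields *)

Section LeviCivita.
Context {R : realType} {n : nat} {M : topologicalType}.
Variable mfd : smooth_structure R n M.
Hypothesis hM : hausdorff_space M.
Variables (g : M -> 'M[R]_n) (nabla : (M -> 'rV[R]_n) -> M -> 'M[R]_n).
Hypothesis hg : is_pseudo_riemannian mfd g.
Hypothesis hLC : is_levi_civita mfd g nabla.
Implicit Types (c : chart R n M) (x p : M) (f : M -> R) (y w : 'rV[R]_n).
Implicit Types (X Y Z v : M -> 'rV[R]_n) (B C K : M -> 'M[R]_n).
Local Notation e := (@basis_vec R n).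
Local Notation atlas := (atlas mfd).
Local Notation vfc := (vf_in_chart mfd).
Local Notation bilc := (bil_in_chart mfd).
Local Notation parallel_bil := (parallel_bil mfd nabla).
Local Notation smooth_vf := (smooth_vf mfd).

Let hnabla := levi_civita_connection hLC.

Lemma tr00 (P : 'M[R]_1) : P 0 0 = P^T 0 0.
Proof. by rewrite mxE. Qed.

Lemma add00 (P Q : 'M[R]_1) : (P + Q) 0 0 = P 0 0 + Q 0 0.
Proof. by rewrite mxE. Qed.

Lemma pair00Bl (a b u : 'rV[R]_n) (G : 'M[R]_n) :
  ((a - b) *m G *m u^T) 0 0 = (a *m G *m u^T) 0 0 - (b *m G *m u^T) 0 0.
Proof. by rewrite !mulmxBl !mxE. Qed.

Lemma pair00Br (a b u : 'rV[R]_n) (G : 'M[R]_n) :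
  (u *m G *m (a - b)^T) 0 0 = (u *m G *m a^T) 0 0 - (u *m G *m b^T) 0 0.
Proof. by rewrite linearB /= mulmxBr !mxE. Qed.

Lemma parallel_metric : parallel_bil g.
Proof.
split; first exact: metric_smooth hg.
move=> Y Z sY sZ x w; have [X sX <-] := exists_vf mfd hM x w.
exact: (metric_compatible hLC).
Qed.

(* d of the 1-form g(X, .), since nabla is metric and torsion-free *)
Definition ext_d_flat X x : 'M[R]_n := nabla X x *m g x - (nabla X x *m g x)^T.

Lemma smooth_nabla_flat X : smooth_vf X -> smooth_bilinear mfd (fun x => nabla X x *m g x).
Proof. by move=> sX; exact: (smooth_bilM (nabla_smooth hnabla sX) (metric_smooth hg)). Qed.

Lemma smooth_ext_d_flat X : smooth_vf X -> smooth_bilinear mfd (ext_d_flat X).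
Proof.
move=> sX; have sN := smooth_nabla_flat sX.
exact: (smooth_bilD sN (smooth_bilN (smooth_bilT sN))).
Qed.

(** Metric compatibility expands the derivative of g(X, E_k) along E_j; after antisymmetrisation the
    terms g(X, nabla E) cancel because coordinate fields commute. *)
Lemma ext_d_flat_in_chart c X y j k : atlas c -> chart_image c y -> smooth_vf X ->
  bilc c (ext_d_flat X) y j k
  = 'D_(e j) (fun z => (vfc c X z *m bilc c g z) 0 k) y
    - 'D_(e k) (fun z => (vfc c X z *m bilc c g z) 0 j) y.
Proof.
move=> ac cy sX; have [E [V [oV Vy Vc sE EV]]] := exists_coord_fields hM ac cy.
set p := chart_inv c y.
have D a b : 'D_(e a) (fun z => (vfc c X z *m bilc c g z) 0 b) y
    = (E a p *m nabla X p *m g p *m (E b p)^T) 0 0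
      + (X p *m g p *m (cov nabla (E a) (E b) p)^T) 0 0.
  rewrite -(parallel_metric.2 X (E b) sX (sE b)).
  rewrite (dir_derive_field _ ac cy) ?EV //; last first.
    exact: (smooth_pair (metric_smooth hg) sX (sE b)).
  apply: derive_open_eq oV Vy _ => z Vz.
  by rewrite /= (pair_with_in_chart _ _ _ ac (Vc _ Vz)) EV // basis_entry.
rewrite !D opprD addrACA.
have -> : (X p *m g p *m (cov nabla (E j) (E k) p)^T) 0 0
    - (X p *m g p *m (cov nabla (E k) (E j) p)^T) 0 0 = 0.
  have tor := torsion_free hLC (sE j) (sE k) p.
  rewrite (lie_bracket_coord ac oV Vc (sE j) (sE k) (EV j) (EV k) Vy) in tor.
  by move/eqP: tor; rewrite subr_eq0 => /eqP ->; rewrite subrr.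
rewrite addr0 -(basis_bilinear (bilc c (ext_d_flat X) y)) -(EV j y Vy) -(EV k y Vy).
rewrite -(pair_with_in_chart _ _ _ ac cy) /pair_with /ext_d_flat -/p.
rewrite mulmxBr mulmxBl [LHS]mxE; congr (_ + _); first by rewrite mulmxA.
by rewrite [LHS]mxE [X in - X]tr00 !trmx_mul !trmxK !mulmxA.
Qed.

(* [R(v, X) Y] up to sign *)
Definition curv v X Y x : 'rV[R]_n :=
  v x *m nabla (cov nabla X Y) x - X x *m nabla (cov nabla v Y) x
  - lie_bracket mfd v X x *m nabla Y x.

(** The curvature is g-skew: the commutator identity for [v] and [X] is applied to the function g(Y,
    Z), each derivative is expanded by metric compatibility, and the mixed products of first
    covariant derivatives cancel. *)
Lemma curv_skew v X Y Z x : smooth_vf v -> smooth_vf X -> smooth_vf Y -> smooth_vf Z ->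
  (curv v X Y x *m g x *m (Z x)^T) 0 0 + (Y x *m g x *m (curv v X Z x)^T) 0 0 = 0.
Proof.
move=> sv sX sY sZ.
have sg := metric_smooth hg.
have s1 W : smooth_vf W -> smooth_vf (cov nabla W Y) by move=> sW; exact: smooth_cov.
have s2 W : smooth_vf W -> smooth_vf (cov nabla W Z) by move=> sW; exact: smooth_cov.
have DE W : smooth_vf W -> (fun p => dir_derive mfd p (W p) (pair_with g Y Z))
   = (fun p => pair_with g (cov nabla W Y) Z p + pair_with g Y (cov nabla W Z) p).
  by move=> sW; apply/funext => p; rewrite (metric_compatible hLC).
have H := dir_derive_bracket x sv sX (smooth_pair sg sY sZ).
rewrite !DE // in H.
have DD U W : smooth_vf W -> dir_derive mfd x (U x)
   (fun p => pair_with g (cov nabla W Y) Z p + pair_with g Y (cov nabla W Z) p)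
  = (U x *m nabla (cov nabla W Y) x *m g x *m (Z x)^T) 0 0
    + (cov nabla W Y x *m g x *m (cov nabla U Z x)^T) 0 0
    + ((cov nabla U Y x *m g x *m (cov nabla W Z x)^T) 0 0
    + (Y x *m g x *m (U x *m nabla (cov nabla W Z) x)^T) 0 0).
  move=> sW; rewrite dir_deriveD; [|exact: smooth_pair (s1 _ sW) sZ|exact: smooth_pair sY (s2 _ sW)].
  by rewrite (parallel_metric.2 _ _ (s1 _ sW) sZ) (parallel_metric.2 _ _ sY (s2 _ sW)).
rewrite (DD v X sX) (DD X v sv) (parallel_metric.2 _ _ sY sZ) in H.
rewrite /curv !pair00Bl !pair00Br.
have arith (a1 m1 m2 a2 b1 b2 c1 c2 : R) :
    a1 + m1 + (m2 + a2) - (b1 + m2 + (m1 + b2)) = c1 + c2 ->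
    a1 - b1 - c1 + (a2 - b2 - c2) = 0.
  move=> E; have -> : a1 - b1 - c1 + (a2 - b2 - c2)
    = a1 + m1 + (m2 + a2) - (b1 + m2 + (m1 + b2)) - (c1 + c2) by ring.
  by rewrite E subrr.
exact: arith H.
Qed.

Section Affine.
Variable v : M -> 'rV[R]_n.
Hypotheses (sv : smooth_vf v) (av : affine_vf mfd nabla v).
Let A := nabla v.

Lemma smooth_A : smooth_endo mfd A.
Proof. exact: (nabla_smooth hnabla sv). Qed.

(* the classical form (nabla_X A) Y = - R(v, X) Y of the affine equation *)
Lemma affine_curv X Y x : smooth_vf X -> smooth_vf Y ->
  X x *m nabla (fun p => Y p *m A p) x = X x *m nabla Y x *m A x - curv v X Y x.
Proof.
move=> sX sY; have := av sX sY x.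
have sXY := smooth_cov hnabla sX sY.
have svY := smooth_cov hnabla sv sY.
have sYA : smooth_vf (fun p => Y p *m A p) by exact: smooth_vfM sY smooth_A.
have -> : lie_bracket mfd v Y = fun p => cov nabla v Y p - Y p *m A p.
  by apply/funext => p; rewrite -(torsion_free hLC sv sY).
rewrite -(torsion_free hLC sv sXY) /cov (nablaB hnabla _ svY sYA).
rewrite -/(cov nabla v Y) -/(cov nabla X Y) /curv mulmxBr -/A => H.
have arith (a b c d k : 'rV[R]_n) : a - b - c - (d - k) = 0 -> k = b - (a - d - c).
  move=> E; apply/eqP; rewrite -subr_eq0 -E; apply/eqP/rowP => i; rewrite !mxE; ring.
exact: arith H.
Qed.

(** By [affine_curv] the covariant derivative of A is a curvature operator. It is g-skew, hence
    drops out of the g-symmetric part of A. *)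
Lemma affine_parallel_flat : parallel_bil (fun x => A x *m g x + g x *m (A x)^T).
Proof.
have sA := smooth_A; have sg := metric_smooth hg.
have sYA Y : smooth_vf Y -> smooth_vf (fun p => Y p *m A p) by move=> sY; exact: smooth_vfM.
split; first by apply: smooth_bilD; [exact: smooth_bilM | exact: smooth_bilMr].
move=> Y Z sY sZ x w; have [X sX <-] := exists_vf mfd hM x w.
have -> : pair_with (fun x => A x *m g x + g x *m (A x)^T) Y Z
  = fun p => pair_with g (fun p => Y p *m A p) Z p + pair_with g Y (fun p => Z p *m A p) p.
  apply/funext => p; rewrite /pair_with mulmxDr mulmxDl [LHS]mxE; congr (_ + _).
    by rewrite !mulmxA.
  by rewrite trmx_mul !mulmxA.
rewrite dir_deriveD; [|exact: smooth_pair (sYA _ sY) sZ|exact: smooth_pair sY (sYA _ sZ)].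
rewrite (parallel_metric.2 _ _ (sYA _ sY) sZ) (parallel_metric.2 _ _ sY (sYA _ sZ)).
rewrite (affine_curv _ sX sY) (affine_curv _ sX sZ) pair00Bl pair00Br.
move: (curv_skew x sv sX sY sZ); move: (curv v X Y x) (curv v X Z x) => R1 R2 C.
rewrite !mulmxDr !mulmxDl !add00 !trmx_mul !mulmxA.
have arith (a b c d k l : R) : c + d = 0 ->
    a - c + k + (l + (b - d)) = a + l + (k + b).
  move=> E; have -> : a - c + k + (l + (b - d)) = a + l + (k + b) - (c + d) by ring.
  by rewrite E subr0.
exact: arith C.
Qed.

(** Curvature commutes with a parallel [J], so the curvature terms from the two orders of A and J
    cancel. *)
Lemma affine_parallel_commutator J : smooth_endo mfd J -> parallel_endo mfd nabla J ->
  parallel_endo mfd nabla (fun x => J x *m A x - A x *m J x).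
Proof.
move=> sJ pJ Y sY x; apply: (@vf_mx_eq _ _ _ mfd hM x) => X sX.
have sA := smooth_A.
have sYA : smooth_vf (fun p => Y p *m A p) by exact: smooth_vfM.
have sYJ : smooth_vf (fun p => Y p *m J p) by exact: smooth_vfM.
have -> : (fun p => Y p *m (J p *m A p - A p *m J p))
  = fun p => (Y p *m J p) *m A p - (Y p *m A p) *m J p.
  by apply/funext => p; rewrite mulmxBr !mulmxA.
have -> : nabla (fun p => Y p *m J p *m A p - Y p *m A p *m J p) x
  = nabla (fun p => Y p *m J p *m A p) x - nabla (fun p => Y p *m A p *m J p) x.
  exact: (nablaB hnabla _ (smooth_vfM sYJ sA) (smooth_vfM sYA sJ)).
have aJ : X x *m nabla (fun p => Y p *m J p *m A p) x
  = X x *m nabla (fun p => Y p *m J p) x *m A x - curv v X (fun p => Y p *m J p) x.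
  exact: (affine_curv _ sX sYJ).
have pYA : nabla (fun p => Y p *m A p *m J p) x = nabla (fun p => Y p *m A p) x *m J x.
  exact: pJ.
rewrite [LHS]mulmxBr aJ pYA (pJ _ sY) (mulmxA (X x) (nabla (fun p => Y p *m A p) x)).
rewrite (affine_curv _ sX sY) mulmxBl.
have covJ W : smooth_vf W -> cov nabla W (fun p => Y p *m J p) = fun p => cov nabla W Y p *m J p.
  by move=> sW; apply/funext => p; rewrite /cov pJ // mulmxA.
have -> : curv v X (fun p => Y p *m J p) x = curv v X Y x *m J x.
  rewrite /curv (covJ _ sX) (covJ _ sv) (pJ _ (smooth_cov hnabla sX sY)).
  rewrite (pJ _ (smooth_cov hnabla sv sY)) (pJ _ sY).
  by rewrite !mulmxBl !mulmxA.
rewrite mulmxA [X in _ = X]mulmxA mulmxBr mulmxBl !mulmxA.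
have arith (a b c : 'rV[R]_n) : a - c - (b - c) = a - b by rewrite opprB addrA subrK.
exact: arith.
Qed.

End Affine.
End LeviCivita.

(** * Closed real 2-forms *)

(* A closed 2-form [t] of type (2,0) + (0,2) is the sum of two closed forms of
   types (2,0) and (0,2), so [t (J ., .)] is closed as well. Here [t a b c]
   stands for the covariant derivative along [a] evaluated at [b], [c]. *)
Lemma closed_anti_invariant (R : realType) (V : zmodType) (J : V -> V) (t : V -> V -> V -> R) :
  (forall a, J (J a) = - a) ->
  (forall a b c, t (- a) b c = - t a b c) ->
  (forall a b c, t a (- b) c = - t a b c) ->
  (forall a b c, t a (J b) (J c) = - t a b c) ->
  (forall a b c, t a b c + t b c a + t c a b = 0) ->
  forall a b c, t a (J b) c + t b (J c) a + t c (J a) b = 0.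
Proof.
move=> JJ o1 o2 tJ cl.
have tJ1 a b c : t a b (J c) = t a (J b) c.
  by apply: oppr_inj; rewrite -o2 -JJ tJ.
pose D a b c := t a (J b) c + t b (J c) a + t c (J a) b.
(* Closedness at [J a], [b], [c] replaces the last two terms of [D]. In this two-term form the
   effect of [J] on each pair of slots can be read off. *)
have DE a b c : D a b c = t a (J b) c - t (J a) b c.
  have := cl (J a) b c; rewrite tJ1 -addrA => /eqP; rewrite addr_eq0 => /eqP ->.
  by rewrite opprK /D addrA.
have Dcyc a b c : D a b c = D b c a by rewrite /D [RHS]addrC addrA.
have D1 a b c : D a (J b) (J c) = - D a b c.
  by rewrite !DE !JJ o2 tJ1 tJ opprK opprB addrC.
have D2 a b c : D (J a) (J b) c = D a b c.
  by rewrite !DE !JJ o1 o2 opprK addrC.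
move=> a b c; rewrite -/(D a b c).
(* After a cyclic shift, the same pair of slots falls under both [D1] and [D2], which carry opposite
   signs. *)
have : D a b c = - D a b c by rewrite -{1}D2 -Dcyc D1 Dcyc.
by move/eqP; rewrite -addr_eq0 -mulr2n mulrn_eq0 => /eqP.
Qed.

Section MatrixDerivative.
Context {R : realType} {n : nat}.
Local Notation e := (@basis_vec R n).
Implicit Types (y : 'rV[R]_n) (U : set 'rV[R]_n).

Definition mx_partial m p (i : 'I_n) (F : 'rV[R]_n -> 'M[R]_(m, p)) y : 'M[R]_(m, p) :=
  \matrix_(j, k) 'D_(e i) (fun z => F z j k) y.

Lemma mx_partial_near m p i (F G : 'rV[R]_n -> 'M[R]_(m, p)) U y : open U -> U y ->
  (forall z, U z -> F z = G z) -> mx_partial i F y = mx_partial i G y.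
Proof.
move=> oU Uy FG; apply/matrixP => j k; rewrite !mxE.
by apply: derive_open_eq oU Uy _ => z /FG ->.
Qed.

Lemma mx_partialM m p q i (F : 'rV[R]_n -> 'M[R]_(m, p)) (G : 'rV[R]_n -> 'M[R]_(p, q)) U y :
  open U -> U y -> smooth_mx U F -> smooth_mx U G ->
  mx_partial i (fun z => F z *m G z) y = mx_partial i F y *m G y + F y *m mx_partial i G y.
Proof.
move=> oU Uy sF sG; apply/matrixP => j k; rewrite !mxE.
have dF l : derivable (fun z => F z j l) y (e i) by exact: smooth_on_derivable (sF j l) Uy.
have dG l : derivable (fun z => G z l k) y (e i) by exact: smooth_on_derivable (sG l k) Uy.
have -> : (fun z => (F z *m G z) j k) = \sum_(l < p) ((fun z => F z j l) * (fun z => G z l k)).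
  by apply/funext => z; rewrite mxE fct_sumE.
rewrite derive_sum; last by move=> l; exact: derivableM.
rewrite -big_split /=; apply: eq_bigr => l _; rewrite deriveM // !mxE addrC.
congr (_ + _); exact: mulrC.
Qed.

Lemma mx_partialN m p i (F : 'rV[R]_n -> 'M[R]_(m, p)) U y : U y -> smooth_mx U F ->
  mx_partial i (fun z => - F z) y = - mx_partial i F y.
Proof.
move=> Uy sF; apply/matrixP => j k; rewrite !mxE.
have dF : derivable (fun z => F z j k) y (e i) by exact: smooth_on_derivable (sF j k) Uy.
rewrite -deriveN //; congr ('D_(e i) _ y).
by apply/funext => z; rewrite mxE.
Qed.

Lemma mx_partialT m p i (F : 'rV[R]_n -> 'M[R]_(m, p)) y :
  mx_partial i (fun z => (F z)^T) y = (mx_partial i F y)^T.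
Proof.
apply/matrixP => j k; rewrite !mxE; congr ('D_(e i) _ y).
by apply/funext => z; rewrite mxE.
Qed.

Definition ext_d2 (F : 'rV[R]_n -> 'M[R]_n) y (i j k : 'I_n) : R :=
  mx_partial i F y j k - mx_partial j F y i k + mx_partial k F y i j.

(** The Christoffel terms cancel in pairs, by symmetry of [Gam] in its two lower indices and
    antisymmetry of [F]. Hence d of a 2-form may be computed with covariant instead of partial
    derivatives. *)
Lemma symmetric_connection_closed (F : 'M[R]_n) (Gam : 'I_n -> 'M[R]_n) i j k :
  F^T = - F -> (forall i j, row j (Gam i) = row i (Gam j)) ->
  let Z i := Gam i *m F + F *m (Gam i)^T in Z i j k - Z j i k + Z k i j = 0.
Proof.
move=> Fa Gs Z.
have FE a b : F a b = - F b a.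
  by have /matrixP /(_ b a) := Fa; rewrite !mxE.
have GE a b l : Gam a b l = Gam b a l.
  by have /rowP /(_ l) := Gs a b; rewrite !mxE.
rewrite /Z !mxE -!big_split /= -sumrB -big_split /= big1 // => l _.
rewrite !mxE (GE j i l) (GE k i l) (GE k j l) (FE l j); ring.
Qed.

End MatrixDerivative.

(** * Closed 2-forms on a pseudo-Kaehler manifold *)

Section Kahler.
Context {R : realType} {n : nat} {M : topologicalType}.
Variable mfd : smooth_structure R n M.
Hypothesis hM : hausdorff_space M.
Variables (g : M -> 'M[R]_n) (nabla : (M -> 'rV[R]_n) -> M -> 'M[R]_n).
Variable J : M -> 'M[R]_n.
Hypothesis hK : is_pseudo_kahler mfd g nabla J.
Implicit Types (c : chart R n M) (x : M) (f : M -> R) (y w : 'rV[R]_n).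
Implicit Types (X Y Z v : M -> 'rV[R]_n) (B C K F : M -> 'M[R]_n).
Local Notation e := (@basis_vec R n).
Local Notation atlas := (atlas mfd).
Local Notation vfc := (vf_in_chart mfd).
Local Notation bilc := (bil_in_chart mfd).
Local Notation endoc := (endo_in_chart mfd).
Local Notation parallel_bil := (parallel_bil mfd nabla).
Local Notation smooth_vf := (smooth_vf mfd).

Let hg := kahler_metric hK.
Let hLC := kahler_levi_civita hK.
Let hnabla := levi_civita_connection hLC.

Definition closed2 K := forall c y i j k, atlas c -> chart_image c y ->
  ext_d2 (bilc c K) y i j k = 0.

Lemma ext_d2_linear (a b : R) K F c y i j k : atlas c -> chart_image c y ->
  smooth_bilinear mfd K -> smooth_bilinear mfd F ->
  ext_d2 (bilc c (fun x => a *: K x + b *: F x)) y i j k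
  = a * ext_d2 (bilc c K) y i j k + b * ext_d2 (bilc c F) y i j k.
Proof.
move=> ac cy sK sF.
have H l p q : mx_partial l (bilc c (fun x => a *: K x + b *: F x)) y p q
   = a * mx_partial l (bilc c K) y p q + b * mx_partial l (bilc c F) y p q.
  rewrite !mxE.
  have dK : derivable (fun z => bilc c K z p q) y (e l) by exact: smooth_on_derivable (sK c ac p q) cy.
  have dF : derivable (fun z => bilc c F z p q) y (e l) by exact: smooth_on_derivable (sF c ac p q) cy.
  have -> : (fun z => bilc c (fun x => a *: K x + b *: F x) z p q)
    = (a *: (fun z => bilc c K z p q)) + (b *: (fun z => bilc c F z p q)).
    apply/funext => z; rewrite bil_add_in_chart 2!bil_scale_in_chart mxE.
    by rewrite [X in X + _]mxE [X in _ + X]mxE.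
  rewrite (deriveD (derivableZ (k := a) dK) (derivableZ (k := b) dF)).
  by rewrite (deriveZ a dK) (deriveZ b dF).
have gen (S P Q : 'I_n -> 'I_n -> 'I_n -> R) :
    (forall l p q, S l p q = a * P l p q + b * Q l p q) ->
    S i j k - S j i k + S k i j
    = a * (P i j k - P j i k + P k i j) + b * (Q i j k - Q j i k + Q k i j).
  by move=> E; rewrite !E; ring.
exact: (gen (fun l => mx_partial l (bilc c (fun x => a *: K x + b *: F x)) y)
  (fun l => mx_partial l (bilc c K) y) (fun l => mx_partial l (bilc c F) y)).
Qed.

Lemma closed2_linear (a b : R) K F : smooth_bilinear mfd K -> smooth_bilinear mfd F ->
  closed2 K -> closed2 F -> closed2 (fun x => a *: K x + b *: F x).
Proof.
by move=> sK sF cK cF c y i j k ac cy; rewrite ext_d2_linear // cK // cF // !mulr0 addr0.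
Qed.

Lemma parallel_closed2 K : parallel_bil K -> (forall x, (K x)^T = - K x) -> closed2 K.
Proof.
move=> pK Ka c y i j k ac cy.
have [V [Gam [[oV Vy Vc] sG Gs DG]]] := exists_christoffel hM hnabla (torsion_free hLC) ac cy.
have H l : mx_partial l (bilc c K) y = Gam l y *m bilc c K y + bilc c K y *m (Gam l y)^T.
  by apply/matrixP => p q; rewrite [LHS]mxE DG.
have KcT : (bilc c K y)^T = - bilc c K y.
  by rewrite -bil_tr_in_chart -bil_opp_in_chart; congr (bilc c _ y); apply/funext.
rewrite /ext_d2 !H.
exact: (@symmetric_connection_closed _ _ _ (fun l => Gam l y) i j k KcT (fun a b => Gs a b y Vy)).
Qed.

Lemma ext_d_flat_closed2 X : smooth_vf X -> closed2 (ext_d_flat g nabla X).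
Proof.
move=> sX c y i j k ac cy; have oc := image_open ac.
pose xi l (z : 'rV[R]_n) := (vfc c X z *m bilc c g z) 0 l.
have sxi l : smooth_on (chart_image c) (xi l).
  have sXc := (smooth_vfP mfd X).1 sX c ac.
  have sgc : smooth_mx (chart_image c) (bilc c g) := metric_smooth hg ac.
  exact: (smooth_mxM oc sXc sgc 0 l).
have H l p q : mx_partial l (bilc c (ext_d_flat g nabla X)) y p q
    = 'D_(e l) ('D_(e p) (xi q)) y - 'D_(e l) ('D_(e q) (xi p)) y.
  rewrite mxE.
  have d a b : derivable ('D_(e a) (xi b)) y (e l).
    exact: smooth_on_derivable (smooth_on_partial a (sxi b)) cy.
  rewrite -deriveB //; apply: (derive_open_eq _ oc cy) => z cz.
  by rewrite (ext_d_flat_in_chart hM hg hLC p q ac cz sX).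
have gen (S D : 'I_n -> 'I_n -> 'I_n -> R) : (forall l p q, S l p q = D l p q - D l q p) ->
    (forall l p q, D l p q = D p l q) -> S i j k - S j i k + S k i j = 0.
  by move=> SE DE; rewrite !SE (DE j i) (DE k i) (DE k j); ring.
apply: (gen (fun l => mx_partial l (bilc c (ext_d_flat g nabla X)) y)
  (fun l p q => 'D_(e l) ('D_(e p) (xi q)) y)) => [|l p q]; first exact: H.
exact: (clairaut l p oc (sxi q) cy).
Qed.

Lemma endo_sqr_in_chart c y : atlas c -> chart_image c y ->
  endoc c J y *m endoc c J y = - 1%:M.
Proof.
move=> ac cy; rewrite -(endo_mul_in_chart _ _ ac cy) /endo_in_chart.
by rewrite (kahler_J_sqr hK) mulmxN mulmx1 mulNmx mulmxV // (frame_inv_unit ac cy).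
Qed.

Lemma bil_unit_in_chart c y K : atlas c -> chart_image c y -> K (chart_inv c y) \in unitmx ->
  bilc c K y \in unitmx.
Proof.
by move=> ac cy uK; rewrite /bil_in_chart !unitmx_mul unitmx_tr uK (frame_inv_unit ac cy).
Qed.

(** As J is parallel, the covariant derivative of F inherits the anti-invariance of F, so
    [closed_anti_invariant] applies to it at each point. [symmetric_connection_closed] converts
    between covariant and partial derivatives on both sides. *)
Lemma anti_invariant_closed2 F : smooth_bilinear mfd F ->
  (forall x, (F x)^T = - F x) -> (forall x, J x *m F x *m (J x)^T = - F x) ->
  closed2 F -> closed2 (fun x => J x *m F x).
Proof.
move=> sF Fa FJ cF c y i j k ac cy; have oc := image_open ac.
have [V [Gam [[oV Vy Vc] sG Gs DG]]] := exists_christoffel hM hnabla (torsion_free hLC) ac cy.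
have sJ := kahler_J_smooth hK.
have pg := parallel_metric hM hg hLC.
have pJg := parallel_bilM sJ (kahler_J_parallel hK) pg.
have sJc : smooth_mx (chart_image c) (endoc c J) := sJ c ac.
have sgc : smooth_mx (chart_image c) (bilc c g) := metric_smooth hg ac.
have sFc : smooth_mx (chart_image c) (bilc c F) := sF c ac.
have DK K l : parallel_bil K -> mx_partial l (bilc c K) y
    = Gam l y *m bilc c K y + bilc c K y *m (Gam l y)^T.
  by move=> pK; apply/matrixP => p q; rewrite [LHS]mxE DG.
(* The values at [y] are introduced as opaque matrices, to be kept apart from the functions that are
   differentiated. *)
have [Jc JcE] : exists Jc, Jc = endoc c J y by eexists.
have [Fc FcE] : exists Fc, Fc = bilc c F y by eexists.
have [gc gcE] : exists gc, gc = bilc c g y by eexists.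
have Dg l := DK g l pg; rewrite -gcE in Dg.
have JJ : Jc *m Jc = - 1%:M by rewrite JcE; exact: endo_sqr_in_chart ac cy.
(* The Christoffel equations are available for bilinear forms only; that of J follows from those of
   [g] and of the parallel form [J g], after division by the invertible [g]. *)
have DJ l : mx_partial l (endoc c J) y = Gam l y *m Jc - Jc *m Gam l y.
  have ug : gc \in unitmx by rewrite gcE; exact: bil_unit_in_chart ac cy (metric_nondegenerate hg _).
  have := DK _ l pJg; rewrite (bil_mull_in_chart _ _ ac cy).
  rewrite (mx_partial_near l oc cy (G := fun z => endoc c J z *m bilc c g z)); last first.
    by move=> z cz; rewrite (bil_mull_in_chart _ _ ac cz).
  rewrite (mx_partialM l oc cy sJc sgc) Dg -JcE -gcE => H.
  rewrite -[LHS](mulmxK ug) -[RHS](mulmxK ug); congr (_ *m _).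
  apply: (addIr (Jc *m (Gam l y *m gc + gc *m (Gam l y)^T))); rewrite H.
  by rewrite mulmxBl mulmxDr !mulmxA addrA subrK.
(* [T l] is the covariant derivative of F along the [l]-th coordinate. *)
have [T TE] : exists T : 'I_n -> 'M[R]_n, forall l,
    T l = mx_partial l (bilc c F) y - (Gam l y *m Fc + Fc *m (Gam l y)^T).
  by exists (fun l => mx_partial l (bilc c F) y - (Gam l y *m Fc + Fc *m (Gam l y)^T)).
have DF l : mx_partial l (bilc c F) y = T l + (Gam l y *m Fc + Fc *m (Gam l y)^T).
  by rewrite TE subrK.
have bilcN K : bilc c (fun x => - K x) = fun z => - bilc c K z.
  by apply/funext => z; rewrite bil_opp_in_chart.
have bilcT K : bilc c (fun x => (K x)^T) = fun z => (bilc c K z)^T.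
  by apply/funext => z; rewrite bil_tr_in_chart.
have FTE : (fun x => (F x)^T) = (fun x => - F x) by apply/funext.
have FcT : Fc^T = - Fc by rewrite FcE -bil_tr_in_chart FTE bil_opp_in_chart.
have Za l : (Gam l y *m Fc + Fc *m (Gam l y)^T)^T = - (Gam l y *m Fc + Fc *m (Gam l y)^T).
  by rewrite linearD /= !trmx_mul trmxK FcT mulmxN mulNmx -opprD addrC.
have Ta l : (T l)^T = - T l.
  rewrite TE linearB /= Za -mx_partialT -bilcT FTE bilcN (mx_partialN l cy sFc).
  by rewrite opprK opprB addrC.
have JFcJ z : chart_image c z -> endoc c J z *m bilc c F z *m (endoc c J z)^T = - bilc c F z.
  move=> cz; rewrite -(bil_mull_in_chart _ _ ac cz) -(bil_mulr_in_chart _ _ ac cz).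
  by rewrite -bil_opp_in_chart; congr (bilc c _ z); apply/funext.
have JFJ : Jc *m Fc *m Jc^T = - Fc by rewrite JcE FcE; exact: JFcJ.
have FcJ : Fc *m Jc^T = Jc *m Fc.
  apply: oppr_inj; rewrite -[in RHS]mulmxN -JFJ !mulmxA JJ.
  by rewrite mulNmx mul1mx mulNmx.
have DJF l : mx_partial l (bilc c (fun x => J x *m F x)) y
    = Jc *m T l + (Gam l y *m (Jc *m Fc) + (Jc *m Fc) *m (Gam l y)^T).
  rewrite (mx_partial_near l oc cy (G := fun z => endoc c J z *m bilc c F z)); last first.
    by move=> z cz; rewrite (bil_mull_in_chart _ _ ac cz).
  rewrite (mx_partialM l oc cy sJc sFc) DJ DF -JcE -FcE.
  rewrite mulmxBl !mulmxDr !mulmxA.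
  have arith (a b u d : 'M[R]_n) : a - b + (u + (b + d)) = u + (a + d).
    by apply/matrixP => p q; rewrite !mxE; ring.
  exact: arith.
have TJ l : Jc *m T l *m Jc^T = - T l.
  have sJF := smooth_mxM oc sJc sFc.
  have D1 : mx_partial l (fun z => endoc c J z *m bilc c F z *m (endoc c J z)^T) y
      = mx_partial l (fun z => - bilc c F z) y by exact: mx_partial_near oc cy JFcJ.
  have D2 : mx_partial l (fun z => endoc c J z *m bilc c F z) y
      = mx_partial l (bilc c (fun x => J x *m F x)) y.
    by apply: (mx_partial_near l oc cy) => z cz; rewrite (bil_mull_in_chart _ _ ac cz).
  move: D1; rewrite (mx_partialM l oc cy sJF (smooth_mxT sJc)) D2 DJF mx_partialT DJ -JcE -FcE.
  have E1 : (Gam l y *m Jc - Jc *m Gam l y)^T = Jc^T *m (Gam l y)^T - (Gam l y)^T *m Jc^T.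
    by rewrite linearB /= !trmx_mul.
  have E2 : Gam l y *m Jc *m Fc *m Jc^T = - (Gam l y *m Fc).
    by rewrite -!mulmxA (mulmxA Jc) JFJ mulmxN.
  rewrite (mx_partialN l cy sFc) DF E1 mulmxBr !mulmxDl !mulmxA E2 JFJ mulNmx.
  have arith (a b u d f : 'M[R]_n) : a + (- b + u) + (- d - u) = - (f + (b + d)) -> a = - f.
    move=> E; have -> : a = a + (- b + u) + (- d - u) + (b + d).
      by apply/matrixP => p q; rewrite !mxE; ring.
    by rewrite E; apply/matrixP => p q; rewrite !mxE; ring.
  exact: arith.
(* Linear extension in the direction of differentiation: J mixes the coordinate vectors, so the
   indexed family [T] does not suffice. *)
pose Tm (a : 'rV[R]_n) := \sum_i a 0 i *: T i.
pose t (a b d : 'rV[R]_n) : R := (b *m Tm a *m d^T) 0 0.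
have tE a b d : t a b d = \sum_i \sum_j \sum_k a 0 i * b 0 j * d 0 k * T i j k.
  rewrite /t /Tm mulmx_sumr mulmx_suml summxE; apply: eq_bigr => l _.
  rewrite -scalemxAr -scalemxAl mxE mxE exchange_big mulr_sumr /=; apply: eq_bigr => q _.
  rewrite !mxE mulr_suml mulr_sumr; apply: eq_bigr => p _; ring.
have clT p q r : T p q r + T q r p + T r p q = 0.
  have gen (S U Z : 'I_n -> 'I_n -> 'I_n -> R) : (forall l p q, S l p q = U l p q + Z l p q) ->
      (forall l p q, U l p q = - U l q p) -> S p q r - S q p r + S r p q = 0 ->
      Z p q r - Z q p r + Z r p q = 0 -> U p q r + U q r p + U r p q = 0.
    move=> SE Ua; rewrite !SE (Ua q r p) => S0 Z0.
    apply: etrans (etrans _ (congr2 (fun a b => a - b) S0 Z0)) (subrr 0); cbv beta; ring.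
  apply: (gen (fun l => mx_partial l (bilc c F) y) (fun l => T l)
    (fun l => Gam l y *m Fc + Fc *m (Gam l y)^T)).
  - by move=> l a b; rewrite DF [LHS]mxE.
  - by move=> l a b; have /matrixP /(_ b a) := Ta l; rewrite mxE [X in _ = X -> _]mxE.
  - exact: (cF c y p q r ac cy).
  - exact: (@symmetric_connection_closed _ _ _ (fun l => Gam l y) p q r FcT (fun a b => Gs a b y Vy)).
have clt a b d : t a b d + t b d a + t d a b = 0.
  have t2 : t b d a = \sum_i \sum_j \sum_k a 0 i * b 0 j * d 0 k * T j k i.
    rewrite tE; under eq_bigr do rewrite exchange_big /=.
    rewrite exchange_big /=; apply: eq_bigr => p _; apply: eq_bigr => q _; apply: eq_bigr => r _.
    ring.
  have t3 : t d a b = \sum_i \sum_j \sum_k a 0 i * b 0 j * d 0 k * T k i j.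
    rewrite tE exchange_big /=; apply: eq_bigr => p _.
    rewrite exchange_big /=; apply: eq_bigr => q _; apply: eq_bigr => r _.
    ring.
  rewrite tE t2 t3 -!big_split /=; apply: big1 => p _.
  rewrite -!big_split /=; apply: big1 => q _; rewrite -!big_split /=; apply: big1 => r _.
  by rewrite -!mulrDr clT mulr0.
have TmN a : Tm (- a) = - Tm a.
  by rewrite /Tm -sumrN; apply: eq_bigr => l _; rewrite mxE scaleNr.
have TmJ a : Jc *m Tm a *m Jc^T = - Tm a.
  rewrite /Tm mulmx_sumr mulmx_suml -sumrN; apply: eq_bigr => l _.
  by rewrite -scalemxAr -scalemxAl TJ scalerN.
have Tme l : Tm (e l) = T l.
  rewrite /Tm (bigD1 l) //= big1 ?addr0 => [|q ql]; first by rewrite mxE !eqxx scale1r.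
  by rewrite mxE (negbTE ql) andbF scale0r.
have teJ p q r : t (e p) (e q *m Jc) (e r) = (Jc *m T p) q r.
  by rewrite /t Tme -(mulmxA (e q)) basis_bilinear.
have cyc := @closed_anti_invariant R 'rV[R]_n (mulmx^~ Jc) t.
have JcT l : (Jc *m T l)^T = - (Jc *m T l).
  have TlJ : T l *m Jc^T = Jc *m T l.
    apply: oppr_inj; rewrite -[in RHS]mulmxN -TJ !mulmxA JJ.
    by rewrite mulNmx mul1mx mulNmx.
  by rewrite trmx_mul Ta mulNmx TlJ.
have H0 : (Jc *m T i) j k + (Jc *m T j) k i + (Jc *m T k) i j = 0.
  rewrite -!teJ; apply: cyc => //.
  - by move=> a; rewrite -mulmxA JJ mulmxN mulmx1.
  - by move=> a b d; rewrite /t TmN mulmxN mulNmx mxE.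
  - by move=> a b d; rewrite /t mulNmx mulNmx mxE.
  - move=> a b d; rewrite /t trmx_mul -(mulmxA b) !mulmxA -(mulmxA b) -(mulmxA b) TmJ.
    by rewrite mulmxN mulNmx mxE.
have JFT : (Jc *m Fc)^T = - (Jc *m Fc) by rewrite trmx_mul FcT mulNmx FcJ.
have gen (S U Z : 'I_n -> 'I_n -> 'I_n -> R) : (forall l p q, S l p q = U l p q + Z l p q) ->
    (forall l p q, U l p q = - U l q p) -> U i j k + U j k i + U k i j = 0 ->
    Z i j k - Z j i k + Z k i j = 0 -> S i j k - S j i k + S k i j = 0.
  move=> SE Ua; rewrite !SE (Ua j k i) => U0 Z0.
  apply: etrans (etrans _ (congr2 (fun a b => a + b) U0 Z0)) (addr0 0); cbv beta; ring.
apply: (gen (fun l => mx_partial l (bilc c (fun x => J x *m F x)) y) (fun l => Jc *m T l) (fun l => Gam l y *m (Jc *m Fc) + (Jc *m Fc) *m (Gam l y)^T)).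
- by move=> l a b; rewrite DJF [LHS]mxE.
- by move=> l a b; have /matrixP /(_ b a) := JcT l; rewrite mxE [X in _ = X -> _]mxE.
- exact: H0.
- exact: (@symmetric_connection_closed _ _ _ (fun l => Gam l y) i j k JFT (fun a b => Gs a b y Vy)).
Qed.

End Kahler.

(** * Complex matrices *)

Local Open Scope complex_scope.

Section ComplexMatrices.
Context {R : realType}.

Definition cmx m p (K L : 'M[R]_(m, p)) : 'M[R[i]]_(m, p) :=
  \matrix_(j, k) (K j k +i* L j k).

Lemma complexD (a b c d : R) : (a +i* b) + (c +i* d) = (a + c) +i* (b + d).
Proof. by []. Qed.

Lemma complexM (a b c d : R) : (a +i* b) * (c +i* d) = (a * c - b * d) +i* (a * d + b * c).
Proof. by []. Qed.

Lemma complex_sum (I : Type) (r : seq I) (f h : I -> R) :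
  \sum_(i <- r) (f i +i* h i) = (\sum_(i <- r) f i) +i* (\sum_(i <- r) h i).
Proof.
elim: r => [|i r IH]; first by rewrite !big_nil.
by rewrite !big_cons IH complexD.
Qed.

Lemma cmxM m p q (K L : 'M[R]_(m, p)) (K' L' : 'M[R]_(p, q)) :
  cmx K L *m cmx K' L' = cmx (K *m K' - L *m L') (K *m L' + L *m K').
Proof.
apply/matrixP => j k; rewrite !mxE.
under eq_bigr do rewrite !mxE complexM.
by rewrite complex_sum sumrB big_split.
Qed.

Lemma cmxD m p (K L K' L' : 'M[R]_(m, p)) : cmx K L + cmx K' L' = cmx (K + K') (L + L').
Proof. by apply/matrixP => j k; rewrite !mxE complexD. Qed.

Lemma cmxT m p (K L : 'M[R]_(m, p)) : (cmx K L)^T = cmx K^T L^T.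
Proof. by apply/matrixP => j k; rewrite !mxE. Qed.

Lemma complexifyE m p (K : 'M[R]_(m, p)) : complexify K = cmx K 0.
Proof. by apply/matrixP => j k; rewrite !mxE. Qed.

Lemma cmx_decomp m p (z : 'M[R[i]]_(m, p)) :
  z = cmx (\matrix_(j, k) complex.Re (z j k)) (\matrix_(j, k) complex.Im (z j k)).
Proof. by apply/matrixP => j k; rewrite !mxE; case: (z j k). Qed.

Lemma cmx0 m p : cmx 0 0 = 0 :> 'M[R[i]]_(m, p).
Proof. by apply/matrixP => j k; rewrite !mxE. Qed.

Lemma cmxN m p (K L : 'M[R]_(m, p)) : - cmx K L = cmx (- K) (- L).
Proof. by apply/matrixP => j k; rewrite !mxE. Qed.

Lemma cmx1 n : cmx 1%:M 0 = 1%:M :> 'M[R[i]]_n.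
Proof. by apply/matrixP => j k; rewrite !mxE; case: (j == k). Qed.

Lemma scale_i_cmx m p (K L : 'M[R]_(m, p)) : 'i *: cmx K L = cmx (- L) K.
Proof.
by apply/matrixP => j k; rewrite !mxE complexM !mul0r !mul1r sub0r add0r.
Qed.

Lemma scale_real_cmx m p (a : R) (K L : 'M[R]_(m, p)) : a%:C *: cmx K L = cmx (a *: K) (a *: L).
Proof.
by apply/matrixP => j k; rewrite !mxE complexM !mul0r subr0 addr0.
Qed.

Lemma complex_half : 2^-1 = (2^-1 : R)%:C :> R[i].
Proof. by rewrite fmorphV /= rmorph_nat. Qed.

End ComplexMatrices.

Section ComplexDerivative.
Context {R : realType} {n : nat}.
Local Notation e := (@basis_vec R n).
Implicit Types (y : 'rV[R]_n) (U : set 'rV[R]_n).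

Lemma smooth_mx_cst m p U (P : 'M[R]_(m, p)) : open U -> smooth_mx U (fun=> P).
Proof. by move=> oU i j; exact: smooth_on_cst. Qed.

Lemma mx_partial_cst m p i (P : 'M[R]_(m, p)) y : mx_partial i (fun=> P) y = 0.
Proof. by apply/matrixP => j k; rewrite !mxE derive_cst. Qed.

Lemma mx_partialD m p i (F G : 'rV[R]_n -> 'M[R]_(m, p)) U y :
  U y -> smooth_mx U F -> smooth_mx U G ->
  mx_partial i (fun z => F z + G z) y = mx_partial i F y + mx_partial i G y.
Proof.
move=> Uy sF sG; apply/matrixP => j k; rewrite !mxE.
have dF : derivable (fun z => F z j k) y (e i) by exact: smooth_on_derivable (sF j k) Uy.
have dG : derivable (fun z => G z j k) y (e i) by exact: smooth_on_derivable (sG j k) Uy.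
rewrite -deriveD //; congr ('D_(e i) _ y).
by apply/funext => z; rewrite mxE.
Qed.

Lemma mx_partialMl m p q i (P : 'M[R]_(m, p)) (G : 'rV[R]_n -> 'M[R]_(p, q)) U y :
  open U -> U y -> smooth_mx U G -> mx_partial i (fun z => P *m G z) y = P *m mx_partial i G y.
Proof.
move=> oU Uy sG; rewrite (mx_partialM i oU Uy (smooth_mx_cst P oU) sG).
by rewrite mx_partial_cst mul0mx add0r.
Qed.

Lemma mx_partialMr m p q i (P : 'M[R]_(p, q)) (G : 'rV[R]_n -> 'M[R]_(m, p)) U y :
  open U -> U y -> smooth_mx U G -> mx_partial i (fun z => G z *m P) y = mx_partial i G y *m P.
Proof.
move=> oU Uy sG; rewrite (mx_partialM i oU Uy sG (smooth_mx_cst P oU)).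
by rewrite mx_partial_cst mulmx0 addr0.
Qed.

Lemma mx_partialB m p i (F G : 'rV[R]_n -> 'M[R]_(m, p)) U y :
  open U -> U y -> smooth_mx U F -> smooth_mx U G ->
  mx_partial i (fun z => F z - G z) y = mx_partial i F y - mx_partial i G y.
Proof.
by move=> oU Uy sF sG; rewrite (mx_partialD i Uy sF (smooth_mxN oU sG)) (mx_partialN i Uy sG).
Qed.

Lemma complex_partial_entry j (P Q : 'rV[R]_n -> 'M[R]_1) y :
  complex_partial j (fun y => cmx (P y) (Q y) 0 0) y
  = cmx (mx_partial j P y) (mx_partial j Q y) 0 0.
Proof.
rewrite /complex_partial !mxE.
by congr (_ +i* _); congr ('D_(e j) _ y); apply/funext => t; rewrite mxE.
Qed.

(** Used with [w] the 1 by 1 identity for 1-forms, and with [w] the transpose of the second vector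
    for 2-forms. *)
Lemma complex_partial_cmx p q j (z : 'rV[R[i]]_p) (w : 'cV[R[i]]_q)
    (A B : 'rV[R]_n -> 'M[R]_(p, q)) U y : open U -> U y ->
  smooth_mx U A -> smooth_mx U B ->
  complex_partial j (fun y => (z *m cmx (A y) (B y) *m w) 0 0) y
  = (z *m cmx (mx_partial j A y) (mx_partial j B y) *m w) 0 0.
Proof.
move=> oU Uy sA sB; rewrite (cmx_decomp z) (cmx_decomp w).
move: (\matrix_(_, _) complex.Re (z _ _)) (\matrix_(_, _) complex.Im (z _ _)) => a b.
move: (\matrix_(_, _) complex.Re (w _ _)) (\matrix_(_, _) complex.Im (w _ _)) => u v.
under eq_fun do rewrite !cmxM.
have sl m (P : 'M[R]_(m, p)) (F : 'rV[R]_n -> 'M[R]_(p, q)) : smooth_mx U F -> smooth_mx U (fun y => P *m F y).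
  by move=> sF; exact: smooth_mxM oU (smooth_mx_cst P oU) sF.
have sr m (P : 'M[R]_(q, m)) (F : 'rV[R]_n -> 'M[R]_(1, q)) :
  smooth_mx U F -> smooth_mx U (fun y => F y *m P).
  by move=> sF; exact: smooth_mxM oU sF (smooth_mx_cst P oU).
have s1 : smooth_mx U (fun y => a *m A y - b *m B y).
  by apply: smooth_mxD => //; [exact: sl | apply: smooth_mxN => //; exact: sl].
have s2 : smooth_mx U (fun y => a *m B y + b *m A y).
  by apply: smooth_mxD => //; exact: sl.
rewrite complex_partial_entry.
rewrite (mx_partialB j oU Uy (sr _ u _ s1) (sr _ v _ s2)) (mx_partialD j Uy (sr _ v _ s1) (sr _ u _ s2)).
rewrite !(mx_partialMr j _ oU Uy) //.
rewrite (mx_partialB j oU Uy (sl _ a _ sA) (sl _ b _ sB)) (mx_partialD j Uy (sl _ a _ sB) (sl _ b _ sA)).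
by rewrite !(mx_partialMl j _ oU Uy) // !cmxM.
Qed.

End ComplexDerivative.

(** * Complex 1-forms and 2-forms *)

Section Forms.
Context {R : realType} {n : nat} {M : topologicalType}.
Variable mfd : smooth_structure R n M.
Local Notation CV := 'rV[R[i]]_n.
Local Notation form := (M -> seq CV -> R[i]).
Implicit Types (c : chart R n M) (x : M) (f : M -> R) (y : 'rV[R]_n) (s : seq CV).
Implicit Types (K L B : M -> 'M[R]_n) (al be : M -> 'cV[R]_n) (omega : form).
Local Notation e := (@basis_vec R n).
Local Notation atlas := (atlas mfd).
Local Notation frame := (frame mfd).
Local Notation chart_at := (chart_at mfd).
Local Notation bilc := (bil_in_chart mfd).
Local Notation endoc := (endo_in_chart mfd).

Definition cform1 al be : form := fun x s =>
  if s is [:: z] then (z *m cmx (al x) (be x)) 0 0 else 0.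

Definition cform2 K L : form := fun x s =>
  if s is [:: z; w] then (z *m cmx (K x) (L x) *m w^T) 0 0 else 0.

Definition cov_in_chart c al y : 'cV[R]_n := frame c (chart_inv c y) *m al (chart_inv c y).

Definition smooth_cov1 al := forall c, atlas c -> smooth_mx (chart_image c) (cov_in_chart c al).

Lemma cform1_degree al be x s : size s != 1%N -> cform1 al be x s = 0.
Proof. by case: s => [|z []]. Qed.

Lemma cform2_degree K L x s : size s != 2 -> cform2 K L x s = 0.
Proof. by case: s => [|z [|w []]]. Qed.

Lemma cform1_in_chart c al be y z :
  form_in_chart mfd c (cform1 al be) y [:: z]
  = (z *m cmx (cov_in_chart c al y) (cov_in_chart c be y)) 0 0.
Proof.
rewrite /form_in_chart /= -mulmxA complexifyE cmxM !mul0mx subr0 addr0.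
by [].
Qed.

Lemma cform2_in_chart c K L y z w :
  form_in_chart mfd c (cform2 K L) y [:: z; w]
  = (z *m cmx (bilc c K y) (bilc c L y) *m w^T) 0 0.
Proof.
rewrite /form_in_chart /= trmx_mul !complexifyE cmxT trmx0 !mulmxA.
rewrite -(mulmxA z) cmxM -(mulmxA z) cmxM !mul0mx !mulmx0 !subr0 !addr0 !add0r.
by [].
Qed.

Lemma form_in_chart_degree k omega c y s : (forall x s, size s != k -> omega x s = 0) ->
  size s != k -> form_in_chart mfd c omega y s = 0.
Proof. by move=> deg sk; rewrite /form_in_chart deg // size_map. Qed.

Lemma complex_partial0 j y : complex_partial j (fun=> 0 : R[i]) y = 0.
Proof. by rewrite /complex_partial !derive_cst. Qed.

Lemma ext_d_degree k omega x s : (forall x s, size s != k -> omega x s = 0) ->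
  size s != k.+1 -> ext_d mfd omega x s = 0.
Proof.
move=> deg sk; rewrite /ext_d big1 // => i _; rewrite big1 ?mulr0 // => j _.
rewrite (_ : (fun y => _) = fun=> 0) ?complex_partial0 ?mulr0 //.
apply/funext => y; apply: (form_in_chart_degree _ _ deg).
rewrite size_cat size_take size_drop ltn_ord.
have predE m l : (l < m)%N -> (l + (m - l.+1))%N = m.-1.
  by case: m => // m; rewrite ltnS subSS => /subnKC.
rewrite predE //; move: sk; apply: contra_neq => <-.
by rewrite prednK // (leq_ltn_trans _ (ltn_ord i)).
Qed.

Definition curl al x : 'M[R]_n := let c := chart_at x in
  \matrix_(j, k) (mx_partial j (cov_in_chart c al) (chart_map c x) k 0
                  - mx_partial k (cov_in_chart c al) (chart_map c x) j 0).

Lemma ext_d_cform1 al be : smooth_cov1 al -> smooth_cov1 be ->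
  ext_d mfd (cform1 al be) = cform2 (curl al) (curl be).
Proof.
move=> sal sbe; apply/funext => x; apply/funext => s.
have [s2|] := eqVneq (size s) 2; last first.
  by move=> s2; rewrite (ext_d_degree x (@cform1_degree al be) s2) cform2_degree.
case: s s2 => [|z [|w []]] //= _.
rewrite /ext_d /= big_ord_recl big_ord1 /= expr0 mul1r expr1 mulN1r.
set c := chart_at x; set y := chart_map c x.
have ac : atlas c := chart_at_atlas mfd x.
have cy : chart_image c y := image_chart_map (chart_at_dom mfd x).
have oc := image_open ac.
have H (u : CV) j : complex_partial j (fun y => form_in_chart mfd c (cform1 al be) y [:: u]) y
    = \sum_k u 0 k * (mx_partial j (cov_in_chart c al) y k 0
                      +i* mx_partial j (cov_in_chart c be) y k 0).
  have -> : (fun y => form_in_chart mfd c (cform1 al be) y [:: u])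
      = (fun y => (u *m cmx (cov_in_chart c al y) (cov_in_chart c be y) *m (1%:M : 'M_1)) 0 0).
    by apply/funext => t; rewrite cform1_in_chart mulmx1.
  rewrite (complex_partial_cmx j u (1%:M : 'cV_1) oc cy (sal c ac) (sbe c ac)) mulmx1 mxE.
  by apply: eq_bigr => k _; rewrite mxE.
pose C j k : R[i] := mx_partial j (cov_in_chart c al) y k 0
  +i* mx_partial j (cov_in_chart c be) y k 0.
transitivity (\sum_j \sum_k z 0 j * w 0 k * C j k - \sum_j \sum_k z 0 j * w 0 k * C k j).
  congr (_ - _); last rewrite exchange_big /=.
    by apply: eq_bigr => j _; rewrite H mulr_sumr; apply: eq_bigr => k _; rewrite mulrA.
  apply: eq_bigr => j _; rewrite H mulr_sumr; apply: eq_bigr => k _.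
  by rewrite -/(C j k) mulrA [w 0 j * _]mulrC.
rewrite [RHS]mxE -sumrB.
transitivity (\sum_k \sum_j z 0 j * w 0 k * (C j k - C k j)).
  rewrite exchange_big /=; apply: eq_bigr => j _; rewrite -sumrB.
  by apply: eq_bigr => k _; rewrite mulrBr.
apply: eq_bigr => k _; rewrite [X in _ = X * _]mxE mulr_suml [X in _ = \sum_j _ * X]mxE.
apply: eq_bigr => j _; rewrite [X in _ = _ * X * _]mxE.
rewrite -mulrA [w 0 k * _]mulrC mulrA; congr (_ * _ * _).
by rewrite /curl [X in _ = X +i* _]mxE [X in _ = _ +i* X]mxE.
Qed.

Lemma ext_d_cform2_closed K L : smooth_bilinear mfd K -> smooth_bilinear mfd L ->
  closed2 mfd K -> closed2 mfd L -> ext_d mfd (cform2 K L) = zero_form.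
Proof.
move=> sK sL cK cL; apply/funext => x; apply/funext => s.
have [s3|] := eqVneq (size s) 3; last first.
  by move=> s3; rewrite (ext_d_degree x (@cform2_degree K L) s3).
case: s s3 => [|z0 [|z1 [|z2 []]]] //= _.
rewrite /ext_d /= !big_ord_recl big_ord0 /= /bump /= expr0 mul1r expr1 mulN1r addr0.
rewrite sqrrN expr1n mul1r.
set c := chart_at x; set y := chart_map c x.
have ac : atlas c := chart_at_atlas mfd x.
have cy : chart_image c y := image_chart_map (chart_at_dom mfd x).
have oc := image_open ac.
pose C j k l : R[i] := mx_partial j (bilc c K) y k l +i* mx_partial j (bilc c L) y k l.
have H (u w : CV) j : complex_partial j (fun y => form_in_chart mfd c (cform2 K L) y [:: u; w]) y
    = \sum_k \sum_l u 0 k * w 0 l * C j k l.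
  have -> : (fun y => form_in_chart mfd c (cform2 K L) y [:: u; w])
      = (fun y => (u *m cmx (bilc c K y) (bilc c L y) *m w^T) 0 0).
    by apply/funext => t; rewrite cform2_in_chart.
  rewrite (complex_partial_cmx j u w^T oc cy (sK c ac) (sL c ac)) mxE exchange_big /=.
  apply: eq_bigr => l _; rewrite mxE mulr_suml; apply: eq_bigr => k _.
  by rewrite [X in _ * X * _]mxE [X in _ * X = _]mxE mulrAC.
have H3 (u v w : CV) : \sum_j u 0 j * complex_partial j
    (fun y => form_in_chart mfd c (cform2 K L) y [:: v; w]) y
    = \sum_j \sum_k \sum_l u 0 j * v 0 k * w 0 l * C j k l.
  apply: eq_bigr => j _; rewrite H mulr_sumr; apply: eq_bigr => k _.
  by rewrite mulr_sumr; apply: eq_bigr => l _; rewrite !mulrA.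
have E := congr2 +%R (H3 z0 z1 z2) (congr2 +%R (congr1 -%R (H3 z1 z0 z2)) (H3 z2 z0 z1)).
apply: etrans E _.
have Ccl j k l : C j k l - C k j l + C l j k = 0.
  transitivity (ext_d2 (bilc c K) y j k l +i* ext_d2 (bilc c L) y j k l); first by [].
  by rewrite cK // cL.
have -> : \sum_j \sum_k \sum_l z1 0 j * z0 0 k * z2 0 l * C j k l
    = \sum_j \sum_k \sum_l z0 0 j * z1 0 k * z2 0 l * C k j l.
  rewrite exchange_big /=; apply: eq_bigr => j _; apply: eq_bigr => k _; apply: eq_bigr => l _.
  by rewrite [z1 0 k * _]mulrC.
have -> : \sum_j \sum_k \sum_l z2 0 j * z0 0 k * z1 0 l * C j k l
    = \sum_j \sum_k \sum_l z0 0 j * z1 0 k * z2 0 l * C l j k.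
  rewrite exchange_big /=; apply: eq_bigr => j _.
  rewrite exchange_big /=; apply: eq_bigr => k _; apply: eq_bigr => l _.
  by rewrite [z2 0 l * _]mulrC [_ * z2 0 l * z1 0 k]mulrAC.
rewrite addrA -sumrB -big_split /=; apply: big1 => j _.
rewrite -sumrB -big_split /=; apply: big1 => k _.
rewrite -sumrB -big_split /=; apply: big1 => l _.
by rewrite -mulrBr -mulrDr Ccl mulr0.
Qed.

(* The (p, q)-types of [cform1] and [cform2] are tested with the matrices of
   the projections onto T^{1,0} and T^{0,1}. *)
Variable J : M -> 'M[R]_n.
Hypothesis JJ : forall x, J x *m J x = - 1%:M.

(** The matrix of (1 - iJ)/2 or (1 + iJ)/2, split into real and imaginary parts. *)
Definition projmx (b : bool) x : 'M[R[i]]_n :=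
  cmx (2^-1 *: 1%:M) (2^-1 *: (if b then - J x else J x)).

Lemma proj_typeE b x z : proj_type J b x z = z *m projmx b x.
Proof.
rewrite /proj_type complexifyE.
have -> : projmx b x = 2^-1 *: (if b then 1%:M - 'i *: cmx (J x) 0 else 1%:M + 'i *: cmx (J x) 0).
  rewrite complex_half scale_i_cmx -cmx1 oppr0.
  by case: b; rewrite ?cmxN cmxD scale_real_cmx ?oppr0 ?addr0 ?add0r.
by rewrite -scalemxAr; case: b; rewrite ?mulmxBr ?mulmxDr mulmx1 -scalemxAr.
Qed.

Lemma projmx_mul b b' x : projmx b x *m projmx b' x = if b == b' then projmx b x else 0.
Proof.
pose sg (b : bool) : R := if b then -1 else 1.
have E d : projmx d x = cmx (2^-1 *: 1%:M) ((2^-1 * sg d) *: J x).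
  by rewrite /projmx /sg; case: d; rewrite ?mulr1 // mulrN1 scaleNr scalerN.
rewrite !E cmxM -!scalemxAl -!scalemxAr !scalerA mul1mx mul1mx mulmx1 JJ scalerN opprK.
rewrite -!scalerDl.
have -> : 2^-1 * 2^-1 + 2^-1 * sg b * (2^-1 * sg b') = if b == b' then 2^-1 else 0.
  by case: b; case: b'; rewrite /sg /=; field.
have -> : 2^-1 * (2^-1 * sg b') + 2^-1 * sg b * 2^-1 = if b == b' then 2^-1 * sg b else 0.
  by case: b; case: b'; rewrite /sg /=; field.
by case: eqP => // _; rewrite !scale0r cmx0.
Qed.

Lemma bidegree_part1_form1 p omega x z :
  bidegree_part J p omega x [:: z]
  = \sum_(b : bool | (b : nat) == p) omega x [:: z *m projmx b x].
Proof.
rewrite /bidegree_part /=.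
rewrite (reindex (fun b : bool => [tuple b])) /=; last first.
  exists (fun t : 1.-tuple bool => thead t) => [b _|[[|b [|? ?]] //= i] _] //.
  exact: val_inj.
by apply: eq_big => [b|b _]; [rewrite addn0 | rewrite /proj_types /= proj_typeE].
Qed.

Lemma bidegree_part_form2 p omega x z w :
  bidegree_part J p omega x [:: z; w]
  = \sum_(b : bool * bool | (b.1 + b.2)%N == p)
      omega x [:: z *m projmx b.1 x; w *m projmx b.2 x].
Proof.
rewrite /bidegree_part /=.
rewrite (reindex (fun b : bool * bool => [tuple b.1; b.2])) /=; last first.
  exists (fun t : 2.-tuple bool => (tnth t ord0, tnth t ord_max)) => [[b b'] _|[[|b [|b' [|? ?]]] //= i] _] //.
  exact: val_inj.
by apply: eq_big => [b|b _]; [rewrite /= addn0 | rewrite /proj_types /= !proj_typeE].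
Qed.

Lemma bidegree_part_degree k p omega x s : (forall x s, size s != k -> omega x s = 0) ->
  size s != k -> bidegree_part J p omega x s = 0.
Proof.
move=> deg sk; rewrite /bidegree_part big1 // => b _; apply: deg.
by rewrite /proj_types size_map size_zip size_tuple minnn.
Qed.

Lemma bidegree_part_cform2 p K L K' L' :
  (forall x, cmx (K' x) (L' x) = \sum_(b : bool * bool | (b.1 + b.2)%N == p)
     projmx b.1 x *m cmx (K x) (L x) *m (projmx b.2 x)^T) ->
  bidegree_part J p (cform2 K L) = cform2 K' L'.
Proof.
move=> E; apply/funext => x; apply/funext => s.
have [s2|s2] := eqVneq (size s) 2; last first.
  rewrite cform2_degree //; apply: bidegree_part_degree s2 => {}x {}s.
  exact: cform2_degree.
case: s s2 => [|z [|w []]] //= _.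
rewrite bidegree_part_form2 /= E mulmx_sumr mulmx_suml summxE.
by apply: eq_bigr => b _; rewrite trmx_mul !mulmxA.
Qed.

Lemma bidegree_part_cform1 p al be al' be' :
  (forall x, cmx (al' x) (be' x) = \sum_(b : bool | (b : nat) == p)
     projmx b x *m cmx (al x) (be x)) ->
  bidegree_part J p (cform1 al be) = cform1 al' be'.
Proof.
move=> E; apply/funext => x; apply/funext => s.
have [s1|s1] := eqVneq (size s) 1%N; last first.
  rewrite cform1_degree //; apply: bidegree_part_degree s1 => {}x {}s.
  exact: cform1_degree.
case: s s1 => [|z []] //= _.
rewrite bidegree_part1_form1 /= E mulmx_sumr summxE.
by apply: eq_bigr => b _; rewrite !mulmxA.
Qed.

Lemma cmx_basis1 al be c y j :
  form_in_chart mfd c (cform1 al be) y [:: complexify (e j)]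
  = cov_in_chart c al y j 0 +i* cov_in_chart c be y j 0.
Proof.
rewrite cform1_in_chart complexifyE cmxM !mul0mx subr0 addr0 mxE.
by rewrite /basis_vec -!rowE !mxE.
Qed.

Lemma cmx_basis2 K L c y j k :
  form_in_chart mfd c (cform2 K L) y [:: complexify (e j); complexify (e k)]
  = bilc c K y j k +i* bilc c L y j k.
Proof.
rewrite cform2_in_chart !complexifyE cmxT trmx0 !cmxM !mul0mx !mulmx0 !subr0 !addr0 add0r mxE.
by rewrite !basis_bilinear.
Qed.

Lemma is_form_cform1 al be : smooth_cov1 al -> smooth_cov1 be ->
  is_form mfd 1 (cform1 al be).
Proof.
move=> sal sbe; split.
- by move=> x s; exact: cform1_degree.
- move=> x [|u s1] [|u' s2] a z z' //= _.
  by rewrite mulmxDl -scalemxAl mxE [X in X + _]mxE.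
- by move=> x s1 s2 s3 z; rewrite cform1_degree // !size_cat /= size_cat /= !addnS.
move=> c ac t /=; have oc := image_open ac.
have [t1|t1] := eqVneq (size t) 1%N.
  case: t t1 => [|j []] //= _; split.
    by apply: (smooth_on_eq oc _ (sal c ac j 0)) => y cy; rewrite cmx_basis1.
  by apply: (smooth_on_eq oc _ (sbe c ac j 0)) => y cy; rewrite cmx_basis1.
have Z y : form_in_chart mfd c (cform1 al be) y [seq complexify (e i) | i <- t] = 0.
  by apply: (form_in_chart_degree _ _ (@cform1_degree al be)); rewrite size_map.
by split; apply: (smooth_on_eq oc _ (smooth_on_cst 0 oc)) => y _; rewrite Z.
Qed.

Lemma is_form_cform2 K L : smooth_bilinear mfd K -> smooth_bilinear mfd L ->
  (forall x, (K x)^T = - K x) -> (forall x, (L x)^T = - L x) ->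
  is_form mfd 2 (cform2 K L).
Proof.
move=> sK sL Ka La; split.
- by move=> x s; exact: cform2_degree.
- move=> x [|u [|u1 s1]] [|u' [|u1' s2]] a z z' //= _.
    by rewrite !mulmxDl -!scalemxAl mxE [X in X + _]mxE.
  by rewrite linearD linearZ /= mulmxDr -scalemxAr mxE [X in X + _]mxE.
- move=> x s1 s2 s3 z.
  have [|/cform2_degree-> //] := eqVneq (size (s1 ++ z :: s2 ++ z :: s3)) 2.
  case: s1 s2 s3 => [|u s1] [|u' s2] [|u'' s3] //=; rewrite ?size_cat /= ?size_cat /= ?addnS // => _.
  set v := (_ *m _ *m _) 0 0.
  have : v = - v.
    rewrite {1}/v -[_ *m _ *m _]trmxK mxE !trmx_mul trmxK cmxT Ka La -cmxN.
    by rewrite mulNmx mulmxN mulmxA mxE.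
  by move/eqP; rewrite -addr_eq0 -mulr2n mulrn_eq0 => /eqP.
move=> c ac t /=; have oc := image_open ac.
have [t1|t1] := eqVneq (size t) 2.
  case: t t1 => [|j [|k []]] //= _; split.
    by apply: (smooth_on_eq oc _ (sK c ac j k)) => y cy; rewrite cmx_basis2.
  by apply: (smooth_on_eq oc _ (sL c ac j k)) => y cy; rewrite cmx_basis2.
have Z y : form_in_chart mfd c (cform2 K L) y [seq complexify (e i) | i <- t] = 0.
  by apply: (form_in_chart_degree _ _ (@cform2_degree K L)); rewrite size_map.
by split; apply: (smooth_on_eq oc _ (smooth_on_cst 0 oc)) => y _; rewrite Z.
Qed.

Lemma pq_form_cform1 al be : smooth_cov1 al -> smooth_cov1 be ->
  (forall x, projmx false x *m cmx (al x) (be x) = 0) -> is_pq_form mfd J 1 0 (cform1 al be).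
Proof.
move=> sal sbe P0; split; first exact: is_form_cform1.
move=> x [|b []] [|z []] //= _ _; case: b => //= _.
by rewrite proj_typeE -mulmxA P0 mulmx0 mxE.
Qed.

Lemma pq_form_cform2 p q K L : (p + q)%N = 2 ->
  smooth_bilinear mfd K -> smooth_bilinear mfd L ->
  (forall x, (K x)^T = - K x) -> (forall x, (L x)^T = - L x) ->
  (forall x (b b' : bool), (b + b')%N != p ->
     projmx b x *m cmx (K x) (L x) *m (projmx b' x)^T = 0) ->
  is_pq_form mfd J p q (cform2 K L).
Proof.
move=> pq sK sL Ka La P0; split; first by rewrite pq; exact: is_form_cform2.
move=> x b s; rewrite pq; case: b => [|b [|b' []]] //; case: s => [|z [|w []]] //= _ _.
rewrite addn0 => bb; rewrite !proj_typeE trmx_mul !mulmxA.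
by rewrite -(mulmxA z) -(mulmxA z) P0 // mulmx0 mul0mx mxE.
Qed.

Lemma sum_bool_pair (V : zmodType) p (F : bool -> bool -> V) :
  \sum_(b : bool * bool | (b.1 + b.2)%N == p) F b.1 b.2
  = (if p == 2 then F true true else 0) + (if p == 1%N then F true false + F false true else 0)
    + (if p == 0%N then F false false else 0).
Proof.
rewrite big_mkcond -(pair_bigA _ (fun b b' : bool => if (b + b')%N == p then F b b' else 0)) /=.
by rewrite !big_bool /=; case: p => [|[|[|p]]] /=; rewrite ?addr0 ?add0r.
Qed.

End Forms.

(** * Exact parallel 2-forms *)

Section TypeProjections.
Context {R : realType} {n : nat} {M : topologicalType}.
Variable J : M -> 'M[R]_n.
Implicit Types (x : M) (K L : 'M[R]_n).

(** The signs are those of [projmx b] = (1 + i s J)/2; expanding the triple product separates real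
    and imaginary parts of every type component of a 2-form. *)
Lemma projmx_conj b b' x K L : let s := if b then -1 else 1 in let s' := if b' then -1 else 1 in
  projmx J b x *m cmx K L *m (projmx J b' x)^T
  = 4^-1%:C *: cmx
      (K - (s * s') *: (J x *m K *m (J x)^T) - s *: (J x *m L) - s' *: (L *m (J x)^T))
      (L - (s * s') *: (J x *m L *m (J x)^T) + s *: (J x *m K) + s' *: (K *m (J x)^T)).
Proof.
move=> s s'.
have E d : projmx J d x = (2^-1)%:C *: cmx 1%:M ((if d then -1 else 1) *: J x).
  by rewrite scale_real_cmx /projmx; case: d; rewrite ?scale1r ?scaleN1r.
rewrite !E -/s -/s' [(_ *: cmx _ _)^T]linearZ /= cmxT -scalemxAl -scalemxAr -scalemxAl scalerA.
rewrite -rmorphM /=; have -> : 2^-1 * 2^-1 = 4^-1 :> R by rewrite -invfM -natrM.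
congr (_ *: _); rewrite cmxM [(_ *: J x)^T]linearZ /= trmx1 !mul1mx cmxM !mulmx1.
have sJ P : (s *: J x) *m P = s *: (J x *m P) by rewrite scalemxAl.
have sJ' P : P *m (s' *: (J x)^T) = s' *: (P *m (J x)^T) by rewrite scalemxAr.
rewrite !sJ !sJ' !mulmxBl !mulmxDl -!scalemxAl !scalerBr !scalerDr !scalerA ![s' * s]mulrC.
move: (J x *m K *m (J x)^T) (J x *m L *m (J x)^T) (J x *m K) (J x *m L) (K *m (J x)^T) (L *m (J x)^T) => a1 a2 a3 a4 a5 a6.
by congr (cmx _ _); apply/matrixP => j k; rewrite !mxE; ring.
Qed.

Lemma projmx_conj_tt x K L :
  projmx J true x *m cmx K L *m (projmx J true x)^T
  = 4^-1%:C *: cmx (K - J x *m K *m (J x)^T + J x *m L + L *m (J x)^T)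
                   (L - J x *m L *m (J x)^T - J x *m K - K *m (J x)^T).
Proof. by rewrite projmx_conj /= mulrNN mulr1 !scaleN1r scale1r !opprK scale1r. Qed.

Lemma projmx_conj_mixed x K L :
  projmx J true x *m cmx K L *m (projmx J false x)^T
  + projmx J false x *m cmx K L *m (projmx J true x)^T
  = cmx (2^-1 *: (K + J x *m K *m (J x)^T)) (2^-1 *: (L + J x *m L *m (J x)^T)).
Proof.
rewrite !projmx_conj /= -scalerDr cmxD scale_real_cmx mulr1 mul1r !scale1r !scaleN1r !opprK.
move: (J x *m K *m (J x)^T) (J x *m L *m (J x)^T) (J x *m K) (J x *m L) (K *m (J x)^T) (L *m (J x)^T) => a1 a2 a3 a4 a5 a6.
by congr (cmx _ _); apply/matrixP => j k; rewrite !mxE; field.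
Qed.

Lemma projmx_assoc b d d' b' x (P : 'M[R[i]]_n) :
  projmx J b x *m (projmx J d x *m P *m (projmx J d' x)^T) *m (projmx J b' x)^T
  = (projmx J b x *m projmx J d x) *m P *m (projmx J b' x *m projmx J d' x)^T.
Proof. by rewrite trmx_mul !mulmxA. Qed.

End TypeProjections.

(** * The type components of d of a (1,0)-form *)

Section Lemmas.
Context {R : realType} {n : nat} {M : topologicalType}.
Variable mfd : smooth_structure R n M.
Hypothesis hM : hausdorff_space M.
Variables (g : M -> 'M[R]_n) (nabla : (M -> 'rV[R]_n) -> M -> 'M[R]_n).
Variable J : M -> 'M[R]_n.
Hypothesis hK : is_pseudo_kahler mfd g nabla J.
Hypothesis ddbar : deldelbar_property mfd J.
Implicit Types (c : chart R n M) (x : M) (f : M -> R) (y w : 'rV[R]_n).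
Implicit Types (X Y Z v : M -> 'rV[R]_n) (B C K F : M -> 'M[R]_n).
Local Notation e := (@basis_vec R n).
Local Notation atlas := (atlas mfd).
Local Notation vfc := (vf_in_chart mfd).
Local Notation bilc := (bil_in_chart mfd).
Local Notation parallel_bil := (parallel_bil mfd nabla).
Local Notation smooth_vf := (smooth_vf mfd).

Let hg := kahler_metric hK.
Let hLC := kahler_levi_civita hK.
Let hnabla := levi_civita_connection hLC.
Let sJ := kahler_J_smooth hK.
Let pJ := kahler_J_parallel hK.
Let JJ := kahler_J_sqr hK.

Definition flat X x : 'cV[R]_n := (X x *m g x)^T.

Lemma cov_in_chart_flat c X y : atlas c -> chart_image c y ->
  cov_in_chart mfd c (flat X) y = (vfc c X y *m bilc c g y)^T.
Proof.
move=> ac cy; rewrite /cov_in_chart /flat /vf_in_chart /bil_in_chart !mulmxA.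
by rewrite mulmxKV ?(frame_inv_unit ac cy) // [RHS]trmx_mul trmxK.
Qed.

Lemma smooth_flat X : smooth_vf X -> smooth_cov1 mfd (flat X).
Proof.
move=> sX c ac; have oc := image_open ac.
have sg : smooth_mx (chart_image c) (bilc c g) := metric_smooth hg ac.
have s := smooth_mxT (smooth_mxM oc ((smooth_vfP mfd X).1 sX c ac) sg).
by apply: (smooth_mx_eq oc _ s) => y cy; rewrite cov_in_chart_flat.
Qed.

Lemma curl_flat X x : smooth_vf X -> curl mfd (flat X) x = ext_d_flat g nabla X x.
Proof.
move=> sX; set c := chart_at mfd x; set y := chart_map c x.
have ac : atlas c := chart_at_atlas mfd x.
have cy : chart_image c y := image_chart_map (chart_at_dom mfd x).
have E : bilc c (ext_d_flat g nabla X) y = ext_d_flat g nabla X x.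
  rewrite /bil_in_chart /y (chart_mapK' ac (chart_at_dom mfd x)) frame_chart_at.
  by rewrite mul1mx trmx1 mulmx1.
rewrite -E; apply/matrixP => j k; rewrite (ext_d_flat_in_chart hM hg hLC j k ac cy sX).
rewrite [LHS]mxE -/c -/y; congr (_ - _).
  rewrite [LHS]mxE; apply: (derive_open_eq _ (image_open ac) cy) => z cz.
  by rewrite cov_in_chart_flat // mxE.
rewrite [LHS]mxE; apply: (derive_open_eq _ (image_open ac) cy) => z cz.
by rewrite cov_in_chart_flat // mxE.
Qed.

Lemma hermitian_gJ x : g x *m (J x)^T = - (J x *m g x).
Proof.
rewrite -[X in _ = - (_ *m X)](kahler_hermitian hK) !mulmxA JJ.
by rewrite mulNmx mul1mx mulNmx opprK.
Qed.

Lemma flat_J X x : flat (fun p => X p *m J p) x = - (J x *m flat X x).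
Proof.
by rewrite /flat -mulmxA -[J x *m g x]opprK -hermitian_gJ mulmxN linearN /= !trmx_mul trmxK mulmxA.
Qed.

Lemma ext_d_flat_anti X x : (ext_d_flat g nabla X x)^T = - ext_d_flat g nabla X x.
Proof. by rewrite /ext_d_flat linearB /= trmxK opprB. Qed.

Lemma ext_d_flat_J X x : smooth_vf X ->
  ext_d_flat g nabla (fun p => X p *m J p) x
  = J x *m (nabla X x *m g x)^T - nabla X x *m g x *m (J x)^T.
Proof.
move=> sX; rewrite /ext_d_flat (pJ sX) -mulmxA -[J x *m g x]opprK -hermitian_gJ !mulmxN.
by rewrite linearN /= opprK !mulmxA [X in - _ + X]trmx_mul trmxK addrC.
Qed.

(* the (1,0)-form with real part g(X, .) *)
Definition eta X := cform1 (flat X) (flat (fun p => X p *m J p)).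

Lemma pq_eta X : smooth_vf X -> is_pq_form mfd J 1 0 (eta X).
Proof.
move=> sX; apply: pq_form_cform1; [exact: smooth_flat|exact/smooth_flat/smooth_vfM|].
move=> x; rewrite /projmx cmxM flat_J mulmxN -!scalemxAl !mul1mx mulmxA JJ mulNmx mul1mx.
by rewrite scalerN !opprK subrr addrC scalerN subrr cmx0.
Qed.

Lemma ext_d_eta X : smooth_vf X -> ext_d mfd (eta X)
  = cform2 (ext_d_flat g nabla X) (ext_d_flat g nabla (fun p => X p *m J p)).
Proof.
move=> sX; have sXJ := smooth_vfM sX sJ.
rewrite /eta ext_d_cform1; [|exact: smooth_flat|exact: smooth_flat].
by congr cform2; apply/funext => x; rewrite curl_flat.
Qed.

(** Twice the component of type (2,0) + (0,2) of a real 2-form; [Jplus] is twice the component of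
    type (1,1). *)
Definition Jminus F x : 'M[R]_n := F x - J x *m F x *m (J x)^T.
Definition Jplus F x : 'M[R]_n := F x + J x *m F x *m (J x)^T.

Lemma mulJJl x m (P : 'M[R]_(m, n)) : P *m J x *m J x = - P.
Proof. by rewrite -mulmxA JJ mulmxN mulmx1. Qed.

Lemma mulJJTl x m (P : 'M[R]_(m, n)) : P *m (J x)^T *m (J x)^T = - P.
Proof. by rewrite -mulmxA -trmx_mul JJ linearN /= trmx1 mulmxN mulmx1. Qed.

Lemma JJmul x m (P : 'M[R]_(n, m)) : J x *m (J x *m P) = - P.
Proof. by rewrite mulmxA JJ mulNmx mul1mx. Qed.

Lemma Jminus_anti F x : (F x)^T = - F x -> (Jminus F x)^T = - Jminus F x.
Proof.
by move=> Fa; rewrite /Jminus linearB /= !trmx_mul trmxK Fa mulNmx mulmxN !mulmxA opprB opprK addrC.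
Qed.

Lemma Jplus_anti F x : (F x)^T = - F x -> (Jplus F x)^T = - Jplus F x.
Proof.
by move=> Fa; rewrite /Jplus linearD /= !trmx_mul trmxK Fa mulNmx mulmxN !mulmxA opprD.
Qed.

Lemma Jminus_J F x : J x *m Jminus F x *m (J x)^T = - Jminus F x.
Proof.
rewrite /Jminus mulmxBr mulmxBl -(mulmxA (J x) (F x)) JJmul mulNmx mulJJTl opprK opprB.
by rewrite !mulmxA.
Qed.

Lemma Jminus_comm F x : Jminus F x *m (J x)^T = J x *m Jminus F x.
Proof.
by apply: oppr_inj; rewrite -(JJmul x) (mulmxA (J x) (Jminus F x)) Jminus_J mulmxN.
Qed.

Lemma J_Jminus F x : J x *m Jminus F x = J x *m F x + F x *m (J x)^T.
Proof. by rewrite mulmxBr -(mulmxA (J x) (F x)) JJmul opprK. Qed.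

Lemma smooth_Jconj F : smooth_bilinear mfd F ->
  smooth_bilinear mfd (fun x => J x *m F x *m (J x)^T).
Proof. by move=> sF; exact: (smooth_bilMr sJ (smooth_bilM sJ sF)). Qed.

Lemma smooth_Jminus F : smooth_bilinear mfd F -> smooth_bilinear mfd (Jminus F).
Proof. by move=> sF; exact: (smooth_bilD sF (smooth_bilN (smooth_Jconj sF))). Qed.

Lemma smooth_Jplus F : smooth_bilinear mfd F -> smooth_bilinear mfd (Jplus F).
Proof. by move=> sF; exact: (smooth_bilD sF (smooth_Jconj sF)). Qed.

Section OneForm.
Variable X : M -> 'rV[R]_n.
Hypothesis sX : smooth_vf X.
Let XJ : M -> 'rV[R]_n := fun p => X p *m J p.
Let K := ext_d_flat g nabla X.
Let K' := ext_d_flat g nabla XJ.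

Let sXJ : smooth_vf XJ. Proof. exact: smooth_vfM. Qed.
Let sK : smooth_bilinear mfd K. Proof. exact: (smooth_ext_d_flat hg hLC sX). Qed.
Let sK' : smooth_bilinear mfd K'. Proof. exact: (smooth_ext_d_flat hg hLC sXJ). Qed.
Let Ka x : (K x)^T = - K x. Proof. exact: ext_d_flat_anti. Qed.
Let K'a x : (K' x)^T = - K' x. Proof. exact: ext_d_flat_anti. Qed.

(* The (0,2)-part of d eta vanishes because J is integrable. *)
Lemma Jminus_K' x : Jminus K' x = - (J x *m Jminus K x).
Proof.
rewrite /Jminus /K' (ext_d_flat_J x sX) /K /ext_d_flat.
move: (nabla X x *m g x) => N.
have E1 : J x *m (J x *m N^T - N *m (J x)^T) *m (J x)^T = - (N^T *m (J x)^T) + J x *m N.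
  by rewrite mulmxBr mulmxBl JJmul !mulmxA mulJJTl mulNmx opprK.
have E2 := J_Jminus (fun=> N - N^T) x; rewrite /Jminus in E2.
rewrite E1 E2 mulmxBr mulmxBl.
move: (J x *m N) (J x *m N^T) (N *m (J x)^T) (N^T *m (J x)^T) => a b c d.
by apply/matrixP => j k; rewrite !mxE; ring.
Qed.

(** Together with [Jminus_K'], this expresses the (2,0)-part of d eta, which involves both [K] and
    [K'], through [Jminus K] alone. *)
Lemma K'_K x : J x *m K' x + K' x *m (J x)^T = Jminus K x.
Proof.
rewrite /Jminus /K' (ext_d_flat_J x sX) /K /ext_d_flat.
move: (nabla X x *m g x) => N.
rewrite mulmxBr JJmul mulmxBl mulJJTl mulmxBr mulmxBl !mulmxA.
move: (J x *m N *m (J x)^T) (J x *m N^T *m (J x)^T) => a b.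
by apply/matrixP => j k; rewrite !mxE; ring.
Qed.

Lemma anti_invariant_part_eq0 : parallel_bil (Jminus K) -> forall x, Jminus K x = 0.
Proof.
move=> pm.
have pJm := parallel_bilM sJ pJ pm.
(* U + i W is the (2,0)-part of d eta. Since [W] is a multiple of [U] rotated by the parallel J,
   both are parallel, hence closed. *)
pose U x := 2^-1 *: Jminus K x.
pose W x := - 2^-1 *: (J x *m Jminus K x).
have pU : parallel_bil U by exact: parallel_bilZ.
have pW : parallel_bil W by exact: parallel_bilZ.
have JmT x : (J x *m Jminus K x)^T = - (J x *m Jminus K x).
  by rewrite trmx_mul Jminus_anti // mulNmx Jminus_comm.
have Ua x : (U x)^T = - U x by rewrite /U linearZ /= Jminus_anti // scalerN.
have Wa x : (W x)^T = - W x by rewrite /W linearZ /= JmT scalerN.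
have UW x : cmx (U x) (W x) = projmx J true x *m cmx (K x) (K' x) *m (projmx J true x)^T.
  rewrite projmx_conj_tt.
  have -> : K x - J x *m K x *m (J x)^T + J x *m K' x + K' x *m (J x)^T = 2 *: Jminus K x.
    by rewrite -addrA K'_K scaler_nat mulr2n.
  have -> : K' x - J x *m K' x *m (J x)^T - J x *m K x - K x *m (J x)^T
      = - 2 *: (J x *m Jminus K x).
    rewrite -[X in X - _ - _]/(Jminus K' x) Jminus_K' scaleNr scaler_nat mulr2n.
    by rewrite -addrA -opprD -J_Jminus -opprD.
  by rewrite scale_real_cmx /U /W !scalerA; congr (cmx (_ *: _) (_ *: _)); field.
have omegaE : del mfd J 1 (eta X) = cform2 U W.
  rewrite /del (ext_d_eta sX); apply: (@bidegree_part_cform2 _ _ _ J 2 K K' U W) => p.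
  by rewrite (sum_bool_pair _ (fun b b' => projmx J b p *m _ *m (projmx J b' p)^T)) /= !addr0 UW.
have pq : is_pq_form mfd J 2 0 (cform2 U W).
  apply: pq_form_cform2 pU.1 pW.1 Ua Wa _ => // x b b' bb.
  rewrite UW projmx_assoc !(projmx_mul JJ).
  by case: b b' bb => [] [] //= _; rewrite ?mul0mx ?trmx0 ?mulmx0.
have cl : ext_d mfd (cform2 U W) = zero_form.
  by apply: ext_d_cform2_closed pU.1 pW.1 _ _; exact: (parallel_closed2 hM hK).
have ex : del_exact mfd J 2 0 (cform2 U W) \/ delbar_exact mfd J 2 0 (cform2 U W).
  by left; exists (eta X); [exact: pq_eta | rewrite omegaE].
(* In bidegree (2,0) there is no potential of bidegree (1,-1), so the form itself is zero. *)
have /= Z := ddbar pq cl ex.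
move=> x; apply/matrixP => j k; rewrite [RHS]mxE.
have := congr1 (fun om => om x [:: complexify (e j); complexify (e k)]) Z.
rewrite /= !complexifyE cmxT trmx0 !cmxM !mul0mx !mulmx0 !subr0 !addr0 add0r mxE !basis_bilinear.
move=> /(congr1 (@complex.Re R)) /=; rewrite [U x j k]mxE => /eqP.
by rewrite mulf_eq0 invr_eq0 pnatr_eq0 /= => /eqP.
Qed.

(** U + i W is the (1,1)-part of d eta, equal to delbar eta by type. [U] is parallel, hence closed;
    [W] comes from [K'], about which nothing is assumed, and its closedness has to go through the
    parts of type (2,0) + (0,2). *)
Lemma invariant_part_potential : parallel_bil (Jplus K) ->
  exists lam, is_pq_form mfd J 0 0 lam /\ exists W,
    cform2 (fun x => 2^-1 *: Jplus K x) W = del mfd J 0 (delbar mfd J 0 lam).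
Proof.
move=> pp.
pose U x := 2^-1 *: Jplus K x.
pose W x := 2^-1 *: Jplus K' x.
have sU : smooth_bilinear mfd U by exact/smooth_bilZ/smooth_Jplus.
have sW : smooth_bilinear mfd W by exact/smooth_bilZ/smooth_Jplus.
have Ua x : (U x)^T = - U x by rewrite /U linearZ /= Jplus_anti // scalerN.
have Wa x : (W x)^T = - W x by rewrite /W linearZ /= Jplus_anti // scalerN.
have UW x : cmx (U x) (W x) =
    projmx J true x *m cmx (K x) (K' x) *m (projmx J false x)^T
    + projmx J false x *m cmx (K x) (K' x) *m (projmx J true x)^T.
  by rewrite projmx_conj_mixed.
have omegaE : delbar mfd J 1 (eta X) = cform2 U W.
  rewrite /delbar (ext_d_eta sX); apply: (@bidegree_part_cform2 _ _ _ J 1 K K' U W) => p.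
  by rewrite (sum_bool_pair _ (fun b b' => projmx J b p *m _ *m (projmx J b' p)^T)) /= add0r addr0 UW.
have pq : is_pq_form mfd J 1 1 (cform2 U W).
  apply: pq_form_cform2 sU sW Ua Wa _ => // x b b' bb.
  rewrite UW mulmxDr mulmxDl !projmx_assoc !(projmx_mul JJ).
  by case: b b' bb => [] [] //= _; rewrite ?mul0mx ?trmx0 ?mulmx0 ?addr0.
have cU : closed2 mfd U.
  by apply: (parallel_closed2 hM hK); [exact: parallel_bilZ | exact: Ua].
have cp : closed2 mfd (Jplus K).
  by apply: (parallel_closed2 hM hK) => // x; exact: Jplus_anti.
have cK : closed2 mfd K := ext_d_flat_closed2 hM hK sX.
have cK' : closed2 mfd K' := ext_d_flat_closed2 hM hK sXJ.
have cm : closed2 mfd (Jminus K).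
  have -> : Jminus K = fun x => 2 *: K x + -1 *: Jplus K x.
    apply/funext => x; rewrite /Jminus /Jplus scaler_nat mulr2n scaleN1r opprD addrA.
    by rewrite addrK.
  exact: closed2_linear sK (smooth_Jplus sK) cK cp.
have cJm : closed2 mfd (fun x => J x *m Jminus K x).
  apply: (anti_invariant_closed2 hM hK (smooth_Jminus sK)) => // x.
    exact: Jminus_anti.
  exact: Jminus_J.
(* [W] is [K'] minus half of [Jminus K'], and [Jminus_K'] turns the latter into the rotation by J of
   the closed anti-invariant form [Jminus K]. *)
have cW : closed2 mfd W.
  have -> : W = fun x => 1 *: K' x + 2^-1 *: (J x *m Jminus K x).
    apply/funext => x; rewrite /W -[J x *m _]opprK -Jminus_K' scalerN scale1r.
    rewrite /Jplus /Jminus; apply/matrixP => j k.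
    by move: (J x *m K' x *m _) => P; rewrite !mxE; field.
  exact: (closed2_linear 1 2^-1 sK' (smooth_bilM sJ (smooth_Jminus sK)) cK' cJm).
have cl : ext_d mfd (cform2 U W) = zero_form by exact: ext_d_cform2_closed.
have ex : del_exact mfd J 1 1 (cform2 U W) \/ delbar_exact mfd J 1 1 (cform2 U W).
  by right; exists (eta X); [exact: pq_eta | rewrite omegaE].
have [lam lampq E] := ddbar pq cl ex.
by exists lam; split => //; exists W.
Qed.

End OneForm.

End Lemmas.

(** * Second derivatives at extrema *)

Section SecondOrder.
Context {R : realType} {n : nat}.
Local Notation e := (@basis_vec R n).
Implicit Types (f : 'rV[R]_n -> R) (U : set 'rV[R]_n) (y u : 'rV[R]_n).

Definition hessian f y : 'M[R]_n := \matrix_(j, k) 'D_(e j) ('D_(e k) f) y.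

Lemma derive_smooth_sum U f y u : open U -> smooth_on U f -> U y ->
  'D_u f y = \sum_j u 0 j * 'D_(e j) f y.
Proof. by move=> oU sf Uy; rewrite derive_sum_partials //; exact: smooth_on_differentiable oU sf Uy. Qed.

Lemma smooth_on_derive U f u : open U -> smooth_on U f -> smooth_on U ('D_u f).
Proof.
move=> oU sf; apply: (@smooth_on_eq _ _ _ _ (fun y => \sum_j u 0 j * 'D_(e j) f y)) => //.
  by move=> y Uy; exact: esym (derive_smooth_sum u oU sf Uy).
apply: smooth_on_sum; first exact: oU.
move=> j; apply: (smooth_onM oU); first exact: smooth_on_cst.
exact: smooth_on_partial.
Qed.

Lemma derive_derive_hessian U f y u : open U -> smooth_on U f -> U y ->
  'D_u ('D_u f) y = (u *m hessian f y *m u^T) 0 0.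
Proof.
move=> oU sf Uy; rewrite (derive_smooth_sum _ oU (smooth_on_derive u oU sf) Uy).
rewrite -mulmxA mxE; apply: eq_bigr => j _; congr (_ * _).
have d k : derivable ('D_(e k) f) y (e j).
  exact: smooth_on_derivable (smooth_on_partial k sf) Uy.
rewrite mxE (derive_open_eq (e j) oU Uy (g := \sum_k (u 0 k *: 'D_(e k) f))); last first.
  by move=> z Uz; rewrite (derive_smooth_sum _ oU sf Uz) fct_sumE.
rewrite derive_sum; last by move=> k; exact: derivableZ (d k).
apply: eq_bigr => k _; rewrite (deriveZ (u 0 k) (d k)).
by rewrite (mxE _ _ j k) (mxE _ _ k 0) mulrC.
Qed.

Lemma line_in_open U y u : open U -> U y ->
  exists2 r : R, 0 < r & forall t, `|t| < r -> U (y + t *: u).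
Proof.
move=> oU Uy.
have c : {for (0 : R), continuous (fun t : R => y + t *: u)}.
  apply: continuousD; first exact: cst_continuous.
  exact: scalel_continuous.
have n0 : nbhs (y + (0 : R) *: u) U by rewrite scale0r addr0; exact: open_nbhs_nbhs.
have /nbhs_ballP[r /= r0 rU] := c _ n0.
by exists r => // t tr; apply: rU; rewrite -ball_normE /= sub0r normrN.
Qed.

Lemma is_derive_smooth_line U f y u (t : R) : open U -> smooth_on U f ->
  U (y + t *: u) ->
  is_derive (t : R^o) 1 (fun r => f (y + r *: u)) ('D_u f (y + t *: u)).
Proof.
move=> oU sf Ut; apply: is_derive_line; apply: DeriveDef (erefl _).
exact/diff_derivable/(smooth_on_differentiable oU sf Ut).
Qed.

(** A positive slope of the derivative [k] at a zero makes [k] positive just to the right, so [h]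
    increases there; at a maximum this is a contradiction. *)
Lemma second_derivative_gt0 (h k : R -> R) (r b : R) : 0 < r ->
  (forall t, `|t| < r -> is_derive (t : R^o) 1 h (k t)) ->
  is_derive (0 : R^o) 1 k b -> k 0 = 0 -> 0 < b ->
  exists2 t, `|t| < r & h 0 < h t.
Proof.
move=> r0 dh dk k0 b0.
have [dk1 dk2] := dk.
have kc : (fun t => t^-1 *: ((k \o shift (0 : R^o)) (t *: 1) - k 0)) @ (0 : R)^' --> b.
  by rewrite -dk2; exact: dk1.
have : \forall t \near (0 : R)^', 0 < t^-1 *: ((k \o shift (0 : R^o)) (t *: 1) - k 0).
  exact: (kc _ (lt_nbhsr b0)).
rewrite near_withinE => /nbhs_ballP[s /= s0 sk].
have kpos t : 0 < t -> t < s -> 0 < k t.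
  move=> t0 ts; have := sk t; rewrite -ball_normE /= sub0r normrN gtr0_norm // => /(_ ts).
  rewrite gt_eqF // k0 subr0 /shift /= addr0 [t *: 1]mulr1 => /(_ isT).
  by rewrite [_ *: _]mulrC pmulr_lgt0 // invr_gt0.
pose t := Num.min r s / 2.
have m0 : 0 < Num.min r s by rewrite lt_min r0 s0.
have t0 : 0 < t by rewrite divr_gt0.
have tm : t < Num.min r s by rewrite ltr_pdivrMr // ltr_pMr // ltr1n.
have [tr ts] : t < r /\ t < s by move: tm; rewrite lt_min => /andP[].
have [||z] := @MVT R h k 0 t t0.
- move=> w; rewrite in_itv /= => /andP[w0 wt]; apply: dh.
  by rewrite gtr0_norm // (lt_trans wt).
- apply: derivable_within_continuous => w; rewrite in_itv /= => /andP[w0 wt].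
  by have [] := dh w; rewrite ?ger0_norm // (le_lt_trans wt).
rewrite in_itv /= subr0 => /andP[z0 zt] E.
exists t; first by rewrite gtr0_norm.
by rewrite -subr_gt0 E mulr_gt0 // kpos // (lt_trans zt).
Qed.

Lemma local_max_derivatives U f y u : open U -> smooth_on U f -> U y ->
  (forall z, U z -> f z <= f y) ->
  'D_u f y = 0 /\ (u *m hessian f y *m u^T) 0 0 <= 0.
Proof.
move=> oU sf Uy fmax; have [r r0 rU] := line_in_open u oU Uy.
pose h (t : R) := f (y + t *: u).
have dh t : `|t| < r -> is_derive (t : R^o) 1 h ('D_u f (y + t *: u)).
  by move=> /rU Ut; exact: is_derive_smooth_line oU sf Ut.
have h0 : h 0 = f y by rewrite /h scale0r addr0.
have D0 : 'D_u f y = 0.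
  have [||||_ hd] := @derive1_at_max R h (- r) r 0.
  - by rewrite ge0_cp // ltW.
  - by move=> t; rewrite in_itv /= => tr; have [] := dh t; rewrite // ltr_norml.
  - by rewrite in_itv /= oppr_lt0 r0.
  - move=> t; rewrite in_itv /= => tr; rewrite h0; apply: fmax; apply: rU.
    by rewrite ltr_norml.
  have [|_] := dh 0; first by rewrite normr0.
  by rewrite hd scale0r addr0 => <-.
split => //; rewrite leNgt; apply/negP.
rewrite -(derive_derive_hessian u oU sf Uy) => q0.
pose k (t : R) := 'D_u f (y + t *: u).
have k0 : k 0 = 0 by rewrite /k scale0r addr0.
have dk : is_derive (0 : R^o) 1 k ('D_u ('D_u f) (y + (0 : R) *: u)).
  apply: is_derive_smooth_line oU (smooth_on_derive u oU sf) _.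
  by rewrite scale0r addr0.
have dk0 : 0 < 'D_u ('D_u f) (y + (0 : R) *: u) by rewrite scale0r addr0.
have [t tr] := second_derivative_gt0 r0 dh dk k0 dk0.
by rewrite h0 ltNge fmax //; exact: rU.
Qed.

Lemma local_min_derivatives U f y u : open U -> smooth_on U f -> U y ->
  (forall z, U z -> f y <= f z) ->
  'D_u f y = 0 /\ 0 <= (u *m hessian f y *m u^T) 0 0.
Proof.
move=> oU sf Uy fmin; have sN := smooth_onN oU sf.
have DN w (h : 'rV[R]_n -> R) z : smooth_on U h -> U z -> 'D_w (- h) z = - 'D_w h z.
  move=> sh Uz; apply: deriveN.
  exact/diff_derivable/(smooth_on_differentiable oU sh Uz).
have HN : hessian (fun z => - f z) y = - hessian f y.
  apply/matrixP => j k; rewrite [LHS]mxE [RHS]mxE [X in _ = - X]mxE.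
  rewrite (derive_open_eq (e j) oU Uy (g := - 'D_(e k) f)).
    exact: DN (smooth_on_partial k sf) Uy.
  by move=> z Uz; rewrite (DN _ _ _ sf Uz).
have [|D0 H0] := local_max_derivatives u oU sN Uy; first by move=> z /fmin; rewrite lerN2.
have D1 := DN u f y sf Uy; rewrite [LHS]D0 in D1.
split; first by apply: oppr_inj; rewrite -D1 oppr0.
have E : u *m - hessian f y *m u^T = - (u *m hessian f y *m u^T).
  by rewrite mulmxN mulNmx.
move: H0; rewrite HN E; move: (u *m hessian f y *m u^T) => P.
by rewrite mxE oppr_le0.
Qed.

End SecondOrder.

(** * Potentials of exact forms of type (1,1) *)

Section Potentials.
Context {R : realType} {n : nat} {M : topologicalType}.
Variable mfd : smooth_structure R n M.
Implicit Types (c : chart R n M) (x : M) (f : M -> R) (y u : 'rV[R]_n).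
Local Notation e := (@basis_vec R n).
Local Notation atlas := (atlas mfd).
Local Notation chart_at := (chart_at mfd).

Lemma cform2_entry (K L : M -> 'M[R]_n) x j k :
  cform2 K L x [:: complexify (e j); complexify (e k)] = K x j k +i* L x j k.
Proof.
rewrite /= !complexifyE cmxT trmx0 !cmxM !mul0mx !mulmx0 !subr0 !addr0 !add0r.
by rewrite mxE !basis_bilinear.
Qed.

Lemma cform2_inj (K L K' L' : M -> 'M[R]_n) : cform2 K L = cform2 K' L' -> K = K'.
Proof.
move=> E; apply/funext => x; apply/matrixP => j k.
have := congr1 (fun om => om x [:: complexify (e j); complexify (e k)]) E.
by rewrite !cform2_entry => -[].
Qed.

(** This is the differential of [f] as a covector; no metric enters. *)
Definition grad f x : 'cV[R]_n := \col_j dir_derive mfd x (e j) f.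

Lemma dir_derive_grad f x u : smooth_function mfd f ->
  dir_derive mfd x u f = (u *m grad f x) 0 0.
Proof.
move=> sf; rewrite /dir_derive derive_sum_partials; last first.
  apply: (smooth_function_differentiable sf (chart_at_atlas mfd x)).
  exact: image_chart_map (chart_at_dom mfd x).
by rewrite [RHS]mxE; apply: eq_bigr => j _; rewrite [grad f x j 0]mxE.
Qed.

Lemma grad_in_chart c f y j : smooth_function mfd f -> atlas c -> chart_image c y ->
  cov_in_chart mfd c (grad f) y j 0 = 'D_(e j) (f \o chart_inv c) y.
Proof.
move=> sf ac cy; set x := chart_inv c y.
have dx : dom c x := chart_inv_dom ac cy.
have cx : chart_map c x = y := chart_invK ac cy.
have -> : cov_in_chart mfd c (grad f) y j 0 = (row j (frame mfd c x) *m grad f x) 0 0.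
  by rewrite /cov_in_chart -/x -row_mul [RHS]mxE.
rewrite -dir_derive_grad // (dir_derive_chart _ ac dx); last first.
  by rewrite cx; exact: smooth_function_differentiable sf ac cy.
by rewrite cx -row_mul mulmxV ?row1 //; exact: frame_unit ac dx.
Qed.

Lemma smooth_grad f : smooth_function mfd f -> smooth_cov1 mfd (grad f).
Proof.
move=> sf c ac j k; rewrite [k]ord1; apply: (smooth_on_eq (image_open ac)); last first.
  exact: smooth_on_partial j (sf c ac).
by move=> y cy; rewrite grad_in_chart.
Qed.

Lemma smooth_function_continuous f : smooth_function mfd f -> continuous f.
Proof.
move=> sf x; set c := chart_at x.
have ac : atlas c := chart_at_atlas mfd x; have dx : dom c x := chart_at_dom mfd x.
have cc := atlas_chart ac.
have cf : {for x, continuous ((f \o chart_inv c) \o chart_map c)}.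
  apply: continuous_comp; first by apply: (chart_map_continuous cc); rewrite inE.
  exact: smooth_on_continuous (sf c ac) (image_chart_map dx).
have fE p : dom c p -> ((f \o chart_inv c) \o chart_map c) p = f p.
  by move=> dp /=; rewrite (chart_mapK' ac dp).
have nd : nbhs x (dom c) by apply: open_nbhs_nbhs; split => //; exact: dom_open cc.
have h : (f \o chart_inv c \o chart_map c) p @[p --> x] --> f x by rewrite -(fE x dx); exact: cf.
apply: cvg_trans h; apply: near_eq_cvg.
by apply: filterS nd => p dp; rewrite fE.
Qed.

Section JCombination.
Variable J : M -> 'M[R]_n.
Hypothesis sJ : smooth_endo mfd J.
Variables (p q : M -> 'cV[R]_n) (a b : R).
Hypotheses (sp : smooth_cov1 mfd p) (sq : smooth_cov1 mfd q).

Lemma J_combination_in_chart c y : atlas c -> chart_image c y ->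
  cov_in_chart mfd c (fun x => a *: p x + b *: (J x *m q x)) y
  = a%:M *m cov_in_chart mfd c p y
    + b%:M *m (endo_in_chart mfd c J y *m cov_in_chart mfd c q y).
Proof.
move=> ac cy; rewrite !mul_scalar_mx /cov_in_chart /endo_in_chart mulmxDr -!scalemxAr.
by rewrite !mulmxA mulmxKV //; exact: frame_inv_unit.
Qed.

Lemma smooth_J_combination : smooth_cov1 mfd (fun x => a *: p x + b *: (J x *m q x)).
Proof.
move=> c ac; have oc := image_open ac.
have sJc : smooth_mx (chart_image c) (endo_in_chart mfd c J) := sJ ac.
have sJq := smooth_mxM oc (smooth_mx_cst b%:M oc) (smooth_mxM oc sJc (sq ac)).
have h := smooth_mxD oc (smooth_mxM oc (smooth_mx_cst a%:M oc) (sp ac)) sJq.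
by apply: smooth_mx_eq oc _ h => y cy; rewrite J_combination_in_chart.
Qed.

(** Where [q] vanishes, the derivative of [J] is multiplied by 0, so only first derivatives of [q]
    are left. This is why potentials are examined at critical points. *)
Lemma curl_J_combination x : q x = 0 ->
  let D := \matrix_(j, k) mx_partial j (cov_in_chart mfd (chart_at x) q) (chart_map (chart_at x) x) k 0 in
  curl mfd (fun x => a *: p x + b *: (J x *m q x)) x
  = a *: curl mfd p x + b *: (D *m (J x)^T - J x *m D^T).
Proof.
move=> q0 D; set c := chart_at x; set y := chart_map c x.
have ac : atlas c := chart_at_atlas mfd x; have oc := image_open ac.
have cy : chart_image c y := image_chart_map (chart_at_dom mfd x).
have iy : chart_inv c y = x by exact: chart_mapK' ac (chart_at_dom mfd x).
have sJc : smooth_mx (chart_image c) (endo_in_chart mfd c J) := sJ ac.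
have Jy : endo_in_chart mfd c J y = J x.
  by rewrite /endo_in_chart iy frame_chart_at mul1mx invmx1 mulmx1.
have qy : cov_in_chart mfd c q y = 0 by rewrite /cov_in_chart iy q0 mulmx0.
have E j : mx_partial j (cov_in_chart mfd c (fun x => a *: p x + b *: (J x *m q x))) y
    = a *: mx_partial j (cov_in_chart mfd c p) y
      + b *: (J x *m mx_partial j (cov_in_chart mfd c q) y).
  rewrite (mx_partial_near j oc cy (fun z cz => J_combination_in_chart ac cz)).
  have sJq := smooth_mxM oc sJc (sq ac).
  rewrite (mx_partialD j cy (smooth_mxM oc (smooth_mx_cst a%:M oc) (sp ac))
    (smooth_mxM oc (smooth_mx_cst b%:M oc) sJq)).
  rewrite (mx_partialMl j a%:M oc cy (sp ac)) (mx_partialMl j b%:M oc cy sJq).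
  by rewrite (mx_partialM j oc cy sJc (sq ac)) qy Jy mulmx0 add0r !mul_scalar_mx.
have DJ j k : (D *m (J x)^T) j k = (J x *m mx_partial j (cov_in_chart mfd c q) y) k 0.
  rewrite [LHS]mxE [RHS]mxE; apply: eq_bigr => l _.
  by rewrite [D j l]mxE [_^T l k]mxE mulrC.
have JD j k : (J x *m D^T) j k = (D *m (J x)^T) k j.
  by rewrite -[J x in LHS]trmxK -trmx_mul [LHS]mxE.
have eD m l (P Q : 'M[R]_(m, l)) j k : (a *: P + b *: Q) j k = a * P j k + b * Q j k.
  by rewrite !mxE.
have eDB (P Q P' Q' : 'cV[R]_n) j k : (a *: P + b *: Q) k 0 - (a *: P' + b *: Q') j 0
    = a * (P k 0 - P' j 0) + b * (Q k 0 - Q' j 0).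
  by rewrite !eD; ring.
have eB (P Q : 'M[R]_n) j k : (P - Q) j k = P j k - Q j k by rewrite !mxE.
apply/matrixP => j k; rewrite [RHS]eD [(D *m _ - _) j k]eB (JD j k) (DJ j k) (DJ k j).
have -> : curl mfd p x j k
  = mx_partial j (cov_in_chart mfd c p) y k 0 - mx_partial k (cov_in_chart mfd c p) y j 0.
  exact: mxE.
rewrite [LHS]mxE -/c -/y (E j) (E k).
exact: eDB.
Qed.

End JCombination.

Lemma hessian_grad f x : smooth_function mfd f ->
  let c := chart_at x in
  \matrix_(j, k) mx_partial j (cov_in_chart mfd c (grad f)) (chart_map c x) k 0
  = hessian (f \o chart_inv c) (chart_map c x).
Proof.
move=> sf; set c := chart_at x => /=.
have ac : atlas c := chart_at_atlas mfd x.
apply/matrixP => j k; rewrite [LHS]mxE [LHS]mxE [RHS]mxE.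
apply: (derive_open_eq _ (image_open ac) (image_chart_map (chart_at_dom mfd x))) => z cz.
by rewrite grad_in_chart.
Qed.

Lemma hessian_sym f x : smooth_function mfd f -> let c := chart_at x in
  (hessian (f \o chart_inv c) (chart_map c x))^T = hessian (f \o chart_inv c) (chart_map c x).
Proof.
move=> sf; set c := chart_at x => /=; have ac : atlas c := chart_at_atlas mfd x.
apply/matrixP => j k; rewrite [LHS]mxE [LHS]mxE [RHS]mxE.
exact: clairaut (image_open ac) (sf c ac) (image_chart_map (chart_at_dom mfd x)).
Qed.

Lemma curl_grad f x : smooth_function mfd f -> curl mfd (grad f) x = 0.
Proof.
move=> sf; have /= H := hessian_grad x sf; have /= := hessian_sym x sf; rewrite -H => S.
apply/matrixP => j k; rewrite [LHS]mxE [RHS]mxE; apply/eqP; rewrite subr_eq0; apply/eqP.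
have := congr1 (fun P : 'M[R]_n => P k j) S.
by rewrite /= [X in X = _]mxE [X in X = _]mxE [X in _ = X]mxE.
Qed.

Section Lambda.
Variable J : M -> 'M[R]_n.
Hypothesis sJ : smooth_endo mfd J.
Hypothesis JJ : forall x, J x *m J x = - 1%:M.
Variable lam : M -> seq 'rV[R[i]]_n -> R[i].
Hypothesis lam00 : is_pq_form mfd J 0 0 lam.
Let l1 x : R := complex.Re (lam x [::]).
Let l2 x : R := complex.Im (lam x [::]).

Lemma smooth_Re_form0 : smooth_function mfd l1.
Proof. by move=> c ac; have [] := form_smooth (pq_form lam00) ac [::]. Qed.

Lemma smooth_Im_form0 : smooth_function mfd l2.
Proof. by move=> c ac; have [] := form_smooth (pq_form lam00) ac [::]. Qed.

Lemma ext_d_form0 : ext_d mfd lam = cform1 (grad l1) (grad l2).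
Proof.
apply/funext => x; apply/funext => s.
have [s1|s1] := eqVneq (size s) 1%N; last first.
  by rewrite (ext_d_degree mfd x (form_degree (pq_form lam00)) s1) cform1_degree.
case: s s1 => [|z []] //= _.
rewrite /ext_d /= big_ord1 /= expr0 mul1r [RHS]mxE; apply: eq_bigr => j _.
by congr (_ * _); rewrite [RHS]mxE [grad l1 x j 0]mxE [grad l2 x j 0]mxE.
Qed.

Let al x : 'cV[R]_n := 2^-1 *: grad l1 x + - 2^-1 *: (J x *m grad l2 x).
Let be x : 'cV[R]_n := 2^-1 *: grad l2 x + 2^-1 *: (J x *m grad l1 x).

Lemma delbar_form0 : delbar mfd J 0 lam = cform1 al be.
Proof.
rewrite /delbar ext_d_form0; apply: bidegree_part_cform1 => x.
rewrite big_mkcond big_bool /= add0r /projmx cmxM /al /be -!scalemxAl !mul1mx.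
by rewrite scaleNr.
Qed.

Lemma del_delbar_form0 : del mfd J 0 (delbar mfd J 0 lam)
  = cform2 (fun x => 2^-1 *: Jplus J (curl mfd al) x) (fun x => 2^-1 *: Jplus J (curl mfd be) x).
Proof.
have s1 := smooth_grad smooth_Re_form0; have s2 := smooth_grad smooth_Im_form0.
rewrite delbar_form0 /del ext_d_cform1; [|exact: smooth_J_combination|exact: smooth_J_combination].
apply: bidegree_part_cform2 => x.
rewrite (sum_bool_pair _ (fun b b' => projmx J b x *m _ *m (projmx J b' x)^T)) /= add0r addr0.
by rewrite projmx_conj_mixed.
Qed.

(** The real part of lambda enters the real part of del delbar lambda only through d d = 0, so the
    imaginary part alone contributes. Its contribution H J^T - J H is already J-invariant, and
    [Jplus] doubles it. *)
Lemma form_critical_point (F W : M -> 'M[R]_n) x :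
  cform2 (fun x => 2^-1 *: Jplus J F x) W = del mfd J 0 (delbar mfd J 0 lam) ->
  grad l2 x = 0 ->
  let H := hessian (l2 \o chart_inv (chart_at x)) (chart_map (chart_at x) x) in
  Jplus J F x *m (J x)^T = H + J x *m H *m (J x)^T.
Proof.
rewrite del_delbar_form0 => E g0 H.
have -> : Jplus J F x = Jplus J (curl mfd al) x.
  apply: (scalerI (a := 2^-1 : R)); first by rewrite invr_eq0 pnatr_eq0.
  exact: (congr1 (fun G => G x) (cform2_inj E)).
have C : curl mfd al x = - 2^-1 *: (H *m (J x)^T - J x *m H).
  rewrite /al (curl_J_combination sJ _ _ (smooth_grad smooth_Re_form0) (smooth_grad smooth_Im_form0) g0).
  by rewrite (curl_grad x smooth_Re_form0) scaler0 add0r (hessian_grad x smooth_Im_form0) hessian_sym //;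
    exact: smooth_Im_form0.
have JTT : (J x)^T *m (J x)^T = - 1%:M by rewrite -trmx_mul JJ linearN /= trmx1.
rewrite /Jplus C; move: (J x) (JJ x) JTT => j JJx JTT.
have -> : j *m (- 2^-1 *: (H *m j^T - j *m H)) *m j^T = - 2^-1 *: (H *m j^T - j *m H).
  rewrite -scalemxAr -scalemxAl mulmxBr mulmxBl -!mulmxA JTT !mulmxA JJx mulNmx mul1mx mulmxN mulmx1.
  by rewrite mulNmx opprK addrC.
rewrite -scalerDl -opprD -[2^-1 + 2^-1]mulr2n -[_ *+ 2]mulr_natl mulfV ?pnatr_eq0 //.
by rewrite scaleN1r opprB mulmxBl -[H *m _ *m _]mulmxA JTT mulmxN mulmx1 opprK addrC.
Qed.

Lemma semidefinite_points (F W : M -> 'M[R]_n) (x0 : M) : compact [set: M] ->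
  cform2 (fun x => 2^-1 *: Jplus J F x) W = del mfd J 0 (delbar mfd J 0 lam) ->
  (exists x, forall u, (u *m (Jplus J F x *m (J x)^T) *m u^T) 0 0 <= 0) /\
  (exists x, forall u, 0 <= (u *m (Jplus J F x *m (J x)^T) *m u^T) 0 0).
Proof.
move=> cM E; have s2 := smooth_Im_form0.
have ne : [set: M] !=set0 by exists x0.
have ct : {within [set: M], continuous l2}.
  exact/continuous_subspaceT/smooth_function_continuous.
have quad x u : grad l2 x = 0 ->
    let H := hessian (l2 \o chart_inv (chart_at x)) (chart_map (chart_at x) x) in
    (u *m (Jplus J F x *m (J x)^T) *m u^T) 0 0
    = (u *m H *m u^T) 0 0 + ((u *m J x) *m H *m (u *m J x)^T) 0 0.
  move=> gx H; have := form_critical_point E gx; rewrite /= -/H => ->.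
  by rewrite mulmxDr mulmxDl trmx_mul !mulmxA [LHS]mxE.
have sc x := s2 (chart_at x) (chart_at_atlas mfd x).
have oc x := image_open (chart_at_atlas mfd x).
have cx x := image_chart_map (chart_at_dom mfd x).
have ix x : l2 (chart_inv (chart_at x) (chart_map (chart_at x) x)) = l2 x.
  by rewrite (chart_mapK' (chart_at_atlas mfd x) (chart_at_dom mfd x)).
split.
  have [x _ xm] := compact_EVT_max ne cM ct.
  have K u := local_max_derivatives u (oc x) (sc x) (cx x).
  have {}K u := K u (fun z _ => eq_rect_r (fun b => _ <= b) (xm (chart_inv _ z) (mem_set I)) (ix x)).
  exists x => u; rewrite quad; first by rewrite -[leRHS]addr0 lerD //; exact: (K _).2.
  by apply/colP => j; rewrite [LHS]mxE [RHS]mxE; exact: (K _).1.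
have [x _ xm] := compact_EVT_min ne cM ct.
have K u := local_min_derivatives u (oc x) (sc x) (cx x).
have {}K u := K u (fun z _ => eq_rect_r (fun b => b <= _) (xm (chart_inv _ z) (mem_set I)) (ix x)).
exists x => u; rewrite quad; first by rewrite addr_ge0 //; exact: (K _).2.
by apply/colP => j; rewrite [LHS]mxE [RHS]mxE; exact: (K _).1.
Qed.

End Lambda.
End Potentials.

(** * Propagation of semidefiniteness *)

Section Propagation.
Context {R : realType} {n : nat}.
Implicit Types (P Q : 'M[R]_n) (u : 'rV[R]_n).

(** At the infimum of the failures in [0, 1], [P] holds by the limit clause; the step clause then
    pushes the failures further right, against the choice of the infimum. *)
Lemma real_induction (P : R -> Prop) : P 0 ->
  (forall t, 0 <= t <= 1 -> P t -> exists2 h, 0 < h & forall s, 0 < s < h -> P (t + s)) ->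
  (forall t, 0 < t <= 1 -> (forall s, 0 <= s < t -> P s) -> P t) ->
  P 1.
Proof.
move=> P0 step lim; apply: contrapT => nP1.
pose S := [set t | 0 <= t <= 1 /\ ~ P t].
have S1 : S 1 by split => //; rewrite ler01 lexx.
have hS : has_inf S by split; [exists 1|exists 0 => t [/andP[]]].
have m0 : 0 <= inf S by apply: lb_le_inf; [exists 1|move=> t [/andP[]]].
have m1 : inf S <= 1 by apply: ge_inf => //; exact: hS.2.
have Pm s : 0 <= s < inf S -> P s.
  move=> /andP[s0 sm]; apply: contrapT => nPs.
  have : inf S <= s.
    by apply: ge_inf; [exact: hS.2|split => //; rewrite s0 (ltW (lt_le_trans sm m1))].
  by rewrite leNgt sm.
have Pi : P (inf S).
  have [m00|m00] := eqVneq (inf S) 0; first by rewrite m00.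
  by apply: lim => //; rewrite lt_neqAle eq_sym m00 m0.
have [|h h0 Ph] := step (inf S) _ Pi; first by rewrite m0 m1.
have [s Ss sm] := inf_adherent h0 hS.
have [_ nPs] := Ss; apply: nPs.
have ms : inf S <= s by apply: ge_inf => //; exact: hS.2.
have [<-//|sne] := eqVneq (inf S) s.
rewrite -(subrK (inf S) s) addrC; apply: Ph.
by rewrite subr_gt0 lt_neqAle sne ms ltrBlDl.
Qed.

Definition quad P u : R := (u *m P *m u^T) 0 0.
Definition psd P := forall u, 0 <= quad P u.

Lemma quadE P u : quad P u = \sum_j \sum_k u 0 j * u 0 k * P j k.
Proof.
rewrite /quad -mulmxA mxE; apply: eq_bigr => j _.
rewrite mxE mulr_sumr; apply: eq_bigr => k _.
by rewrite [u^T k 0]mxE mulrA mulrAC.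
Qed.

Lemma quadD P Q u : quad (P + Q) u = quad P u + quad Q u.
Proof. by rewrite /quad mulmxDr mulmxDl mxE. Qed.

Lemma quadN P u : quad (- P) u = - quad P u.
Proof. by rewrite /quad mulmxN mulNmx mxE. Qed.

Lemma quadZ a P u : quad (a *: P) u = a * quad P u.
Proof. by rewrite /quad -scalemxAr -scalemxAl mxE. Qed.

Lemma quad_conj P Q u : quad (Q *m P *m Q^T) u = quad P (u *m Q).
Proof. by rewrite /quad trmx_mul !mulmxA. Qed.

Lemma quad_tr P u : quad P^T u = quad P u.
Proof.
have tr11 (Q : 'M[R]_1) : Q^T 0 0 = Q 0 0 by rewrite mxE.
by rewrite /quad -[LHS]tr11 !trmx_mul !trmxK mulmxA.
Qed.

Lemma quad1 u : quad 1%:M u = \sum_j u 0 j ^+ 2.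
Proof.
rewrite /quad mulmx1 mxE; apply: eq_bigr => j _.
by rewrite [u^T j 0]mxE expr2.
Qed.

(** Each product of coordinates is at most half the sum of their squares. *)
Lemma quad_bound P u (C : R) : (forall j k, `|P j k| <= C) ->
  `|quad P u| <= C * n%:R * quad 1%:M u.
Proof.
move=> PC; rewrite quadE quad1.
apply: (@le_trans _ _ (\sum_(j < n) \sum_(k < n) C * ((u 0 j ^+ 2 + u 0 k ^+ 2) / 2))).
  apply: (le_trans (ler_norm_sum _ _ _)); apply: ler_sum => j _.
  apply: (le_trans (ler_norm_sum _ _ _)); apply: ler_sum => k _.
  rewrite normrM mulrC; apply: ler_pM => //.
  rewrite normrM; rewrite -[u 0 j ^+ 2]real_normK ?num_real // -[u 0 k ^+ 2]real_normK ?num_real //.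
  move: `|u 0 j| `|u 0 k| => a b.
  have := sqr_ge0 (a - b); rewrite ler_pdivlMr //; nra.
have -> : \sum_(j < n) \sum_(k < n) C * ((u 0 j ^+ 2 + u 0 k ^+ 2) / 2)
   = C / 2 * (\sum_(j < n) \sum_(k < n) u 0 j ^+ 2 + \sum_(j < n) \sum_(k < n) u 0 k ^+ 2).
  rewrite -big_split /= mulr_sumr; apply: eq_bigr => j _.
  rewrite -big_split /= mulr_sumr; apply: eq_bigr => k _.
  by rewrite mulrA mulrAC.
have -> : \sum_(j < n) \sum_(k < n) u 0 j ^+ 2 = n%:R * \sum_j u 0 j ^+ 2.
  by rewrite mulr_sumr; apply: eq_bigr => j _; rewrite sumr_const card_ord mulr_natl.
rewrite sumr_const card_ord -[_ *+ n]mulr_natl.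
by rewrite le_eqVlt; apply/orP; left; apply/eqP; field.
Qed.

(* f (t + s) = (1 + s G) f(t) (1 + s G)^T + s H + o(s), uniformly on unit vectors *)
Lemma psd_step (G H : 'M[R]_n) (f : R -> 'M[R]_n) (eta t : R) : 0 < eta ->
  (forall j k, is_derive (t : R^o) 1 (fun s => f s j k) ((G *m f t + f t *m G^T + H) j k)) ->
  (forall u, eta * quad 1%:M u <= quad H u) -> psd (f t) ->
  exists2 h, 0 < h & forall s, 0 < s < h -> psd (f (t + s)).
Proof.
move=> e0 df Heta ft.
pose F s : 'M[R]_n := f (t + s) - (1%:M + s *: G) *m f t *m (1%:M + s *: G)^T.
have FE s : F s = f (t + s) - (f t + s *: (G *m f t + f t *m G^T) + (s * s) *: (G *m f t *m G^T)).
  rewrite /F; congr (_ - _).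
  move: (f t) => P.
  rewrite [(1%:M + _)^T]linearD /= trmx1 [(s *: G)^T]linearZ /= mulmxDl mul1mx -scalemxAl.
  rewrite mulmxDr mulmx1 -scalemxAr mulmxDl -scalemxAl [s *: (_ + s *: _)]scalerDr scalerA.
  by rewrite scalerDr !addrA.
have F0 : F 0 = 0 by rewrite FE addr0 scale0r mul0r scale0r !addr0 subrr.
(* [quad_bound] costs a factor [n], and [d * n <= eta]: entries within [d] of those of [H] still
   give a nonnegative form. *)
pose d : R := eta / n.+1%:R.
have d0 : 0 < d by rewrite divr_gt0 // ltr0n.
have near jk : \forall s \near (0 : R)^', `|H jk.1 jk.2 - s^-1 * F s jk.1 jk.2| < d.
  case: jk => j k /=.
  have [dF1 dF2] := df j k.
  have cF : s^-1 *: ((fun r => f r j k) (s *: 1 + t) - f t j k) @[s --> (0 : R)^']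
      --> (G *m f t + f t *m G^T + H) j k.
    by rewrite -dF2; exact: dF1.
  have d2 : 0 < d / 2 by rewrite divr_gt0.
  have b0 : 0 < d / 2 / (`|(G *m f t *m G^T) j k| + 1) by rewrite divr_gt0 // ltr_wpDl.
  have n1 := @dnbhs0_lt _ R _ b0.
  have /cvgrPdist_lt/(_ _ d2) n2 := cF.
  have n3 : \forall s \near (0 : R)^', s != 0 by exact: nbhs_dnbhs_neq.
  near=> s.
  have s0 : s != 0 by near: s.
  have -> : F s j k = f (t + s) j k - (f t j k + s * (G *m f t + f t *m G^T) j k
      + (s * s) * (G *m f t *m G^T) j k).
    rewrite FE; move: (f (t + s)) (f t) (G *m f t + _) (G *m f t *m _) => a b a' b'.
    by rewrite !mxE.
  have h1 : `|s| < d / 2 / (`|(G *m f t *m G^T) j k| + 1) by near: s.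
  have h2 : `|(G *m f t + f t *m G^T + H) j k - s^-1 *: (f (s *: 1 + t) j k - f t j k)| < d / 2.
    by near: s.
  move: h2; rewrite [s *: 1]mulr1 [s + t]addrC [(_ + H) j k]mxE [_ *: _]/(_ * _).
  move: (f (t + s) j k) (f t j k) ((G *m f t + _) j k) (H j k) ((G *m f t *m _) j k) h1
    => a b p q r h1 h2.
  have -> : q - s^-1 * (a - (b + s * p + s * s * r)) = (p + q - s^-1 * (a - b)) + s * r.
    by field.
  apply: (le_lt_trans (ler_normD _ _)); rewrite [ltRHS](splitr d); apply: ltr_leD => //.
  rewrite normrM; move: h1; rewrite ltr_pdivlMr ?ltr_wpDl // => h1.
  by apply: le_trans (ltW h1); rewrite ler_wpM2l // lerDl.
have nearA : nbhs (0 : R) [set s | s != 0 ->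
    forall jk : 'I_n * 'I_n, `|H jk.1 jk.2 - s^-1 * F s jk.1 jk.2| < d].
  exact: (@filter_forall _ _ _ (0 : R)^' _ near).
have /nbhs_ballP[h /= h0 hP] := nearA.
exists h => // s /andP[s0 sh] u.
have bnd j k : `|(H - s^-1 *: F s) j k| <= d.
  have := hP s; rewrite -ball_normE /= sub0r normrN gtr0_norm // => /(_ sh (lt0r_neq0 s0) (j, k)) /=.
  by move=> /ltW; rewrite !mxE.
have := quad_bound u bnd; rewrite quadD quadN quadZ ler_norml => /andP[_ Q].
have := Heta u => Hu; have q0 : 0 <= quad 1%:M u by rewrite quad1 sumr_ge0 // => j _; exact: sqr_ge0.
have dn : d * n%:R <= eta.
  by rewrite /d mulrAC ler_pdivrMr ?ltr0n // ler_pM2l // ler_nat.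
have Fs : 0 <= quad (F s) u.
  have : 0 <= s^-1 * quad (F s) u.
    by have := ler_wpM2r q0 dn; move: (d * n%:R * _) Q => a; lra.
  by rewrite pmulr_rge0 // invr_gt0.
rewrite -[f (t + s)](subrK ((1%:M + s *: G) *m f t *m (1%:M + s *: G)^T)) quadD quad_conj.
by rewrite addr_ge0 //; exact: ft.
Unshelve. all: by end_near.
Qed.

Lemma psd_limit (f : R -> 'M[R]_n) (t : R) : 0 < t ->
  (forall j k, {for t, continuous (fun s => f s j k)}) ->
  (forall s, 0 <= s < t -> psd (f s)) -> psd (f t).
Proof.
move=> t0 cf fs u; rewrite leNgt; apply/negP => q0.
have cq : quad (f s) u @[s --> t] --> quad (f t) u.
  rewrite quadE; under eq_fun do rewrite quadE.
  apply: cvg_big => [|j _]; first exact: add_continuous.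
  apply: cvg_big => [|k _]; first exact: add_continuous.
  apply: cvgM; first exact: cvg_cst.
  exact: cf.
have nq : nbhs (t : R) [set s : R | quad (f s) u < 0] by exact: (cvgr_lt _ cq _ q0).
have /nbhs_ballP[r /= r0 rq] := nq.
pose s := Num.max 0 (t - r / 2).
have r2 : 0 < r / 2 by rewrite divr_gt0.
have st : s < t by rewrite gt_max t0 ltrBlDr ltrDl.
have ss : 0 <= s < t by rewrite st andbT le_max lexx.
have := fs s ss u; rewrite leNgt => /negP; apply; apply: rq.
rewrite -ball_normE /= ger0_norm ?subr_ge0 ?ltW //.
have : t - r / 2 <= s by rewrite le_max lexx orbT.
by move: r0 => /=; lra.
Qed.

Lemma psd_propagation (f G H : R -> 'M[R]_n) (eta : R -> R) :
  (forall t, 0 <= t <= 1 -> 0 < eta t) ->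
  (forall t j k, 0 <= t <= 1 ->
    is_derive (t : R^o) 1 (fun s => f s j k) ((G t *m f t + f t *m (G t)^T + H t) j k)) ->
  (forall t u, 0 <= t <= 1 -> eta t * quad 1%:M u <= quad (H t) u) ->
  psd (f 0) -> psd (f 1).
Proof.
move=> e0 df Heta f0; apply: (real_induction (P := fun t => psd (f t))) => // t t1.
  move=> ft; apply: (@psd_step (G t) (H t) f (eta t) t) => //; first exact: e0.
    by move=> j k; exact: df.
  by move=> u; exact: Heta.
case/andP: t1 => t0 t1; apply: psd_limit => // j k.
have [d _] := df t j k (introT andP (conj (ltW t0) t1)).
exact/differentiable_continuous/derivable1_diffP.
Qed.

(** Along the segment [b] solves b' = G b + b G^T, an equation whose flow acts by congruences.
    Instead of constructing that flow, a positive perturbation satisfies the strict inequality of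
    [psd_propagation], and its size is arbitrary. *)
Lemma psd_transport (U : set 'rV[R]_n) (b : 'rV[R]_n -> 'M[R]_n)
    (Gam : 'I_n -> 'rV[R]_n -> 'M[R]_n) (C : R) y y' :
  open U -> (forall j k, smooth_on U (fun z => b z j k)) ->
  (forall i j k z, U z -> 'D_(basis_vec i) (fun z => b z j k) z
      = (Gam i z *m b z + b z *m (Gam i z)^T) j k) ->
  (forall i j k z, U z -> `|Gam i z j k| <= C) ->
  (forall t, 0 <= t <= 1 -> U (y + t *: (y' - y))) ->
  psd (b y) -> psd (b y').
Proof.
move=> oU sb Db GC seg; set w := y' - y.
pose z t := y + t *: w.
have z0 : z 0 = y by rewrite /z scale0r addr0.
have z1 : z 1 = y' by rewrite /z scale1r addrC subrK.
pose G t := \sum_i w 0 i *: Gam i (z t).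
pose D := (\sum_i `|w 0 i|) * C.
have GD t j k : 0 <= t <= 1 -> `|G t j k| <= D.
  move=> t01; rewrite /G summxE /D mulr_suml; apply: le_trans (ler_norm_sum _ _ _) _.
  by apply: ler_sum => i _; rewrite mxE normrM ler_wpM2l //; exact/GC/seg.
(* [b + ep * exp (L t)] has derivative [G f + f G^T] plus a positive definite term. *)
pose L := 2 * (D * n%:R) + 1.
move=> by0 u; apply/ler_addgt0Pl => eps eps0.
pose E t := expR (L * t).
have E0 t : 0 < E t by exact: expR_gt0.
have q1 p : 0 <= quad 1%:M p by rewrite quad1 sumr_ge0 // => j _; exact: sqr_ge0.
have dE (t : R) : is_derive (t : R^o) 1 E (L * E t).
  have dl : is_derive (t : R^o) 1 (fun s : R => L * s) L.
    by apply: is_derive_eq (is_deriveZ (f := id) L (is_derive_id (t : R^o) 1)) _; exact: mulr1.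
  have d := @is_derive1_comp R expR (fun s => L * s) t _ _ (is_derive_expR _) dl.
  by apply: is_derive_eq d _; rewrite mulrC.
(* Chosen so that at time 1 the perturbation contributes at most [eps] on the vector [u]; the
   summand 1 keeps [K] positive. *)
pose K := E 1 * quad 1%:M u + 1.
have K0 : 0 < K by rewrite ltr_wpDl // mulr_ge0 // ltW.
pose ep := eps / K.
have ep0 : 0 < ep by rewrite divr_gt0.
pose f t := b (z t) + (ep * E t) *: 1%:M.
have arith (Q B : 'M[R]_n) a : Q *m (B + a *: 1%:M) + (B + a *: 1%:M) *m Q^T
    + a *: (L%:M - Q - Q^T) = Q *m B + B *m Q^T + (a * L) *: 1%:M.
  rewrite mulmxDr mulmxDl -scalemxAr mulmx1 -scalemxAl mul1mx -scalemx1.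
  by move: (Q *m B) (B *m Q^T) => P P'; apply/matrixP => i k; rewrite !mxE; ring.
have : psd (f 1).
  apply: (@psd_propagation f G (fun t => (ep * E t) *: (L%:M - G t - (G t)^T)) (fun t => ep * E t)).
  - by move=> t _; rewrite mulr_gt0.
  - move=> t j k t01.
    pose Gt := G t; have GtE : G t = Gt by [].
    have d1 : is_derive (t : R^o) 1 (fun s => b (z s) j k) ((Gt *m b (z t) + b (z t) *m Gt^T) j k).
      apply: is_derive_eq (is_derive_smooth_line oU (sb j k) (seg t t01)) _.
      rewrite (derive_smooth_sum w oU (sb j k) (seg t t01)).
      rewrite -/(z t) /Gt /G mulmx_suml linear_sum /= mulmx_sumr -big_split /= summxE.
      apply: eq_bigr => i _; rewrite (Db i j k (z t) (seg t t01)).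
      rewrite linearZ /= -scalemxAl -scalemxAr.
      by move: (Gam i (z t) *m _) (_ *m (Gam i (z t))^T) => P Q; rewrite !mxE mulrDr.
    have d2 := is_deriveZ (ep * (1%:M : 'M[R]_n) j k) (dE t).
    have d := is_deriveD d1 d2.
    have -> : (fun s => f s j k) = (fun s => b (z s) j k) + (ep * (1%:M : 'M[R]_n) j k) \*: E.
      apply/funext => s; rewrite /f [LHS]mxE [X in _ + X]mxE.
      by congr (_ + _); rewrite [RHS]/(_ * _) mulrAC.
    apply: is_derive_eq d _; rewrite /f GtE arith [RHS]mxE [X in _ = _ + X]mxE.
    congr (_ + _); move: (E t) ((1%:M : 'M[R]_n) j k) => et d; rewrite -[LHS]/(_ * _).
    by rewrite [L * et]mulrC mulrA [ep * d * et]mulrAC [LHS]mulrAC.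
  - move=> t p t01; rewrite quadZ; apply: ler_wpM2l; first by rewrite mulr_ge0 // ltW.
    rewrite !quadD !quadN quad_tr -[L%:M]scalemx1 quadZ /L.
    have := quad_bound p (fun j k => GD t j k t01); rewrite ler_norml => /andP[_].
    move: (quad 1%:M p) (quad (G t) p) (D * n%:R) => a q d; lra.
  - move=> p; rewrite /f z0 quadD quadZ; apply: addr_ge0; first exact: by0.
    by apply: mulr_ge0 => //; apply/ltW/mulr_gt0.
move=> /(_ u); rewrite /f z1 quadD quadZ -mulrA => h.
apply: (le_trans h); rewrite addrC lerD2r /ep mulrAC ler_pdivrMr // ler_wpM2l ?(ltW eps0) //.
by rewrite lerDl.
Qed.

End Propagation.

(** * Semidefinite parallel forms on a connected manifold *)

Section ParallelForms.
Context {R : realType} {n : nat} {M : topologicalType}.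
Variable mfd : smooth_structure R n M.
Hypothesis hM : hausdorff_space M.
Implicit Types (c : chart R n M) (x : M) (y u : 'rV[R]_n) (K : M -> 'M[R]_n).
Local Notation e := (@basis_vec R n).
Local Notation atlas := (atlas mfd).
Local Notation bilc := (bil_in_chart mfd).

Lemma psd_congr (P F : 'M[R]_n) : F \in unitmx -> psd (F *m P *m F^T) <-> psd P.
Proof.
move=> uF; split => h u; last by rewrite quad_conj; exact: h.
by have := h (u *m invmx F); rewrite quad_conj mulmxKV.
Qed.

Lemma psd_in_chart c K y : atlas c -> chart_image c y ->
  psd (bilc c K y) <-> psd (K (chart_inv c y)).
Proof. by move=> ac cy; apply: psd_congr; exact: frame_inv_unit. Qed.

Lemma segment_in_ball y0 y y' (r t : R) : ball y0 r y -> ball y0 r y' -> 0 <= t <= 1 ->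
  ball y0 r (y + t *: (y' - y)).
Proof.
rewrite -!ball_normE /= => hy hy' /andP[t0 t1].
have -> : y0 - (y + t *: (y' - y)) = (1 - t) *: (y0 - y) + t *: (y0 - y').
  by apply/matrixP => i j; rewrite !mxE; ring.
have [->|tne] := eqVneq t 0; first by rewrite subr0 scale1r scale0r addr0.
have tp : 0 < t by rewrite lt_neqAle eq_sym tne.
apply: (le_lt_trans (ler_normD _ _)); rewrite !normrZ (ger0_norm t0) ger0_norm ?subr_ge0 //.
have -> : r = (1 - t) * r + t * r by ring.
by apply: ler_ltD; [rewrite ler_wpM2l ?subr_ge0 // ltW|rewrite ltr_pM2l].
Qed.

Variables (g : M -> 'M[R]_n) (nabla : (M -> 'rV[R]_n) -> M -> 'M[R]_n).
Hypothesis hLC : is_levi_civita mfd g nabla.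
Let hnabla := levi_civita_connection hLC.
Local Notation parallel_bil := (parallel_bil mfd nabla).

Lemma psd_parallel_near K c y0 : parallel_bil K -> atlas c -> chart_image c y0 ->
  exists V, [/\ open V, V y0, V `<=` chart_image c &
    forall y y', V y -> V y' -> psd (bilc c K y) -> psd (bilc c K y')].
Proof.
move=> pK ac cy.
have [V [Gam [[oV Vy Vc] sG _ DG]]] := exists_christoffel hM hnabla (torsion_free hLC) ac cy.
(* The extra 1 makes the bound strict at [y0] for every symbol, so it persists on a ball, where
   segments stay inside by convexity. *)
pose C := \sum_(p : 'I_n * ('I_n * 'I_n)) (`|Gam p.1 y0 p.2.1 p.2.2| + 1).
have near1 (p : 'I_n * ('I_n * 'I_n)) : \forall z \near y0, `|Gam p.1 z p.2.1 p.2.2| < C.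
  have cG : `|Gam p.1 z p.2.1 p.2.2| @[z --> y0] --> `|Gam p.1 y0 p.2.1 p.2.2|.
    have h := smooth_on_continuous (sG p.1 p.2.1 p.2.2) Vy.
    exact: (cvg_norm (f := fun z => Gam p.1 z p.2.1 p.2.2) h).
  have pC : `|Gam p.1 y0 p.2.1 p.2.2| + 1 <= C.
    by rewrite /C (bigD1 p) //= lerDl; apply: sumr_ge0 => q _; rewrite addr_ge0.
  by apply: (cvgr_lt _ cG); apply: lt_le_trans pC; rewrite ltrDl.
have nearA : nbhs y0 [set z | V z /\ forall p : 'I_n * ('I_n * 'I_n), `|Gam p.1 z p.2.1 p.2.2| < C].
  apply: filterI; first exact: open_nbhs_nbhs.
  exact: (@filter_forall _ _ _ (nbhs y0) _ near1).
have /nbhs_ballP[r /= r0 rA] := nearA.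
exists (ball y0 r); split; [exact: ball_open|exact: ballxx|by move=> z /rA[/Vc]|].
move=> y y' ry ry'.
apply: (@psd_transport _ _ (ball y0 r) (bilc c K) Gam C); first exact: ball_open.
- move=> j k; apply: smooth_on_subset (pK.1 c ac j k) => z /rA[/Vc]; exact.
- by move=> i j k z /rA[Vz _]; exact: DG.
- by move=> i j k z /rA[_ /(_ (i, (j, k)))/ltW].
- by move=> t t01; exact: segment_in_ball.
Qed.

(** The local statement is symmetric in its two points, so it shows that the set of points where [K]
    is semidefinite is both open and closed. Passing between charts is a congruence and preserves
    semidefiniteness. *)
Lemma psd_parallel K x x' : connected [set: M] -> parallel_bil K -> psd (K x) -> psd (K x').
Proof.
move=> conn pK Kx.
have loc p : exists N, [/\ open N, N p & forall q q', N q -> N q' -> psd (K q) -> psd (K q')].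
  set c := chart_at mfd p; have ac : atlas c := chart_at_atlas mfd p.
  have dp : dom c p := chart_at_dom mfd p.
  have [V [oV Vp Vc VK]] := psd_parallel_near pK ac (image_chart_map dp).
  exists (dom c `&` chart_map c @^-1` V); split => //.
    rewrite openE => q [dq Vq].
    have cq : {for q, continuous (chart_map c)}.
      by apply: (chart_map_continuous (atlas_chart ac)); rewrite inE.
    have n1 := open_nbhs_nbhs (conj (dom_open (atlas_chart ac)) dq).
    have n2 := cq _ (open_nbhs_nbhs (conj oV Vq)).
    by apply: filterS (filterI n1 n2) => z [].
  move=> q q' [dq Vq] [dq' Vq'].
  have := VK _ _ Vq Vq'.
  have E p' : dom c p' -> psd (bilc c K (chart_map c p')) <-> psd (K p').
    move=> dp'; rewrite -[X in _ <-> psd (K X)](chart_mapK' ac dp').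
    exact: psd_in_chart ac (image_chart_map dp').
  by move=> h /(E q dq)/h/(E q' dq').
pose A := [set p | psd (K p)].
have oA : open A.
  rewrite openE => p Ap; have [N [oN Np NK]] := loc p.
  apply: filterS (open_nbhs_nbhs (conj oN Np)) => q Nq; exact: NK Np Nq Ap.
have cA : closed A.
  rewrite -[A]setCK; apply: open_closedC; rewrite openE => p nAp; have [N [oN Np NK]] := loc p.
  by apply: filterS (open_nbhs_nbhs (conj oN Np)) => q Nq Aq; apply: nAp; exact: NK Nq Np Aq.
have AT : A = setT.
  apply: conn; first by exists x.
    by exists A => //; rewrite setTI.
  by exists A => //; rewrite setTI.
by have : A x' by rewrite AT.
Qed.

Lemma quad_eq0 (P : 'M[R]_n) : P^T = P -> (forall u, quad P u = 0) -> P = 0.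
Proof.
move=> sP P0.
have E j k : P j k = (e j *m P *m (e k)^T) 0 0 by rewrite basis_bilinear.
apply/matrixP => j k; rewrite [RHS]mxE.
have := P0 (e j + e k); rewrite /quad linearD /= mulmxDl mulmxDl !mulmxDr.
have Ej := P0 (e j); have Ek := P0 (e k); rewrite /quad in Ej Ek.
have Ps : P k j = P j k by rewrite -[in LHS]sP mxE.
have aD (Q1 Q2 : 'M[R]_1) : (Q1 + Q2) 0 0 = Q1 0 0 + Q2 0 0 by rewrite mxE.
rewrite !aD Ej Ek -!E Ps add0r addr0; lra.
Qed.

End ParallelForms.

(** * Vanishing of the J-invariant part *)

Section InvariantPart.
Context {R : realType} {n : nat} {M : topologicalType}.
Variable mfd : smooth_structure R n M.
Hypotheses (hM : hausdorff_space M) (cM : compact [set: M]) (connM : connected [set: M]).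
Variables (g : M -> 'M[R]_n) (nabla : (M -> 'rV[R]_n) -> M -> 'M[R]_n).
Variable J : M -> 'M[R]_n.
Hypothesis hK : is_pseudo_kahler mfd g nabla J.
Hypothesis ddbar : deldelbar_property mfd J.
Let hLC := kahler_levi_civita hK.
Let sJ := kahler_J_smooth hK.
Let pJ := kahler_J_parallel hK.
Let JJ := kahler_J_sqr hK.
Local Notation parallel_bil := (parallel_bil mfd nabla).

Lemma invariant_part_eq0 X : smooth_vf mfd X ->
  parallel_bil (Jplus J (ext_d_flat g nabla X)) ->
  forall x, Jplus J (ext_d_flat g nabla X) x = 0.
Proof.
move=> sX pp x.
have [lam [lam00 [W E]]] := invariant_part_potential hM hK ddbar sX pp.
have [[x1 h1] [x2 h2]] := semidefinite_points sJ JJ lam00 x cM E.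
pose F := Jplus J (ext_d_flat g nabla X); pose b p := F p *m (J p)^T.
have pb : parallel_bil b.
  have -> : b = fun p => (J p *m (F p)^T)^T.
    by apply/funext => p; rewrite trmx_mul trmxK.
  exact/parallel_bilT/(parallel_bilM sJ pJ)/parallel_bilT.
have FT p : (F p)^T = - F p by apply: Jplus_anti; exact: ext_d_flat_anti.
have FJ p : F p *m (J p)^T = - (J p *m F p).
  have JFJ : J p *m F p *m (J p)^T = F p.
    rewrite /F /Jplus mulmxDr mulmxDl -(mulmxA (J p) (ext_d_flat _ _ _ _)) (JJmul hK).
    by rewrite mulNmx (mulJJTl hK) opprK addrC.
  by rewrite -[in LHS]JFJ (mulJJTl hK).
have bT : (b x)^T = b x by rewrite /b trmx_mul trmxK FT FJ mulmxN.
have nb : psd (- b x).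
  have h : psd (- b x1) by move=> w; rewrite quadN oppr_ge0; exact: h1.
  exact: (psd_parallel hM hLC x connM (parallel_bilN pb) h).
have pb0 : psd (b x) := psd_parallel hM hLC x connM pb h2.
have b0 : b x = 0.
  apply: quad_eq0 bT _ => u; apply/le_anti; rewrite pb0 andbT.
  by have := nb u; rewrite quadN oppr_ge0.
by apply: oppr_inj; rewrite -(mulJJTl hK x) -/(F x) -/(b x) b0 mul0mx oppr0.
Qed.

End InvariantPart.

(** * Affine fields on compact pseudo-Kaehler manifolds *)

(** The hypothesis on [j *m s] gives two expansions of [j *m s *m s], according to which factor [s]
    is replaced by a commutator; their sum is the left-hand side. In [S_sqr], [q] is the matrix of d
    of g(JSv, .) before multiplication by [g]. *)
Lemma J_average_square (F : fieldType) n (j a s : 'M[F]_n) :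
  j *m j = - 1%:M -> s *m j = - (j *m s) -> j *m s = j *m a - a *m j ->
  let q := a *m s *m j + j *m s *m (j *m a *m j) in
  q - j *m q *m j = 2 *: (j *m s *m s).
Proof.
move=> jj sj js q.
have jjr m (P : 'M_(m, n)) : P *m j *m j = - P by rewrite -mulmxA jj mulmxN mulmx1.
have H1 : a *m s *m j = - (a *m j *m s) by rewrite -mulmxA sj mulmxN mulmxA.
have H2 : j *m s *m (j *m a *m j) = s *m a *m j.
  by rewrite -[j *m s]opprK -sj mulNmx !mulmxA jjr !mulNmx opprK.
have H3 : j *m (a *m s *m j) *m j = - (j *m a *m s) by rewrite mulmxA jjr mulmxA.
have H4 : j *m (s *m a *m j) *m j = s *m j *m a by rewrite mulmxA jjr mulmxA sj mulNmx.
have E1 : j *m s *m s = j *m a *m s - a *m j *m s by rewrite {1}js mulmxBl.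
have E2 : j *m s *m s = s *m a *m j - s *m j *m a.
  by rewrite -[j *m s]opprK -sj mulNmx -[s *m j *m s]mulmxA js mulmxBr !mulmxA opprB.
rewrite scaler_nat mulr2n {1}E1 E2 /q H2 mulmxDr mulmxDl H3 H4 H1 opprD opprK.
by rewrite addrACA [- _ + _]addrC.
Qed.

Section AffineFields.
Context {R : realType} {n : nat} {M : topologicalType}.
Variable mfd : smooth_structure R n M.
Hypotheses (hM : hausdorff_space M) (cM : compact [set: M]) (connM : connected [set: M]).
Variables (g : M -> 'M[R]_n) (nabla : (M -> 'rV[R]_n) -> M -> 'M[R]_n).
Variable J : M -> 'M[R]_n.
Hypothesis hK : is_pseudo_kahler mfd g nabla J.
Hypothesis ddbar : deldelbar_property mfd J.
Implicit Types (x : M) (X Y : M -> 'rV[R]_n) (B C K : M -> 'M[R]_n).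
Local Notation parallel_bil := (parallel_bil mfd nabla).
Local Notation parallel_endo := (parallel_endo mfd nabla).
Local Notation smooth_vf := (smooth_vf mfd).
Let hg := kahler_metric hK.
Let hLC := kahler_levi_civita hK.
Let sJ := kahler_J_smooth hK.
Let pJ := kahler_J_parallel hK.
Let JJ := kahler_J_sqr hK.

Lemma parallel_endoM B C : smooth_endo mfd B -> parallel_endo B -> parallel_endo C ->
  parallel_endo (fun x => B x *m C x).
Proof.
move=> sB pB pC Y sY x; rewrite mulmxA -(pB Y sY) -(pC _ (smooth_vfM sY sB)).
by congr (nabla _ x); apply/funext => y; rewrite mulmxA.
Qed.

Lemma parallel_Jconj K : parallel_bil K -> parallel_bil (fun x => J x *m K x *m (J x)^T).
Proof.
move=> pK.
have -> : (fun x => J x *m K x *m (J x)^T) = fun x => (J x *m (J x *m K x)^T)^T.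
  by apply/funext => x; rewrite [RHS]trmx_mul trmxK.
exact/parallel_bilT/(parallel_bilM sJ pJ)/parallel_bilT/(parallel_bilM sJ pJ).
Qed.

Lemma parallel_ext_d_flat_eq0 X : smooth_vf X -> parallel_bil (ext_d_flat g nabla X) ->
  forall x, ext_d_flat g nabla X x = 0.
Proof.
move=> sX pK x; have pC := parallel_Jconj pK.
have := anti_invariant_part_eq0 hM hK ddbar sX (parallel_bilD pK (parallel_bilN pC)) x.
have := invariant_part_eq0 hM cM connM hK ddbar sX (parallel_bilD pK pC) x.
rewrite /Jminus /Jplus; move: (ext_d_flat g nabla X x) (J x *m _ *m _) => P Q PQ PQ'.
have : 2 *: P = 0 by rewrite scaler_nat mulr2n -[RHS]addr0 -{1}PQ -PQ' addrACA subrr addr0.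
by move/eqP; rewrite scaler_eq0 pnatr_eq0 => /eqP.
Qed.

Variable v : M -> 'rV[R]_n.
Hypotheses (sv : smooth_vf v) (av : affine_vf mfd nabla v).
Let A := nabla v.
(** An algebraic substitute for A + A^*, to which [adjoint_A] identifies it afterwards. In this form
    it anticommutes with J by construction, and [J S] is the commutator known to be parallel. *)
Let S x := A x + J x *m A x *m J x.

Lemma S_anticommutes x : S x *m J x = - (J x *m S x).
Proof.
by rewrite /S mulmxDl mulmxDr (mulJJl hK) !mulmxA JJ mulNmx mul1mx mulNmx opprD opprK addrC.
Qed.

Lemma JS_commutator x : J x *m S x = J x *m A x - A x *m J x.
Proof. by rewrite /S mulmxDr !mulmxA JJ mulNmx mul1mx mulNmx. Qed.

Lemma smooth_S : smooth_endo mfd S.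
Proof.
have sA := smooth_A hLC sv.
exact: (smooth_endoD sA (smooth_endoM (smooth_endoM sJ sA) sJ)).
Qed.

Lemma parallel_JS : parallel_endo (fun x => J x *m S x).
Proof.
under eq_fun do rewrite JS_commutator.
exact: (affine_parallel_commutator hM hLC sv av sJ pJ).
Qed.

Lemma parallel_S : parallel_endo S.
Proof.
have -> : S = fun x => J x *m S x *m J x.
  by apply/funext => x; rewrite -mulmxA S_anticommutes mulmxN (JJmul hK) opprK.
exact: (parallel_endoM (smooth_endoM sJ smooth_S) parallel_JS pJ).
Qed.

(* d of the 1-form g(Jv, .) is parallel, hence zero *)
Lemma adjoint_A x : adjoint g A x = J x *m A x *m J x.
Proof.
pose vJ p := v p *m J p.
(* Writing [A J] as [J A - J S] leaves [J] applied to the g-symmetric part of A; both summands are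
   parallel even if A is not. *)
have KE p : ext_d_flat g nabla vJ p
    = - (J p *m S p *m g p) + J p *m (A p *m g p + g p *m (A p)^T).
  rewrite /ext_d_flat /vJ (pJ sv) JS_commutator !trmx_mul (Defs.metric_sym hg) mulmxA.
  rewrite (hermitian_gJ hK) mulNmx opprK mulmxBl opprB mulmxDr !mulmxA addrA.
  by rewrite subrK.
have pK : parallel_bil (ext_d_flat g nabla vJ).
  have -> : ext_d_flat g nabla vJ
    = fun p => - (J p *m S p *m g p) + J p *m (A p *m g p + g p *m (A p)^T).
    exact/funext.
  apply: parallel_bilD.
    apply/parallel_bilN/(parallel_bilM _ parallel_JS (parallel_metric hM hg hLC)).
    exact: smooth_endoM sJ smooth_S.
  exact: (parallel_bilM sJ pJ (affine_parallel_flat hM hg hLC sv av)).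
have := parallel_ext_d_flat_eq0 (smooth_vfM sv sJ) pK x.
rewrite KE /adjoint JS_commutator mulmxBl opprB mulmxDr !mulmxA addrA subrK => h.
have E : A x *m J x *m g x = - (J x *m g x *m (A x)^T) by apply/eqP; rewrite -addr_eq0 h.
rewrite -[RHS](mulmxK (metric_nondegenerate hg x)); congr (_ *m _).
by rewrite -!mulmxA [A x *m _]mulmxA E mulmxN -!mulmxA (JJmul hK) opprK.
Qed.

Lemma SE x : A x + adjoint g A x = S x.
Proof. by rewrite adjoint_A. Qed.

Lemma S_g x : S x *m g x = A x *m g x + g x *m (A x)^T.
Proof. by rewrite -SE mulmxDl /adjoint mulmxKV // (metric_nondegenerate hg). Qed.

Lemma S_g_sym x : g x *m (S x)^T = S x *m g x.
Proof.
by rewrite -{1}(Defs.metric_sym hg) -trmx_mul S_g linearD /= !trmx_mul trmxK (Defs.metric_sym hg) addrC.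
Qed.

(* up to a factor, g(J S^2 ., .) is the J-invariant part of d of the 1-form g(JSv, .) *)
Lemma S_sqr x : S x *m S x = 0.
Proof.
pose X p := v p *m S p *m J p.
have sX : smooth_vf X by exact: (smooth_vfM (smooth_vfM sv smooth_S) sJ).
have KE p : Jplus J (ext_d_flat g nabla X) p = 2 *: (J p *m (S p *m (S p *m g p))).
  have N : nabla X p *m g p = A p *m S p *m J p *m g p.
    by rewrite /X (pJ (smooth_vfM sv smooth_S)) (parallel_S sv).
  have gAT : g p *m (A p)^T = J p *m A p *m J p *m g p.
    by rewrite -adjoint_A /adjoint mulmxKV // (metric_nondegenerate hg).
  have gJ := hermitian_gJ hK p.
  have NT : (nabla X p *m g p)^T = - (J p *m S p *m (J p *m A p *m J p) *m g p).
    rewrite N !trmx_mul (Defs.metric_sym hg) (mulmxA (g p)) gJ mulNmx -!mulmxA.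
    rewrite (mulmxA (g p)) S_g_sym -!mulmxA gAT.
    by rewrite !mulmxA.
  rewrite /Jplus /ext_d_flat NT opprK N.
  (* As J is g-skew, averaging the form [Q g] over J amounts to [Q - J Q J] on endomorphisms, the
     expression in [J_average_square]. *)
  have conj Q : J p *m (Q *m g p) *m (J p)^T = - (J p *m Q *m J p *m g p).
    by rewrite -!mulmxA gJ !mulmxN.
  rewrite -mulmxDl conj -mulNmx -mulmxDl (J_average_square (JJ p) (S_anticommutes p)) //.
    by rewrite -scalemxAl -!mulmxA.
  exact: JS_commutator.
have pK : parallel_bil (Jplus J (ext_d_flat g nabla X)).
  have -> : Jplus J (ext_d_flat g nabla X) = fun p => 2 *: (J p *m (S p *m (S p *m g p))).
    exact/funext.
  have pg := parallel_metric hM hg hLC; have sS := smooth_S; have pS := parallel_S.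
  exact/parallel_bilZ/(parallel_bilM sJ pJ)/(parallel_bilM sS pS)/(parallel_bilM sS pS pg).
have := invariant_part_eq0 hM cM connM hK ddbar sX pK x.
rewrite KE => /eqP; rewrite scaler_eq0 pnatr_eq0 /= => /eqP h.
have {}h : S x *m (S x *m g x) = 0.
  by apply: oppr_inj; rewrite -(JJmul hK x) h mulmx0 oppr0.
by rewrite -[LHS](mulmxK (metric_nondegenerate hg x)) -[S x *m _ *m g x]mulmxA h mul0mx.
Qed.

(** Torsion-freeness replaces the brackets by covariant derivatives, and the Lie derivative of [g]
    becomes the form [S g], with [g] invertible. *)
Lemma killing_iff : killing_vf mfd g v <-> forall x, S x = 0.
Proof.
have E X Y x : smooth_vf X -> smooth_vf Y ->
    dir_derive mfd x (v x) (pair_with g X Y) - pair_with g (lie_bracket mfd v X) Y x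
    - pair_with g X (lie_bracket mfd v Y) x
    = (X x *m (S x *m g x) *m (Y x)^T) 0 0.
  move=> sX sY; rewrite (metric_compatible hLC sv sX sY) /pair_with.
  rewrite -(torsion_free hLC sv sX) -(torsion_free hLC sv sY) pair00Bl pair00Br.
  have -> : (X x *m (S x *m g x) *m (Y x)^T) 0 0
      = (cov nabla X v x *m g x *m (Y x)^T) 0 0 + (X x *m g x *m (cov nabla Y v x)^T) 0 0.
    by rewrite /cov S_g mulmxDr mulmxDl add00 trmx_mul !mulmxA.
  have ar (a b c d : R) : a + b - (a - c) - (b - d) = c + d by ring.
  exact: ar.
split => [kv x|S0 X Y sX sY x]; last by rewrite E // S0 mul0mx mulmx0 mul0mx mxE.
have h : S x *m g x = 0.
  apply: (vf_mx_eq (mfd := mfd) hM (x := x)) => X sX; rewrite mulmx0.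
  apply: trmx_inj; apply: (vf_mx_eq (mfd := mfd) hM (x := x)) => Y sY.
  rewrite trmx0 mulmx0; apply: trmx_inj; rewrite trmx_mul trmxK trmx0.
  by apply/matrixP => i j; rewrite !ord1 -E // [RHS]mxE; exact: kv.
by rewrite -[LHS](mulmxK (metric_nondegenerate hg x)) h mul0mx.
Qed.

(** In the same way the Lie derivative of J is [- J S], and J is invertible. *)
Lemma real_holomorphic_iff : real_holomorphic_vf mfd J v <-> forall x, S x = 0.
Proof.
have E X x : smooth_vf X ->
    lie_bracket mfd v (fun y => X y *m J y) x - lie_bracket mfd v X x *m J x
    = - (X x *m (J x *m S x)).
  move=> sX; rewrite -(torsion_free hLC sv (smooth_vfM sX sJ)) -(torsion_free hLC sv sX).
  rewrite /cov (pJ sX) JS_commutator mulmxBr mulmxBl !mulmxA.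
  by move: (v x *m _ *m _) (X x *m J x *m _) (X x *m _ *m J x) => a b c; apply/matrixP => i j; rewrite !mxE; ring.
split => [hv x|S0 X sX x]; last by rewrite E // S0 !mulmx0 oppr0.
have h : J x *m S x = 0.
  apply: (vf_mx_eq (mfd := mfd) hM (x := x)) => X sX; rewrite mulmx0.
  by apply: oppr_inj; rewrite -E // hv // oppr0.
by apply: oppr_inj; rewrite -(JJmul hK x) h mulmx0 oppr0.
Qed.

(** The adjoint has the trace of A, while J A J has the opposite trace. *)
Lemma divergence_eq0 x : divergence nabla v x = 0.
Proof.
rewrite /divergence -/(A x).
have : \tr (adjoint g A x) = - \tr (A x).
  by rewrite adjoint_A mxtrace_mulC mulmxA JJ mulNmx mul1mx linearN.
rewrite /adjoint mxtrace_mulC mulmxA mulVmx ?(metric_nondegenerate hg) // mul1mx mxtrace_tr.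
by move: (\tr _) => a h; lra.
Qed.

End AffineFields.

Local Close Scope complex_scope.

Theorem theorem5p1 (R : realType) (n : nat) (M : topologicalType)
    (mfd : smooth_structure R n M)
    (g : M -> 'M[R]_n) (nabla : (M -> 'rV[R]_n) -> M -> 'M[R]_n)
    (J : M -> 'M[R]_n) (v : M -> 'rV[R]_n) :
  hausdorff_space M -> compact [set: M] -> connected [set: M] ->
  is_pseudo_kahler mfd g nabla J ->
  deldelbar_property mfd J ->
  smooth_vf mfd v -> affine_vf mfd nabla v ->
  let A := nabla v in
  let Astar := adjoint g A in
  (forall x, Astar x = J x *m A x *m J x) /\
  (forall x, (A x - Astar x) *m J x = J x *m (A x - Astar x)) /\
  (forall x, (A x + Astar x) *m J x = - (J x *m (A x + Astar x))) /\
  (parallel_endo mfd nabla (fun x => A x + Astar x) /\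
   forall x, exists k : nat, (A x + Astar x) ^+ k = 0) /\
  (forall x, divergence nabla v x = 0) /\
  (killing_vf mfd g v <-> real_holomorphic_vf mfd J v).
Proof.
move=> hM cM connM hK ddbar sv av A Astar.
have aE x : Astar x = J x *m A x *m J x := adjoint_A hM cM connM hK ddbar sv av x.
have JJ := kahler_J_sqr hK.
split=> //; split.
  move=> x; rewrite aE mulmxBl mulmxBr -[J x *m A x *m J x *m J x]mulmxA JJ mulmxN mulmx1.
  by rewrite !mulmxA JJ mulNmx mul1mx mulNmx !opprK addrC.
have SE : (fun x => A x + Astar x) = fun x => A x + J x *m A x *m J x.
  by apply/funext => x; rewrite aE.
split; first by move=> x; rewrite aE; exact: (S_anticommutes hK v x).
split.
  split; first by rewrite SE; exact: (parallel_S hM hK sv av).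
  move=> x; exists 2; rewrite aE expr2.
  exact: (S_sqr hM cM connM hK ddbar sv av x).
split; first exact: (divergence_eq0 hM cM connM hK ddbar sv av).
(* Both conditions on [v] say that S vanishes identically. *)
rewrite (killing_iff hM cM connM hK ddbar sv av).
by rewrite (real_holomorphic_iff hM hK sv).
Qed.
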